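(* Let $d\le n$ be natural numbers, let $\alpha_{ij}\in\mathbb{R}$ for $1\le i\le d$, $1\le j\le n$ (not necessarily non-negative), and let $X_j$, $1\le j\le n$, be independent, non-negative random variables that are regularly varying with index $-1$ and bounded away from $0$. Put $Y_i:=\prod_{j=1}^nX_j^{\alpha_{ij}}$, $1\le i\le d$. If the optimization problem $$\sum_{j=1}^n\kappa_j\to\min!\quad\text{under the constraints}\quad\sum_{j=1}^n\alpha_{ij}\kappa_j\ge1\ \ \forall\,1\le i\le d,\quad\kappa_j\ge0\ \ \forall\,1\le j\le n,$$ has a solution $(\kappa_j)_{1\le j\le n}$, then for all $\varepsilon>0$, as $x\to\infty$, $$P(Y_i>x\ \forall\,1\le i\le d)=o\bigl(x^{\varepsilon-\sum_{j=1}^n\kappa_j}\bigr),\qquad x^{-\varepsilon-\sum_{j=1}^n\kappa_j}=o\bigl(P(Y_i>x\ \forall\,1\le i\le d)\bigr).$$ Now suppose, in addition, that the solution is unique and that $J:=\{j:\kappa_j>0\}$ has exactly $d$ elements. Then the matrix $\mathbf{A}:=(\alpha_{ij})_{1\le i\le d,\,j\in J}$ is invertible. If all entries $A^{-1}_{ji}$ ($j\in J$, $1\le i\le d$) of its inverse $\mathbf{A}^{-1}$ are positive, then for all $s_i>0$, $1\le i\le d$, $$\lim_{x\to\infty}\frac{P(Y_i>s_ix\ \forall\,1\le i\le d)}{\prod_{j\in J}P(X_j>x^{\kappa_j})}=D\prod_{i=1}^ds_i^{-\sum_{j\in J}A^{-1}_{ji}}$$ with $$D:=\frac{1}{|\det\mathbf{A}|}\,\frac{\prod_{k\notin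 J}E\Bigl(X_k^{\sum_{j\in J}\sum_{i=1}^dA^{-1}_{ji}\alpha_{ik}}\Bigr)}{\prod_{i=1}^d\sum_{j\in J}A^{-1}_{ji}}.$$
   Context: A non-negative random variable $X$ is regularly varying with index $-1$ if $P(X>x)>0$ for all $x$ and $P(X>sx)/P(X>x)\to s^{-1}$ as $x\to\infty$ for every $s>0$. ''Bounded away from $0$'' means that there is $\delta>0$ with $X_j\ge\delta$ almost surely for all $j$. An empty product equals $1$; ''$k\notin J$'' ranges over $k\in\{1,\dots,n\}\setminus J$. *)

(* Defs.v *)
From HB Require Import structures.
From mathcomp Require Import all_boot all_order all_algebra.
From mathcomp Require Import all_classical all_reals all_analysis.

Set Implicit Arguments.
Unset Strict Implicit.
Unset Printing Implicit Defensive.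

Import Order.TTheory GRing.Theory Num.Theory.
Import numFieldNormedType.Exports.

Local Open Scope classical_set_scope.
Local Open Scope ring_scope.

(** Makes the Landau notation [f =o_+oo g] available. *)
Canonical pinfty_filter_on (R : realType) : filter_on R :=
  FilterType (pinfty_nbhs R) _.

Definition lp_feasible (R : realType) (d n : nat) (alpha : 'M[R]_(d, n))
    (kappa : 'I_n -> R) : Prop :=
  (forall i, 1 <= \sum_j alpha i j * kappa j) /\ (forall j, 0 <= kappa j).

Definition lp_solution (R : realType) (d n : nat) (alpha : 'M[R]_(d, n))
    (kappa : 'I_n -> R) : Prop :=
  lp_feasible alpha kappa /\
  forall kappa', lp_feasible alpha kappa' -> \sum_j kappa j <= \sum_j kappa' j.

Definition pos_support (R : realType) (n : nat) (kappa : 'I_n -> R) :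
    {set 'I_n} :=
  [set j | 0 < kappa j]%SET.

(** The columns of [alpha] with index in [J], as a square matrix: the column
    number [l] stands for the [l]-th element of [J] in increasing order. *)
Definition cols_of (R : realType) (d n : nat) (alpha : 'M[R]_(d, n))
    (J : {set 'I_n}) (cardJ : #|J| = d) : 'M[R]_d :=
  \matrix_(i, l) alpha i (enum_val (cast_ord (esym cardJ) l)).

Definition regularly_varying_m1 (disp : measure_display)
    (T : measurableType disp) (R : realType) (P : probability T R)
    (X : {RV P >-> R}) : Prop :=
  [/\ {ae P, forall w, 0 <= X w},
      forall x : R, (0 < ccdf X x)%E &
      forall s : R, 0 < s ->
        fine (ccdf X (s * x)) / fine (ccdf X x) @[x --> +oo] --> s^-1].

Definition independent_RVs (disp : measure_display)
    (T : measurableType disp) (R : realType) (P : probability T R) (n : nat)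
    (X : 'I_n -> {RV P >-> R}) : Prop :=
  forall (K : {set 'I_n}) (B : 'I_n -> set R),
    (forall j, measurable (B j)) ->
    P [set w | forall j, j \in K -> B j (X j w)] =
    (\prod_(j in K) P (X j @^-1` B j))%E.

Definition bounded_away_from0 (disp : measure_display)
    (T : measurableType disp) (R : realType) (P : probability T R) (n : nat)
    (X : 'I_n -> {RV P >-> R}) : Prop :=
  exists2 delta : R, 0 < delta &
    forall j, {ae P, forall w, delta <= X j w}.

(** When [X] is bounded away from 0 the conventions of [powR] at nonpositive
    bases only matter on a null set. *)
Definition power_prod (disp : measure_display)
    (T : measurableType disp) (R : realType) (P : probability T R) (d n : nat)
    (alpha : 'M[R]_(d, n)) (X : 'I_n -> {RV P >-> R}) (i : 'I_d) (w : T) : R :=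
  \prod_(j < n) X j w `^ alpha i j.

Definition joint_tail (disp : measure_display)
    (T : measurableType disp) (R : realType) (P : probability T R) (d : nat)
    (Y : 'I_d -> T -> R) (u : 'I_d -> R) : R :=
  fine (P [set w | forall i, u i < Y i w]).

(** [\sum_(j in J) \sum_i A^-1 j i * alpha i k]: here and below a sum over
    [j in J] is a sum over the row number [l] of [invmx A]. *)
Definition moment_exponent (R : realType) (d n : nat) (alpha : 'M[R]_(d, n))
    (A : 'M[R]_d) (k : 'I_n) : R :=
  \sum_l \sum_i invmx A l i * alpha i k.

Definition power_moment (disp : measure_display)
    (T : measurableType disp) (R : realType) (P : probability T R)
    (X : {RV P >-> R}) (e : R) : \bar R :=
  'E_P[fun w => (X w `^ e)%R]%E.

(** Real-valued; meaningful when the expectations are finite, as [fine] sends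
    [+oo] to [0]. *)
Definition limit_constant (disp : measure_display)
    (T : measurableType disp) (R : realType) (P : probability T R) (d n : nat)
    (alpha : 'M[R]_(d, n)) (X : 'I_n -> {RV P >-> R}) (J : {set 'I_n})
    (A : 'M[R]_d) : R :=
  `|\det A|^-1 *
  (\prod_(k | k \notin J)
      fine (power_moment (X k) (moment_exponent alpha A k))
   / \prod_i \sum_l invmx A l i).

(* Main.v *)
(**
With [L_j = ln X_j] and [N = ln x] the event becomes [sum_j alpha_ij L_j > N] for
all [i]. Up to the lower bound of the [L_j], the vector [L_j^+ / N] is then feasible
for the linear program, so [sum_j L_j^+ >= N K] with [K = sum_j kappa_j], and
Markov's inequality gives the upper bound; boxes around [(1 + eta) kappa_j N] give
the lower one.

If the solution is unique and [|J| = d], a kernel vector of [A] would give other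
solutions, so [A] is invertible; perturbing [kappa] shows [kappa_J = A^-1 1] and,
for [k] not in [J], that the moment exponent of [X_k] is smaller than [1]. Writing
[L_j = kappa_j N + t_j] for [j] in [J] by means of quantile functions, the normalised
probability becomes an integral against [exp (- sum_j t_j) dt] of the indicator of a
set converging to the cone [A t > c - Z], where [Z] depends on the [X_k] with [k] not
in [J] only. As [A^-1 > 0], the cone lies in the orthant [t > A^-1 (c - Z)], whose mass
factorises and converges by Potter's bounds and dominated convergence; Fatou's lemma
for the cone and for its complement in the orthant then gives the limit. The change
of variables [u = A t] computes the mass of the cone.
*)

Require Import Defs.
From HB Require Import structures.
From mathcomp Require Import all_boot all_order all_algebra.
From mathcomp Require Import all_classical all_reals all_analysis.
From mathcomp Require Import measurable_realfun lra ring.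

Set Implicit Arguments.
Unset Strict Implicit.
Unset Printing Implicit Defensive.

Import Order.TTheory GRing.Theory Num.Theory.
Import numFieldNormedType.Exports.

Local Open Scope classical_set_scope.
Local Open Scope ring_scope.

(** The laws of the [L_j] need not have densities, so the limit cannot be read off from convergence
    of densities. Every law is however the image of the exponential law under its quantile function,
    and after this substitution division by the tail at [kappa_j N] is a mere translation of the
    exponential variable; regular variation says that the translated quantile functions converge to
    the identity. The indicator of the cone in these coordinates has no convenient integrable
    majorant. The orthant is a product of rays, so its mass given [Z] is exactly a product of tail
    ratios, and domination is only needed for this function of [Z]. Potter's bounds cost a small
    multiple of [|Z|] in the exponent, which is paid for by the strict inequality between the moment
    exponents and 1. Fatou's lemma, which needs no majorant, bounds cone and complement from below;
    as the total mass is known to converge, neither bound can be strict. Vectors are functions on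
    ['I_n], integrated one coordinate at a time. *)

Section Ereal.
Variable R : realType.

Lemma limn_einf_ge0 (u : (\bar R)^nat) : (forall k, 0 <= u k)%E -> (0 <= limn_einf u)%E.
Proof.
move=> u0; rewrite limn_einf_lim; apply: lime_ge; first exact: is_cvg_einfs.
by apply: nearW => n; apply: le_ereal_inf_tmp => _ [m _ <-].
Qed.

Lemma le_limn_einf (u v : (\bar R)^nat) : (forall k, u k <= v k)%E ->
  (limn_einf u <= limn_einf v)%E.
Proof.
move=> uv; rewrite !limn_einf_lim; apply: lee_lim; try exact: is_cvg_einfs.
apply: nearW => n; apply: le_ereal_inf_tmp => _ [m /= nm <-].
by apply: le_trans (uv m); apply: ereal_inf_lbound; exists m.
Qed.

Lemma measurable_limn_einf d (T : measurableType d) (f : (T -> \bar R)^nat) :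
  (forall k, measurable_fun setT (f k)) ->
  measurable_fun setT (fun x => limn_einf (f^~ x)).
Proof.
move=> mf; have -> : (fun x => limn_einf (f^~ x)) =
    (fun x => - limn_esup (fun k => - f k x))%E.
  by apply/funext => x; rewrite -limn_einfN; congr limn_einf; apply/funext => k /=; rewrite oppeK.
apply: measurableT_comp => //; apply: measurable_fun_limn_esup => k.
exact: measurableT_comp.
Qed.

Lemma emeasurable_prod d (T : measurableType d) (I : Type) (s : seq I) (P : pred I)
    (f : I -> T -> \bar R) :
  (forall i, P i -> measurable_fun setT (f i)) ->
  measurable_fun setT (fun x => \prod_(i <- s | P i) f i x)%E.
Proof.
move=> mf; elim: s => [|i s IH].
  by rewrite (_ : (fun _ => _) = cst 1%E) //; apply/funext => x; rewrite big_nil.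
rewrite (_ : (fun _ => _) = if P i then (fun x => f i x * \prod_(j <- s | P j) f j x)%E
    else (fun x => \prod_(j <- s | P j) f j x)%E); last first.
  by case: ifPn => Pi; apply/funext => x; rewrite big_cons ?Pi ?(negbTE Pi).
by case: ifPn => // Pi; apply: emeasurable_funM => //; exact: mf.
Qed.

Lemma fine_prode (I : Type) (s : seq I) (P : pred I) (f : I -> \bar R) :
  (forall i, P i -> f i \is a fin_num) ->
  fine (\prod_(i <- s | P i) f i)%E = \prod_(i <- s | P i) fine (f i).
Proof.
move=> ff; rewrite (eq_bigr (fun i => (fine (f i))%:E)) ?prodEFin//.
by move=> i Pi; rewrite fineK// ff.
Qed.

End Ereal.

(** * Iterated integrals *)

Section IteratedIntegral.
Variable R : realType.
Implicit Types n : nat.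
Local Notation mR := (measurableTypeR R).

(* Measurability in the coordinates of ['I_n -> R], expressed by composition
   with measurable coordinate functions on an arbitrary space [S'], so that no
   sigma-algebra on ['I_n -> R] is needed; the parameter in [S] is what makes
   Tonelli's theorem applicable by induction on [n]. *)
Definition pmeas d (S : measurableType d) n
    (F : S -> ('I_n -> R) -> \bar R) : Prop :=
  forall d' (S' : measurableType d') (h : S' -> S) (v : 'I_n -> S' -> mR),
    measurable_fun setT h -> (forall i, measurable_fun setT (v i)) ->
    measurable_fun setT (fun s => F (h s) (v ^~ s)).

Definition fcons n (x : R) (v : 'I_n -> R) : 'I_n.+1 -> R :=
  fun i => oapp v x (unlift ord0 i).

Lemma fcons0 n x (v : 'I_n -> R) : fcons x v ord0 = x.
Proof. by rewrite /fcons unlift_none. Qed.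

Lemma fconsS n x (v : 'I_n -> R) i : fcons x v (lift ord0 i) = v i.
Proof. by rewrite /fcons liftK. Qed.

(** Stands in for the integral against the product measure; coordinate 0 is the outermost. For
    [n = 0] the written point is the only function on an empty type. *)
Fixpoint iint n : ('I_n -> {sigma_finite_measure set mR -> \bar R}) ->
    (('I_n -> R) -> \bar R) -> \bar R :=
  match n with
  | 0 => fun _ F => F (fun _ => 0)
  | m.+1 => fun mu F =>
     (\int[mu ord0]_x iint (fun i => mu (lift ord0 i)) (fun v => F (fcons x v)))%E
  end.

Lemma pmeas_comp d (S : measurableType d) d' (S' : measurableType d') n
    (F : S -> ('I_n -> R) -> \bar R) (h : S' -> S) :
  measurable_fun setT h -> pmeas F -> pmeas (fun s => F (h s)).
Proof.
move=> mh mF e U k v mk mv; apply: (mF _ _ (h \o k)) => //.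
exact: measurableT_comp.
Qed.

(** Moves the first coordinate into the parameter space, the step by which the inductions on [n]
    below pass to one coordinate fewer. *)
Lemma pmeas_fcons d (S : measurableType d) n
    (F : S -> ('I_n.+1 -> R) -> \bar R) :
  pmeas F -> pmeas (fun (z : S * mR) v => F z.1 (fcons z.2 v)).
Proof.
move=> mF e U h v mh mv /=.
apply: (mF _ _ (fun s => (h s).1) (fun i s => fcons (h s).2 (v^~ s) i)).
- exact: measurableT_comp measurable_fst mh.
- move=> i; rewrite /fcons; case: unliftP => [j _|_]/=; first exact: mv.
  exact: measurableT_comp measurable_snd mh.
Qed.

Lemma pmeas_fconsr d (S : measurableType d) n
    (F : S -> ('I_n.+1 -> R) -> \bar R) s :
  pmeas F -> pmeas (fun (x : mR) v => F s (fcons x v)).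
Proof.
move=> /pmeas_fcons mF; exact: (pmeas_comp (pair1_measurable s) mF).
Qed.

Lemma iint_ge0 n mu (F : ('I_n -> R) -> \bar R) :
  (forall v, 0 <= F v)%E -> (0 <= iint mu F)%E.
Proof.
elim: n mu F => [|n IH] mu F F0 /=; first exact: F0.
by apply: integral_ge0 => x _; exact: IH.
Qed.

Lemma eq_iint n mu (F G : ('I_n -> R) -> \bar R) :
  (forall v, F v = G v) -> iint mu F = iint mu G.
Proof. by move=> /funext ->. Qed.

(** Tonelli's theorem makes an integral over [x] measurable in the parameter once the integrand is
    jointly measurable on [S * mR]; the induction hypothesis supplies this, with [S * mR] as the new
    parameter space. *)
Lemma iint_measurable d (S : measurableType d) n mu
    (F : S -> ('I_n -> R) -> \bar R) :
  pmeas F -> (forall s v, 0 <= F s v)%E ->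
  measurable_fun setT (fun s => iint mu (F s)).
Proof.
elim: n mu d S F => [|n IH] mu d S F mF F0 /=.
  by apply: (mF _ _ id (fun _ => cst 0)) => // i; exact: measurable_cst.
have mG := IH (fun i => mu (lift ord0 i)) _ _ _ (pmeas_fcons mF)
  (fun z v => F0 z.1 (fcons z.2 v)).
apply: (measurable_fun_fubini_tonelli_F
  (fun z : S * mR => iint (fun i => mu (lift ord0 i))
      (fun v => F z.1 (fcons z.2 v)))) => // z.
by apply: iint_ge0 => v.
Qed.

Lemma iint_measurable1 d (S : measurableType d) s n mu
    (F : S -> ('I_n.+1 -> R) -> \bar R) :
  pmeas F -> (forall s v, 0 <= F s v)%E ->
  measurable_fun setT (fun x : mR => iint mu (fun v => F s (fcons x v))).
Proof. by move=> mF F0; apply: iint_measurable => //; exact: pmeas_fconsr. Qed.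

(** The parameter [s] serves the induction: once the first coordinate is split off, it takes the
    place of [s]. *)
Lemma le_iint d (S : measurableType d) s n mu (F G : S -> ('I_n -> R) -> \bar R) :
  pmeas F -> pmeas G -> (forall s v, 0 <= F s v)%E ->
  (forall s v, 0 <= G s v)%E -> (forall v, F s v <= G s v)%E ->
  (iint mu (F s) <= iint mu (G s))%E.
Proof.
elim: n mu d S s F G => [|n IH] mu d S s F G mF mG F0 G0 FG //=.
apply: ge0_le_integral => //.
- by move=> x _; exact: iint_ge0.
- exact: iint_measurable1.
- exact: iint_measurable1.
- move=> x _.
  apply: (IH _ _ _ (x : mR) (fun x v => F s (fcons x v)) (fun x v => G s (fcons x v))) => //;
  exact: pmeas_fconsr.
Qed.

Lemma iintD d (S : measurableType d) s n mu (F G : S -> ('I_n -> R) -> \bar R) :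
  pmeas F -> pmeas G -> (forall s v, 0 <= F s v)%E ->
  (forall s v, 0 <= G s v)%E ->
  (iint mu (fun v => F s v + G s v) = iint mu (F s) + iint mu (G s))%E.
Proof.
elim: n mu d S s F G => [|n IH] mu d S s F G mF mG F0 G0 //=.
rewrite -ge0_integralD //.
- apply: eq_integral => x _.
  apply: (IH _ _ _ (x : mR) (fun x v => F s (fcons x v)) (fun x v => G s (fcons x v))) => //;
  exact: pmeas_fconsr.
- by move=> x _; exact: iint_ge0.
- exact: iint_measurable1.
- by move=> x _; exact: iint_ge0.
- exact: iint_measurable1.
Qed.

Lemma iintZl d (S : measurableType d) s n mu (F : S -> ('I_n -> R) -> \bar R) (c : \bar R) :
  pmeas F -> (forall s v, 0 <= F s v)%E -> (0 <= c)%E ->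
  (iint mu (fun v => c * F s v) = c * iint mu (F s))%E.
Proof.
elim: n mu d S s F => [|n IH] mu d S s F mF F0 c0 //=.
rewrite -ge0_integralZl //.
- apply: eq_integral => x _.
  apply: (IH _ _ _ (x : mR) (fun x v => F s (fcons x v))) => //; exact: pmeas_fconsr.
- exact: iint_measurable1.
- by move=> x _; exact: iint_ge0.
Qed.

Lemma pmeas_limn_einf d (S : measurableType d) n (F : nat -> S -> ('I_n -> R) -> \bar R) :
  (forall k, pmeas (F k)) -> pmeas (fun s v => limn_einf (fun k => F k s v)).
Proof.
move=> mF d' S' h v mh mv.
exact: (measurable_limn_einf (f := fun k s => F k (h s) (v^~ s)) (fun k => mF k _ _ _ _ mh mv)).
Qed.

(** Fatou's lemma once per coordinate: the induction hypothesis treats the inner integrals, the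
    measure of the first coordinate the outer one. *)
Lemma iint_fatou d (S : measurableType d) s n mu (F : nat -> S -> ('I_n -> R) -> \bar R) :
  (forall k, pmeas (F k)) -> (forall k s v, 0 <= F k s v)%E ->
  (iint mu (fun v => limn_einf (fun k => F k s v)) <=
   limn_einf (fun k => iint mu (F k s)))%E.
Proof.
elim: n mu d S s F => [|n IH] mu d S s F mF F0 //=.
apply: (@le_trans _ _ (\int[mu ord0]_x limn_einf (fun k => iint (fun i => mu (lift ord0 i)) (fun v => F k s (fcons x v))))%E).
  apply: ge0_le_integral => //.
  - by move=> x _; apply: iint_ge0 => v; exact: limn_einf_ge0.
  - apply: (iint_measurable1 s _ (F := fun s v => limn_einf (fun k => F k s v))).
      exact: pmeas_limn_einf.
    by move=> ? ?; exact: limn_einf_ge0.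
  - apply: measurable_limn_einf => k; exact: iint_measurable1.
  - move=> x _; apply: (IH _ _ _ (x : mR) (fun k x v => F k s (fcons x v))) => // k.
    exact: pmeas_fconsr.
apply: fatou => // k.
- exact: iint_measurable1.
- by move=> x _; exact: iint_ge0.
Qed.

Lemma iint_fubini d (S : measurableType d) n mu
    (m : {sigma_finite_measure set S -> \bar R}) (F : S -> ('I_n -> R) -> \bar R) :
  pmeas F -> (forall s v, 0 <= F s v)%E ->
  (\int[m]_s iint mu (F s) = iint mu (fun v => \int[m]_s F s v))%E.
Proof.
elim: n mu F => [//|n IH] mu F mF F0 /=.
rewrite (fubini_tonelli (fun z : S * mR => iint (fun i => mu (lift ord0 i))
      (fun v => F z.1 (fcons z.2 v)))).
- apply: eq_integral => x _ /=; apply: (IH _ (fun s v => F s (fcons x v))) => //.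
  apply: (pmeas_comp (pair2_measurable (x : mR)) (pmeas_fcons mF)).
- by apply: iint_measurable => //; exact: pmeas_fcons.
- by move=> z; exact: iint_ge0.
Qed.

Lemma iint_prod n mu (f : 'I_n -> R -> \bar R) :
  (forall i, measurable_fun setT (f i : mR -> _)) -> (forall i x, 0 <= f i x)%E ->
  (iint mu (fun v => \prod_i f i (v i)) = \prod_i \int[mu i]_x f i x)%E.
Proof.
elim: n mu f => [|n IH] mu f mf f0 /=; first by rewrite !big_ord0.
rewrite big_ord_recl -(IH _ (fun i => f (lift ord0 i)))//.
rewrite muleC -ge0_integralZl //; last first.
  by apply: iint_ge0 => v; exact: prode_ge0.
apply: eq_integral => x _.
rewrite muleC -(@iintZl _ unit tt _ _ (fun _ v => \prod_i f (lift ord0 i) (v i))%E)//.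
- apply: eq_iint => v; rewrite big_ord_recl fcons0; congr (_ * _)%E.
  by apply: eq_bigr => i _; rewrite fconsS.
- move=> d S h v mh mv; apply: emeasurable_prod => //.
  by move=> i _; exact: measurableT_comp (mf _) (mv _).
- by move=> _ v; exact: prode_ge0.
Qed.

End IteratedIntegral.

(** * Linear change of variables *)

Section LinearChange.
Variable R : realType.
Local Notation mR := (measurableTypeR R).
Local Notation leb := (@lebesgue_measure R).

Lemma measurable_affine (a b : R) :
  measurable_fun setT ((fun x => a * x + b) : mR -> mR).
Proof. by apply: measurable_funD => //; apply: measurable_funM. Qed.

(** By uniqueness of Lebesgue measure it suffices to treat half-open intervals. For negative [a] the
    preimage is half-open on the other side, which does not affect its length. *)
Lemma lebesgue_measure_affine (a b : R) (A : set mR) : a != 0 -> measurable A ->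
  (`|a|%:E * leb ((fun x : mR => (a * x + b)%R : mR) @^-1` A))%E = leb A.
Proof.
move=> a0 mA.
pose m := isMeasurableFun.Build _ _ _ _ _ (measurable_affine a b).
pose phi : {mfun mR >-> mR} := HB.pack (fun x : mR => a * x + b : mR) m.
have na0 : 0 <= `|a| by [].
apply/esym; rewrite -[LHS]/(leb A).
rewrite (@lebesgue_measure_unique R (mscale (NngNum na0) (pushforward leb phi))) //.
move=> _ [[x y] _ <-] /=.
rewrite /mscale /= /pushforward /= lebesgue_measure_itv /= lte_fin.
have [ap|an|az] := ltgtP a 0; last by rewrite az eqxx in a0.
- have -> : ((fun t : mR => a * t + b : mR) @^-1` `]x, y]%classic) = `[(y - b) / a, (x - b) / a[%classic.
    apply/seteqP; split => t /=; rewrite !in_itv /=.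
      by rewrite ler_ndivrMr // ltr_ndivlMr// => /andP[? ?]; apply/andP; split; lra.
    by rewrite ler_ndivrMr // ltr_ndivlMr// => /andP[? ?]; apply/andP; split; lra.
  rewrite lebesgue_measure_itv /= lte_fin ltr_nM2r ?invr_lt0// ltrD2r.
  case: ifPn => _; last by rewrite mule0.
  by rewrite -EFinB -EFinM ltr0_norm //; congr EFin; field.
- have -> : ((fun t : mR => a * t + b : mR) @^-1` `]x, y]%classic) = `](x - b) / a, (y - b) / a]%classic.
    apply/seteqP; split => t /=; rewrite !in_itv /=.
      by rewrite ler_pdivlMr // ltr_pdivrMr// => /andP[? ?]; apply/andP; split; lra.
    by rewrite ler_pdivlMr // ltr_pdivrMr// => /andP[? ?]; apply/andP; split; lra.
  rewrite lebesgue_measure_itv /= lte_fin ltr_pM2r ?invr_gt0// ltrD2r.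
  case: ifPn => _; last by rewrite mule0.
  by rewrite -EFinB -EFinM gtr0_norm //; congr EFin; field.
Qed.

Lemma ge0_integral_affine (a b : R) (f : mR -> \bar R) : a != 0 ->
  measurable_fun setT f -> (forall x, 0 <= f x)%E ->
  (\int[leb]_x f (a * x + b)%R = `|a|^-1%:E * \int[leb]_x f x)%E.
Proof.
move=> a0 mf f0.
pose m := isMeasurableFun.Build _ _ _ _ _ (measurable_affine a b).
pose phi : {mfun mR >-> mR} := HB.pack (fun x : mR => a * x + b : mR) m.
have na0 : 0 <= `|a| by [].
have <- : (\int[mscale (NngNum na0) (pushforward leb phi)]_x f x = \int[leb]_x f x)%E.
  by move=> m0; apply: eq_measure_integral => A mA _; exact: (lebesgue_measure_affine b a0 mA).
rewrite ge0_integral_mscale //= muleA -EFinM mulVf ?normr_eq0// mul1e.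
by rewrite ge0_integral_pushforward //=; exact: measurable_affine.
Qed.

(** Matrices act on functions rather than on column vectors, because functions are what [iint]
    integrates over. *)
Definition act m n (M : 'M[R]_(m, n)) (v : 'I_n -> R) : 'I_m -> R :=
  fun i => \sum_j M i j * v j.

Lemma act_mul m n p (M : 'M[R]_(m, n)) (N : 'M[R]_(n, p)) v :
  act (M *m N) v = act M (act N v).
Proof.
apply/funext => i; rewrite /act.
under eq_bigr do rewrite mxE mulr_suml.
rewrite exchange_big /=; apply: eq_bigr => j _; rewrite mulr_sumr.
by apply: eq_bigr => k _; rewrite mulrA.
Qed.

Lemma act1 n (v : 'I_n -> R) : act 1%:M v = v.
Proof.
apply/funext => i; rewrite /act (bigD1 i)//= mxE eqxx mul1r big1 ?addr0// => j ji.
by rewrite mxE eq_sym (negbTE ji) mul0r.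
Qed.

Lemma act_block n (a : R) (r : 'rV[R]_n) (c : 'cV[R]_n) (D : 'M[R]_n) x v :
  act (block_mx a%:M r c D : 'M[R]_n.+1) (fcons x v) =
  fcons (a * x + act r v 0) (fun i => act D v i + c i 0 * x).
Proof.
apply/funext => i.
set B := (B in act B _).
(* Blocks are indexed through [lshift] and [rshift], [fcons] through [ord0] and [lift ord0]; the
   next facts identify the two. *)
have E0 (k : 'I_1) : (lshift n k : 'I_n.+1) = ord0 by apply: val_inj; rewrite /= (ord1 k).
have E1 j : (rshift 1 j : 'I_n.+1) = lift ord0 j by apply: val_inj.
have B00 : B ord0 ord0 = a by rewrite -(E0 0) [LHS]block_mxEul mxE eqxx mulr1n.
have B01 j : B ord0 (lift ord0 j) = r 0 j by rewrite -E1 -(E0 0) [LHS]block_mxEur.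
have B10 j : B (lift ord0 j) ord0 = c j 0 by rewrite -E1 -(E0 0) [LHS]block_mxEdl.
have B11 j k : B (lift ord0 j) (lift ord0 k) = D j k by rewrite -!E1 [LHS]block_mxEdr.
rewrite /act big_ord_recl fcons0.
case: (unliftP ord0 i) => [k ->|->].
  rewrite fconsS B10 addrC; congr (_ + _).
  by apply: eq_bigr => j _; rewrite B11 fconsS.
rewrite fcons0 B00; congr (_ + _).
by apply: eq_bigr => j _; rewrite B01 fconsS.
Qed.

Lemma pmeas_act d (S : measurableType d) m n (M : 'M[R]_(m, n)) 
    (F : S -> ('I_m -> R) -> \bar R) :
  pmeas F -> pmeas (fun s v => F s (act M v)).
Proof.
move=> mF d' S' h v mh mv.
apply: (mF _ _ h (fun i s => act M (v^~ s) i)) => // i.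
apply: measurable_sum => j; apply: measurable_funM => //; exact: mv.
Qed.

Local Notation lebs := (fun _ => leb).

Lemma iint_shift d (S : measurableType d) s n (w : 'I_n -> R) 
    (F : S -> ('I_n -> R) -> \bar R) :
  pmeas F -> (forall s v, 0 <= F s v)%E ->
  iint lebs (fun v => F s (fun i => v i + w i)) = iint lebs (F s).
Proof.
elim: n d S s w F => [|n IH] d S s w F mF F0 /=.
  by congr (F s _); apply/funext => -[].
transitivity (\int[leb]_x iint lebs (fun v => F s (fcons (1 * x + w ord0)%R v)))%E.
  apply: eq_integral => x _; rewrite mul1r.
  rewrite -(IH _ mR (x + w ord0 : mR) (fun i => w (lift ord0 i)) (fun y v => F s (fcons y v)))//; last first.
    exact: pmeas_fconsr.
  apply: eq_iint => v; congr (F s _); apply/funext => i.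
  by case: (unliftP ord0 i) => [k ->|->]; rewrite ?fconsS ?fcons0.
rewrite (ge0_integral_affine _ (f := fun x => iint lebs (fun v => F s (fcons x v)))) ?oner_eq0//.
- by rewrite normr1 invr1 mul1e.
- exact: iint_measurable1.
- by move=> x; exact: iint_ge0.
Qed.

(** A predicate on matrices, so that it can be proved for triangular factors and transferred to
    products. *)
Definition linear_change n (M : 'M[R]_n) := forall F : ('I_n -> R) -> \bar R,
  pmeas (fun _ : unit => F) -> (forall v, 0 <= F v)%E ->
  iint lebs (fun v => F (act M v)) = (`|\det M|^-1%:E * iint lebs F)%E.

Lemma linear_change_mul n (M N : 'M[R]_n) :
  linear_change M -> linear_change N -> linear_change (M *m N).
Proof.
move=> HM HN F mF F0; under eq_iint do rewrite act_mul.
rewrite (HN (fun v => F (act M v)))//; last exact: (pmeas_act M mF).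
by rewrite HM // muleA -EFinM det_mulmx normrM invfM mulrC.
Qed.

(** With the other coordinates fixed, the first one undergoes an affine map with slope [a].
    Tonelli's theorem brings it innermost, where the affine rule removes the shift and yields the
    factor [|a|^-1]; it then goes outermost again and [D] is handled by hypothesis. *)
Lemma linear_change_ublock n (a : R) (r : 'rV[R]_n) (D : 'M[R]_n) : a != 0 ->
  linear_change D -> linear_change (block_mx a%:M r 0 D : 'M[R]_n.+1).
Proof.
move=> a0 HD F mF F0.
have mFc := pmeas_fconsr tt mF.
have mH : pmeas (fun (x : mR) v => F (fcons (a * x + act r v 0) (act D v))).
  move=> d' S' h v mh mv.
  apply: (mFc _ _ (fun s => a * h s + act r (v^~ s) 0) (fun i s => act D (v^~ s) i)).
    apply: measurable_funD; first exact: measurable_funM.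
    by apply: measurable_sum => j; apply: measurable_funM => //; exact: mv.
  by move=> i; apply: measurable_sum => j; apply: measurable_funM => //; exact: mv.
rewrite /=.
under eq_integral => x _.
  under eq_iint => v.
    rewrite act_block (_ : (fun i => _) = act D v); last first.
      by apply/funext => i; rewrite mxE mul0r addr0.
    over.
  over.
rewrite /= (@iint_fubini R _ mR n lebs leb (fun x v => F (fcons (a * x + act r v 0) (act D v))))//.
transitivity (iint lebs (fun v => `|a|^-1%:E * \int[leb]_x F (fcons x (act D v)))%E).
  apply: eq_iint => v.
  rewrite (ge0_integral_affine _ (f := fun x => F (fcons x (act D v))))//.
  by apply: (mFc _ mR id (fun i _ => act D v i)) => // i.
rewrite (@iintZl _ _ unit tt _ _ (fun _ v => \int[leb]_x F (fcons x (act D v)))%E)//.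
- rewrite -(@iint_fubini R _ mR n lebs leb (fun x v => F (fcons x (act D v))))//; last first.
    exact: (pmeas_act D mFc).
  under eq_integral => x _.
    rewrite (HD (fun v => F (fcons x v)))//; last first.
      by move=> d' S' h v mh mv; apply: (mFc _ _ (fun _ => x)).
    over.
  rewrite ge0_integralZl//.
  + rewrite muleA -EFinM -invfM -normrM; congr ((`|_|^-1)%:E * _)%E.
    by rewrite (det_ublock (a%:M : 'M[R]_1)) det_scalar1.
  + exact: (iint_measurable1 tt _ (F := fun _ => F)).
  + by move=> x _; exact: iint_ge0.
- move=> d' S' h v mh mv.
  apply: (measurable_fun_fubini_tonelli_F (fun z : S' * mR => F (fcons z.2 (act D (v^~ z.1))))) => //.
  apply: (mFc _ _ snd (fun i z => act D (v^~ z.1) i)); first exact: measurable_snd.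
  move=> i; apply: measurable_sum => j; apply: measurable_funM => //.
  exact: measurableT_comp (mv j) measurable_fst.
- by move=> _ v; apply: integral_ge0.
Qed.

(** A shear: for fixed [x] the remaining coordinates are translated by [c i 0 * x], and Lebesgue
    measure is translation invariant. *)
Lemma linear_change_lblock n (c : 'cV[R]_n) :
  linear_change (block_mx 1%:M 0 c 1%:M : 'M[R]_n.+1).
Proof.
move=> F mF F0 /=.
under eq_integral => x _.
  under eq_iint => v.
    rewrite act_block act1 mul1r (_ : act 0 v 0 = 0); last first.
      by rewrite /act big1// => j _; rewrite mxE mul0r.
    rewrite addr0.
    over.
  rewrite (@iint_shift _ mR (x : mR) _ (fun i => c i 0 * x) (fun x v => F (fcons x v)))//; last first.
    exact: (pmeas_fconsr tt mF).
  over.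
by rewrite /= (det_lblock (1%:M : 'M[R]_1)) !det1 mulr1 normr1 invr1 mul1e.
Qed.

(* Elimination by blocks: if the top left entry of [M] is nonzero, [M] is a lower
   times an upper block triangular matrix; otherwise adding another row to the
   first one makes it nonzero. *)
Lemma linear_change_unit n (M : 'M[R]_n) : M \in unitmx -> linear_change M.
Proof.
elim: n M => [|n IH] M uM.
  move=> F mF F0 /=; rewrite det_mx00 normr1 invr1 mul1e.
  by congr F; apply/funext => -[].
have pivot (N : 'M[R]_(1 + n)) : N \in unitmx -> N ord0 ord0 != 0 -> linear_change N.
  move=> uN; set a := N ord0 ord0 => a0.
  pose r : 'rV[R]_n := ursubmx N; pose c : 'cV[R]_n := dlsubmx N.
  (* [D] is the Schur complement of the pivot [a], which gives the factorisation [NE]. *)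
  pose D : 'M[R]_n := drsubmx N - a^-1 *: (c *m r).
  have aE : ulsubmx N = a%:M.
    rewrite [LHS]mx11_scalar; congr (_%:M); rewrite !mxE /a.
    by congr (N _ _); apply: val_inj.
  have NE : N = block_mx 1%:M 0 (a^-1 *: c) 1%:M *m block_mx a%:M r 0 D.
        rewrite mulmx_block !mul1mx !mul0mx !addr0.
    rewrite -scalemxAl mul_mx_scalar scalerA mulVf// scale1r.
    by rewrite -scalemxAl addrC subrK -aE submxK.
  rewrite NE; apply: linear_change_mul; first exact: linear_change_lblock.
  apply: linear_change_ublock => //; apply: IH.
  move: uN; rewrite NE unitmx_mul => /andP[_].
  by rewrite !unitmxE det_ublock unitrM => /andP[].
have [M0|M0] := eqVneq (M ord0 ord0) 0; last exact: pivot.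
have [i Mi] : exists i, M i ord0 != 0.
  apply/existsP; move: uM; apply: contraLR; rewrite negb_exists => /forallP H.
  rewrite unitmxE (expand_det_col _ ord0) big1 ?unitr0// => i _.
  by move/negPn: (H i) => /eqP ->; rewrite mul0r.
case: (unliftP ord0 i) => [k ik|i0]; last by rewrite i0 M0 eqxx in Mi.
(* [E s] adds [s] times the row [lift ord0 k] to the first row: [E 1] makes the pivot nonzero and
   [E (-1)] undoes it. *)
pose E (s : R) : 'M[R]_(1 + n) := block_mx (1%:M : 'M[R]_1) (s *: delta_mx 0 k) 0 1%:M.
have EE : E (-1) *m E 1 = 1%:M.
  rewrite /E mulmx_block !mul1mx !mulmx0 !mul0mx !addr0 !add0r.
  by rewrite mulmx1 -scalerDl addrN scale0r [RHS](@scalar_mx_block _ 1 n).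
have -> : M = E (-1) *m (E 1 *m M) by rewrite mulmxA EE mul1mx.
have uE s : E s \in unitmx by rewrite unitmxE /E (det_ublock (1%:M : 'M[R]_1)) !det1 mulr1 unitr1.
apply: linear_change_mul.
  apply: linear_change_ublock; first exact: oner_neq0.
  apply: IH; exact: unitmx1.
apply: pivot; first by rewrite unitmx_mul uE uM.
have -> : (E 1 *m M) ord0 ord0 = act (E 1) (fun j => M j ord0) ord0 by rewrite mxE.
have -> : (fun j => M j ord0) = fcons 0 (fun j => M (lift ord0 j) ord0).
  by apply/funext => j; case: (unliftP ord0 j) => [l ->|->]; rewrite ?fconsS ?fcons0.
rewrite /E act_block fcons0 mulr0 add0r /act (bigD1 k)//= big1 ?addr0.
  by rewrite !mxE !eqxx !mul1r -ik.
by move=> j /negbTE jk; rewrite !mxE jk andbF mulr0 mul0r.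
Qed.

End LinearChange.

(** * Independence *)

Section Independence.
Variables (R : realType) (disp : measure_display) (T : measurableType disp).
Variables (P : probability T R) (n : nat) (X : 'I_n -> {RV P >-> R}).
Local Notation mR := (measurableTypeR R).

(** The same map with values in [measurableTypeR R], the type that carries Lebesgue measure and the
    measures of [iint]. *)
Definition borelRV (Y : {RV P >-> R}) : {mfun T >-> mR} :=
  HB.pack (Y : T -> mR)
    (isMeasurableFun.Build _ _ _ _ (Y : T -> mR) (measurable_funPT Y)).

Definition law_of (Y : {RV P >-> R}) : {sigma_finite_measure set mR -> \bar R} :=
  distribution P (borelRV Y).

Definition law (j : 'I_n) := law_of (X j).

Definition upd (g : 'I_n -> R) (j : 'I_n) (x : R) : 'I_n -> R :=
  fun k => if k == j then x else g k.

(** The recursion follows that of [iint], so that independence can be used for one coordinate at a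
    time. *)
Fixpoint upds d : ('I_n -> R) -> ('I_d -> 'I_n) -> ('I_d -> R) -> 'I_n -> R :=
  match d with
  | 0 => fun g _ _ => g
  | d'.+1 => fun g e v => upds (upd g (e ord0) (v ord0))
      (fun l => e (lift ord0 l)) (fun l => v (lift ord0 l))
  end.

Lemma upds_notin d g (e : 'I_d -> 'I_n) v k :
  (forall l, e l != k) -> upds g e v k = g k.
Proof.
elim: d g e v => [//|d IH] g e v ek /=.
by rewrite IH // /upd eq_sym (negbTE (ek _)).
Qed.

Lemma upds_in d g (e : 'I_d -> 'I_n) v l :
  injective e -> upds g e v (e l) = v l.
Proof.
elim: d g e v l => [? ? ? []//|d IH] g e v l ie /=.
case: (unliftP ord0 l) => [k ->|->].
  by rewrite (IH _ (fun l => e (lift ord0 l)))// => ? ? /ie /lift_inj.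
rewrite upds_notin /upd ?eqxx// => k; apply/eqP => /ie /eqP.
by rewrite eq_sym (negbTE (neq_lift _ _)).
Qed.

Lemma measurable_upds d S (Sd : measurableType S) g (e : 'I_d -> 'I_n)
    (v : 'I_d -> Sd -> mR) k :
  (forall i, measurable_fun setT (g i : Sd -> mR)) -> (forall i, measurable_fun setT (v i)) ->
  measurable_fun setT ((fun s => upds (g^~ s) e (v^~ s) k) : Sd -> mR).
Proof.
elim: d g e v => [|d IH] g e v mg mv /=; first exact: mg.
apply: (IH (fun i s => upd (g^~ s) (e ord0) (v ord0 s) i)) => // i.
by rewrite /upd; case: (i == _); [exact: mv|exact: mg].
Qed.

Hypothesis indX : independent_RVs X.

(* Generates the sigma-algebra of all [X k] with [k != j]. *)
Definition cylinders_off (j : 'I_n) : set (set T) :=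
  [set E | exists2 B : 'I_n -> set R, (forall k, measurable (B k)) &
     E = [set w | forall k, k != j -> B k (X k w)]].

Lemma cylinders_off_measurable j : cylinders_off j `<=` measurable.
Proof.
move=> _ [C mC ->].
have -> : [set w | forall k, k != j -> C k (X k w)] =
   \bigcap_(k in [set k | k != j]) (X k @^-1` C k) by [].
apply: fin_bigcap_measurable => [|k _]; first exact: finite_finset.
by apply: measurable_funPTI; exact: mC.
Qed.

(** Both sides are finite measures in [E] that agree on the cylinders, and these are stable under
    intersection and generate the sigma-algebra. *)
Lemma indep_off j B E : measurable B -> <<s cylinders_off j >> E ->
  P (E `&` X j @^-1` B) = (P (X j @^-1` B) * P E)%E.
Proof.
move=> mB sE.
have mXB : measurable (X j @^-1` B) by exact: measurable_funPTI.
have c0 : 0 <= fine (P (X j @^-1` B)) by rewrite fine_ge0.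
have -> : P (X j @^-1` B) = (fine (P (X j @^-1` B)))%:E.
  by rewrite fineK// fin_num_measure.
apply: (@g_sigma_algebra_measure_unique _ R T (cylinders_off j) (@cylinders_off_measurable j) (fun=> setT) _ _
  (mrestr P mXB) (mscale (NngNum c0) P)) => //.
- by move=> _; exists (fun=> setT) => //; apply/seteqP.
- by rewrite bigcup_const //; exists 0%N.
- move=> _ _ [C mC ->] [D mD ->]; exists (fun k => C k `&` D k).
    by move=> k; exact: measurableI.
  apply/seteqP; split => w /=; first by move=> [H1 H2] k kj; split; [exact: H1|exact: H2].
  by move=> H; split => k /H [].
- move=> _ [C mC ->] /=; rewrite /mrestr /mscale /= fineK ?fin_num_measure//.
  (* [C'] puts [B] in coordinate [j]: independence for all indices computes the left side,
     independence for all indices but [j] the factor [P E]. *)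
  pose C' k := if k == j then B else C k.
  have mC' k : measurable (C' k) by rewrite /C'; case: ifP.
  have := indX [set: 'I_n]%SET mC'.
  rewrite (bigD1 j) ?inE//=.
  rewrite {2}/C' eqxx.
  have -> : [set w | forall k, k \in [set: 'I_n]%SET -> C' k (X k w)] =
     [set w | forall k, k != j -> C k (X k w)] `&` X j @^-1` B.
    apply/seteqP; split => w /=.
      move=> H; split.
        by move=> k kj; have := H k; rewrite /C' inE (negbTE kj); apply.
      by have := H j; rewrite /C' inE eqxx; apply.
    move=> [H1 H2] k _; rewrite /C'; case: ifPn => [/eqP -> //|]; exact: H1.
  move=> ->; congr (_ * _)%E.
  have := indX (~: [set j])%SET mC'.
  have -> : [set w | forall k, k \in (~: [set j])%SET -> C' k (X k w)] =
     [set w | forall k, k != j -> C k (X k w)].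
    apply/seteqP; split => w /= H k.
      by move=> kj; have := H k; rewrite !inE /C' (negbTE kj); apply.
    by rewrite !inE /C' => kj; rewrite (negbTE kj); exact: H.
  by move=> ->; apply: eq_bigl => k; rewrite !inE.
- by move=> _; rewrite /= /mrestr setTI ltey_eq fin_num_measure.
Qed.

Local Notation offT j := (g_sigma_algebraType (cylinders_off j)).

Lemma measurable_off_id j : measurable_fun setT (id : T -> offT j).
Proof.
move=> _ E mE; rewrite setTI.
exact: (smallest_sub (@sigma_algebra_measurable _ T) (@cylinders_off_measurable j)).
Qed.

Lemma measurable_off j k : k != j -> measurable_fun setT (X k : offT j -> mR).
Proof.
move=> kj _ B mB; rewrite setTI; apply: sub_sigma_algebra.
exists (fun l => if l == k then B else setT).
  by move=> l; case: ifP.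
apply/seteqP; split => w /=.
  by move=> Bw l lj; case: ifPn => // /eqP ->.
by move=> /(_ k kj); rewrite eqxx.
Qed.

Let offRV j : {mfun T >-> offT j} :=
  HB.pack (id : T -> offT j)
    (isMeasurableFun.Build _ _ _ _ (id : T -> offT j) (@measurable_off_id j)).

Let pairRV j : {mfun T >-> (mR * offT j)%type} :=
  HB.pack (fun w => (X j w : mR, w : offT j))
    (isMeasurableFun.Build _ _ _ _ (fun w => (X j w : mR, w : offT j))
       (measurable_fun_pair (measurable_funPT (borelRV (X j))) (@measurable_off_id j))).

(** The pair of [X j] and the identity of [T], the latter seen as a variable in [T] with the
    sigma-algebra of the other [X k], has a product law by [indep_off]. The integrand on the right
    forgets the own value of [X j], so it is measurable for that sigma-algebra and Tonelli's theorem
    applies. *)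
Lemma integral_indep1 j (F : ('I_n -> R) -> \bar R) :
  pmeas (fun _ : unit => F) -> (forall g, 0 <= F g)%E ->
  (\int[P]_w F (fun k => X k w) =
   \int[P]_w \int[law j]_x F (upd (fun k => X k w) j x))%E.
Proof.
move=> mF F0.
pose Phi (z : mR * offT j) := F (upd (fun k => X k z.2) j z.1).
have mPhi : measurable_fun setT Phi.
  apply: (mF _ _ (fun _ => tt) (fun k (z : mR * offT j) => upd (fun k => X k z.2) j z.1 k)) => // k.
  rewrite /upd; case: (eqVneq k j) => kj; first exact: measurable_fst.
  exact: measurableT_comp (measurable_off kj) measurable_snd.
have Phi0 z : (0 <= Phi z)%E by exact: F0.
transitivity (\int[P]_w (Phi \o pairRV j) w)%E.
  apply: eq_integral => w _ /=; congr F; apply/funext => k.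
  by rewrite /upd; case: eqP => // ->.
rewrite -(ge0_integral_distribution (pairRV j : {RV P >-> _})) //.
pose P' : probability (offT j) R := distribution P (offRV j).
transitivity (\int[law j \x P']_z Phi z)%E.
  apply: eq_measure_integral => A mA _; apply/esym.
  apply: (@product_measure_unique _ _ _ _ R (law j) P' (distribution P (pairRV j))) => // B E mB mE.
  rewrite /= /pushforward /distribution /= /pushforward /=.
  have -> : (fun w => (X j w, w)) @^-1` (B `*` E) = E `&` X j @^-1` B.
    by apply/seteqP; split => w [].
  exact: indep_off.
rewrite fubini_tonelli2 //.
rewrite /fubini_G /= ge0_integral_distribution //=; last first.
- by move=> w; exact: integral_ge0.
- by apply: (measurable_fun_fubini_tonelli_G Phi).
Qed.

Lemma pmeas_upds d (mu : 'I_d -> {sigma_finite_measure set mR -> \bar R})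
    (e : 'I_d -> 'I_n) (F : ('I_n -> R) -> \bar R) :
  pmeas (fun _ : unit => F) -> (forall g, 0 <= F g)%E ->
  pmeas (fun _ : unit => fun g => iint mu (fun v => F (upds g e v))).
Proof.
move=> mF F0 d' S' h g mh mg.
apply: (iint_measurable _ (F := fun s v => F (upds (g^~ s) e v))) => //.
move=> d2 S2 h2 v2 mh2 mv2.
apply: (mF _ _ (fun _ => tt) (fun k s => upds (g^~ (h2 s)) e (v2^~ s) k)) => // k.
apply: (measurable_upds (g := fun i s => g i (h2 s))) => // i.
exact: measurableT_comp (mg i) mh2.
Qed.

(** The variables with index [e l] are replaced by integration variables one at a time; the
    remaining ones stay random. *)
Lemma integral_indep d (e : 'I_d -> 'I_n) (F : ('I_n -> R) -> \bar R) :
  pmeas (fun _ : unit => F) -> (forall g, 0 <= F g)%E ->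
  (\int[P]_w F (fun k => X k w) =
   \int[P]_w iint (fun l => law (e l)) (fun v => F (upds (fun k => X k w) e v)))%E.
Proof.
move=> mF F0; elim: d e => [//|d IH] e /=.
rewrite (IH (fun l => e (lift ord0 l))).
rewrite (@integral_indep1 (e ord0) (fun g => iint (fun l => law (e (lift ord0 l)))
  (fun v => F (upds g (fun l => e (lift ord0 l)) v)))).
- apply: eq_integral => w _; apply: eq_integral => x _; apply: eq_iint => v.
  congr (F (upds _ _ _)); first by rewrite fcons0.
  by apply/funext => l; rewrite fconsS.
- exact: pmeas_upds.
- by move=> g; exact: iint_ge0.
Qed.

Lemma expectation_prod (f : 'I_n -> mR -> \bar R) :
  (forall j, measurable_fun setT (f j)) -> (forall j x, 0 <= f j x)%E ->
  (\int[P]_w \prod_j f j (X j w) = \prod_j \int[P]_w f j (X j w))%E.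
Proof.
move=> mf f0.
(* With [e = id] every variable is replaced, so that the outer integrand is constant. *)
rewrite (@integral_indep n id (fun g => \prod_j f j (g j))%E).
- under eq_integral => w _.
    under eq_iint => v.
      rewrite (eq_bigr (fun j => f j (v j))); last first.
        by move=> j _; rewrite (@upds_in n _ id v j).
      over.
    rewrite iint_prod//.
    over.
  rewrite integral_cst// [X in (_ * X)%E]probability_setT mule1.
  by apply: eq_bigr => j _; rewrite ge0_integral_distribution.
- move=> d' S' h v mh mv; apply: emeasurable_prod => j _.
  exact: measurableT_comp (mf j) (mv j).
- by move=> g; exact: prode_ge0.
Qed.

End Independence.

(** * Regularly varying tails *)

Section Potter.
Variables (R : realType) (S : R -> R).
Hypothesis S_gt0 : forall w, 0 < S w.
Hypothesis S_le1 : forall w, S w <= 1.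
Hypothesis S_nincr : forall w w', w <= w' -> S w' <= S w.
Hypothesis S_rv : forall h, S (w + h) / S w @[w --> +oo] --> expR (- h).

(** [S] stands for the tail of a logarithm, for which regular variation concerns translations
    instead of dilations. Potter's bounds come from the step [h = 1], iterated, and from
    monotonicity. *)
Lemma unit_step_bounds (eta : R) : 0 < eta -> exists w0, forall w, w0 <= w ->
  expR (- (1 + eta)) * S w <= S (w + 1) /\ S (w + 1) <= expR (- (1 - eta)) * S w.
Proof.
move=> eta0.
have lo : expR (- (1 + eta)) < expR (- 1) :> R by rewrite ltr_expR; lra.
have hi : expR (- 1) < expR (- (1 - eta)) :> R by rewrite ltr_expR; lra.
have /= [M1 [_ H1]] := cvgr_gt _ (@S_rv 1) _ lo.
have /= [M2 [_ H2]] := cvgr_lt _ (@S_rv 1) _ hi.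
exists (Num.max M1 M2 + 1) => w hw.
have /H1 h1 : M1 < w by apply: lt_le_trans hw; rewrite ltr_pwDr// le_max lexx.
have /H2 h2 : M2 < w by apply: lt_le_trans hw; rewrite ltr_pwDr// le_max lexx orbT.
split.
- by rewrite -ler_pdivlMr // ltW.
- by rewrite -ler_pdivrMr // ltW.
Qed.

Lemma nat_steps_bounds (eta : R) : 0 < eta -> exists w0, forall w m, w0 <= w ->
  S (w + m%:R) <= expR (- (1 - eta) * m%:R) * S w /\
  S w <= expR ((1 + eta) * m%:R) * S (w + m%:R).
Proof.
move=> /unit_step_bounds[w0 H]; exists w0 => w m hw.
elim: m => [|m [IH1 IH2]]; first by rewrite !mulr0 expR0 !mul1r addr0.
have [|h1 h2] := H (w + m%:R); first by rewrite (le_trans hw)// lerDl.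
have E (c : R) : expR (c * (m%:R + 1)) = expR (c * m%:R) * expR c.
  by rewrite mulrDr mulr1 expRD.
rewrite -natr1 addrA !E; split.
- by rewrite (le_trans h2)// [X in X * S w]mulrC -mulrA ler_pM2l ?expR_gt0.
- rewrite (le_trans IH2)// -mulrA ler_pM2l ?expR_gt0//.
  by rewrite -ler_pdivrMl ?expR_gt0// -expRN.
Qed.

(** Only [w] has to be large, not [w + h]. Iterated unit steps give the exponential rate, and
    monotonicity fills the gaps between integers at the cost of [expR 2]. Where [w + h] lies below
    [w0], the bound [S (w + h) <= 1] is used, which costs [1 / S w0]. *)
Lemma potter (eta : R) : 0 < eta < 1 -> exists (C w0 : R), 0 < C /\
  forall w h, w0 <= w -> S (w + h) <= C * S w * expR (eta * `|h| - h).
Proof.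
move=> /andP[eta0 eta1].
have [w0 H] := nat_steps_bounds eta0.
exists (expR 2 / S w0), w0; split; first by rewrite divr_gt0 ?expR_gt0.
move=> w h hw.
have e2 : expR 2 <= expR 2 / S w0 by rewrite ler_peMr ?expR_ge0// -invr1 lef_pV2 ?posrE.
have [h0|h0] := leP 0 h.
- have /andP[m1 m2] := truncn_itv h0; set m := Num.truncn h in m1 m2.
  have [h1 _] := H w m hw.
  apply: (@le_trans _ _ (S (w + m%:R))); first by apply: S_nincr; rewrite lerD2l.
  rewrite (le_trans h1)// ger0_norm // [leRHS]mulrAC ler_pM2r//.
  apply: (@le_trans _ _ (expR 2 * expR (eta * h - h))); last by rewrite ler_pM2r ?expR_gt0.
  rewrite -expRD ler_expR.
  have : h - 1 <= m%:R by rewrite lerBlDr natr1 ltW.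
  nra.
- pose w1 := Num.max (w + h) w0.
  have w1w : w1 <= w by rewrite ge_max hw andbT; lra.
  have hS : S (w + h) <= S w1 / S w0.
    rewrite ler_pdivlMr// /w1; have [q|/ltW q] := leP (w + h) w0.
      by rewrite ler_piMl// ltW.
    by rewrite ler_piMr// ltW.
  have d0 : 0 <= w - w1 by rewrite subr_ge0.
  have /andP[m1 m2] := truncn_itv d0; set m := Num.truncn (w - w1) in m1 m2.
  have w1w0 : w0 <= w1 by rewrite le_max lexx orbT.
  have [_ h2] := H w1 m.+1 w1w0.
  have h3 : S (w1 + m.+1%:R) <= S w by apply: S_nincr; lra.
  have w1h : w + h <= w1 by rewrite le_max lexx.
  rewrite (le_trans hS)// ltr0_norm //.
  rewrite [leRHS](_ : _ = expR 2 * expR (eta * - h - h) * S w / S w0); last by ring.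
  rewrite ler_pM2r ?invr_gt0// (le_trans h2)//.
  apply: (@le_trans _ _ (expR ((1 + eta) * m.+1%:R) * S w)); first by rewrite ler_pM2l ?expR_gt0.
  rewrite ler_pM2r// -expRD ler_expR.
  have : m.+1%:R <= - h + 1 by rewrite -natr1 lerD2r (le_trans m1)//; lra.
  nra.
Qed.

End Potter.

(** * Exponential integrals over rays and against the exponential law *)

Section ExponentialIntegrals.
Variable R : realType.
Local Notation mR := (measurableTypeR R).
Local Notation leb := (@lebesgue_measure R).

Lemma measurable_ray_expR (a c : R) :
  measurable_fun setT (fun x : mR => ((c <= x)%R%:R * expR (- a * x))%:E : \bar R).
Proof.
apply/measurable_EFinP; apply: measurable_funM.
  rewrite (_ : (fun _ => _) = \1_(`[c, +oo[%classic : set mR)); last first.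
    by apply/funext => x; rewrite indicE mem_setE in_itv /= andbT.
  by apply: measurable_indic.
by apply: measurableT_comp => //; apply: measurable_funM.
Qed.

Lemma integral_ray_expR (a c : R) : 0 < a ->
  (\int[leb]_x ((c <= x)%R%:R * expR (- a * x))%:E = (expR (- a * c) / a)%:E)%E.
Proof.
move=> a0.
(* The substitution [x -> a * (x - c)] reduces the claim to the total mass of the standard
   exponential density. *)
have E (x : mR) : (((c <= x)%R%:R * expR (- a * x))%:E =
    (expR (- a * c))%:E * (exponential_pdf 1 (a * x + (- a * c)))%:E)%E.
  rewrite -EFinM; congr EFin; rewrite /exponential_pdf patchE.
  have -> : (a * x + - a * c \in `[0, +oo[%classic) = (c <= x).
    by rewrite mem_setE in_itv /= andbT mulNr subr_ge0 ler_pM2l.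
  case: ifP => _; last by rewrite mul0r mulr0.
  by rewrite !mul1r -expRD; congr expR; ring.
under eq_integral do rewrite E.
have mE : measurable_fun setT (fun x : mR => (exponential_pdf 1 x)%:E).
  by apply/measurable_EFinP; exact: measurable_exponential_pdf.
rewrite ge0_integralZl//; last 2 first.
- exact: (measurableT_comp mE (@measurable_affine R a (- a * c))).
- by move=> x _; rewrite lee_fin exponential_pdf_ge0.
rewrite (ge0_integral_affine _ (f := fun x => (exponential_pdf 1 x)%:E)) ?gt_eqF//.
- by rewrite integral_exponential_pdf// mule1 -EFinM gtr0_norm.
- by move=> x; rewrite lee_fin exponential_pdf_ge0.
Qed.

Lemma integral_open_ray (c : R) (f : mR -> R) : measurable_fun setT f ->
  (\int[leb]_x ((c < x)%R%:R * f x)%:E = \int[leb]_x ((c <= x)%R%:R * f x)%:E)%E.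
Proof.
move=> mf.
transitivity (\int[leb]_(x in `]c, +oo[) (f x)%:E)%E.
  rewrite [RHS]integral_mkcond; apply: eq_integral => x _; rewrite patchE.
  have -> : (x \in `]c, +oo[%classic) = (c < x) by rewrite mem_setE in_itv /= andbT.
  by case: ifP; rewrite ?mul1r ?mul0r.
rewrite integral_itv_obnd_cbnd; last by apply/measurable_EFinP; exact: measurable_funTS.
rewrite [LHS]integral_mkcond; apply: eq_integral => x _; rewrite patchE.
have -> : (x \in `[c, +oo[%classic) = (c <= x) by rewrite mem_setE in_itv /= andbT.
by case: ifP; rewrite ?mul1r ?mul0r.
Qed.

Import HBNNSimple.

(** On indicators this is the definition of [exponential_prob]; linearity extends it to simple
    functions and monotone convergence to nonnegative ones. *)
Lemma ge0_integral_exponential_prob (f : mR -> \bar R) :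
  measurable_fun setT f -> (forall x, 0 <= f x)%E ->
  (\int[exponential_prob 1]_x f x = \int[leb]_x (f x * (exponential_pdf 1 x)%:E))%E.
Proof.
move=> mf f0.
have mE : measurable_fun setT (fun x : mR => (exponential_pdf 1 x)%:E).
  by apply/measurable_EFinP; exact: measurable_exponential_pdf.
have E0 (x : mR) : (0 <= (exponential_pdf 1 x)%:E)%E by rewrite lee_fin exponential_pdf_ge0.
pose g := nnsfun_approx measurableT mf.
have gf x : (EFin \o g ^~ x) @ \oo --> f x by apply: cvg_nnsfun_approx.
have gn n x : (0 <= (g n x)%:E)%E by rewrite lee_fin.
have gnd x : {homo (fun n => (g n x)%:E) : m n / (m <= n)%N >-> (m <= n)%E}.
  by move=> m n mn; rewrite lee_fin; exact/lefP/nd_nnsfun_approx.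
transitivity (limn (fun n => \int[exponential_prob 1]_x (g n x)%:E))%E.
  rewrite -monotone_convergence//; last first.
    by move=> n; exact/measurable_EFinP.
  by apply: eq_integral => x _; apply/esym/cvg_lim => //; exact: gf.
transitivity (limn (fun n => \int[leb]_x ((g n x)%:E * (exponential_pdf 1 x)%:E)))%E; last first.
  rewrite -monotone_convergence//; last 3 first.
  - by move=> n; apply: emeasurable_funM => //; exact/measurable_EFinP.
  - by move=> n x _; exact: mule_ge0.
  - by move=> x _ m n mn; apply: lee_wpmul2r => //; exact: gnd.
  apply: eq_integral => x _; apply/cvg_lim => //.
  by apply: cvgeZr => //; exact: gf.
congr (limn _); apply/funext => n.
under eq_integral do rewrite fimfunE -fsumEFin//.
rewrite ge0_integral_fsum//; last 2 first.
- by move=> r; exact/measurable_EFinP/measurable_funM.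
- by move=> r x _; rewrite nnfun_muleindic_ge0.
under [RHS]eq_integral => x _.
  rewrite fimfunE -fsumEFin// muleC ge0_mule_fsumr; last first.
    by move=> r; rewrite nnfun_muleindic_ge0.
  over.
rewrite ge0_integral_fsum//; last 2 first.
- move=> r; apply: emeasurable_funM => //; exact/measurable_EFinP/measurable_funM.
- by move=> r x _; rewrite mule_ge0// nnfun_muleindic_ge0.
apply: eq_fsbigr => r _.
rewrite (integralZl_indic _ (fun r => g n @^-1` [set r]))//; last by move=> r0; rewrite preimage_nnfun0.
rewrite integral_indic// setIT.
set A := g n @^-1` [set r].
have mA : measurable A by exact: measurable_funPTI.
have [r0|r0] := leP 0 r; last first.
  have A0 : A = set0 by rewrite /A preimage_nnfun0.
  rewrite A0 measure0 mule0 integral0_eq// => x _.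
  by rewrite indicE in_set0 mulr0 mule0.
transitivity (r%:E * \int[leb]_x ((fun x => (exponential_pdf 1 x)%:E) \_ A) x)%E.
  by rewrite -integral_mkcond.
have p0 x : [set: mR] x -> (0 <= ((fun x => (exponential_pdf 1 x)%:E) \_ A) x)%E.
  by move=> _; rewrite patchE; case: ifP.
have mp : measurable_fun setT ((fun x : mR => (exponential_pdf 1 x)%:E) \_ A).
  exact/(measurable_restrictT _ _).1/measurable_funTS.
rewrite -(ge0_integralZl_EFin _ measurableT p0 mp r0).
apply: eq_integral => x _; rewrite [RHS]muleC EFinM -muleA patchE indicE.
by case: (x \in A); rewrite ?mul1e ?mul0e.
Qed.

End ExponentialIntegrals.

(** * Tails and quantile functions *)

Section Tail.
Variables (R : realType) (disp : measure_display) (T : measurableType disp).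
Variables (P : probability T R) (L : {RV P >-> R}).
Local Notation mR := (measurableTypeR R).
Local Notation leb := (@lebesgue_measure R).

Definition tail (w : R) : R := fine (ccdf L w).

Lemma tailE w : (tail w)%:E = P (L @^-1` `]w, +oo[%classic).
Proof. by rewrite /tail fineK// fin_num_measure. Qed.

Lemma tail_ge0 w : 0 <= tail w.
Proof. by rewrite fine_ge0. Qed.

Lemma tail_le1 w : tail w <= 1.
Proof. by rewrite -lee_fin tailE probability_le1//; exact: measurable_funPTI. Qed.

Lemma tail_nincr w w' : w <= w' -> tail w' <= tail w.
Proof.
by move=> ww'; rewrite fine_le ?fin_num_measure//; exact: ccdf_nonincreasing.
Qed.

Lemma tail_cvgy : tail w @[w --> +oo] --> (0 : R).
Proof. by apply: fine_cvg; exact: cvg_ccdfy0. Qed.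

Lemma tail_cvgNy : tail w @[w --> -oo] --> (1 : R).
Proof. by apply: fine_cvg; exact: cvg_ccdfNy1. Qed.

Lemma tail_right_continuous w : tail @ w^'+ --> tail w.
Proof.
apply: fine_cvg; rewrite /tail fineK ?fin_num_measure//.
exact: ccdf_right_continuous.
Qed.

(* The tail at [quantile s] is [exp (- s)]: [quantile] pushes the standard
   exponential distribution to the law of [L]. The value at [s <= 0] is junk. *)
Definition quantile (s : R) : R :=
  if 0 < s then sup [set w | expR (- s) < tail w] else 0.

(** Strictness on both sides rests on right continuity of the tail: if [expR (- s) < tail w], the
    same holds slightly to the right of [w], so [w] is below the supremum. The set is nonempty and
    bounded above because [0 < expR (- s) < 1] and the tail runs from 1 to 0. *)
Lemma quantile_gt s w : 0 < s -> (w < quantile s) = (expR (- s) < tail w).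
Proof.
move=> s0; rewrite /quantile s0.
set E := [set w | _ < tail w].
have e1 : expR (- s) < 1 by rewrite expR_lt1 oppr_lt0.
have e0 : 0 < expR (- s) by rewrite expR_gt0.
have E0 : E !=set0.
  have /= [M [_ HM]] := cvgr_gt _ tail_cvgNy _ e1.
  by exists (M - 1); apply: HM; rewrite ltrBlDr ltrDl.
have Eub : has_ubound E.
  have /= [M [_ HM]] := cvgr_lt _ tail_cvgy _ e0.
  exists M => y Ey; rewrite leNgt; apply/negP => /HM.
  by rewrite ltNge (ltW Ey).
apply/idP/idP => [/(sup_gt E0)[y Ey wy]|we].
  by apply: lt_le_trans Ey _; apply/tail_nincr/ltW.
have H := cvgr_gt _ (@tail_right_continuous w) _ we.
have : \forall t \near w^'+, w < t /\ expR (- s) < tail t.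
  near=> t; split; near: t; [exact: nbhs_right_gt|exact: H].
move=> /filter_ex[t [wt Et]].
by apply: (lt_le_trans wt); exact: ub_le_sup.
Unshelve. all: by end_near.
Qed.

Hypothesis tail_gt0 : forall w, 0 < tail w.

Lemma quantile_gt_ln s w : 0 < s -> (w < quantile s) = (- ln (tail w) < s).
Proof.
move=> s0; rewrite quantile_gt// ltrNl -[X in _ < X](@lnK _ (tail w)) ?posrE//.
by rewrite ltr_expR.
Qed.

Lemma ln_tail_le0 w : ln (tail w) <= 0.
Proof. by rewrite ln_le0// tail_le1. Qed.

Lemma measurable_quantile : measurable_fun setT (quantile : mR -> mR).
Proof.
apply: (measurability _ (RGenOInfty.measurableE R)) => //= _ [_ [a ->] <-].
rewrite setTI.
(* For [s <= 0] the quantile has its junk value 0, which lies in the ray exactly when [a < 0]. *)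
have -> : quantile @^-1` `]a, +oo[%classic = `]- ln (tail a), +oo[%classic `|`
    (`]-oo, 0%R]%classic `&` [set _ | a < 0]).
  apply/seteqP; split => s /=; rewrite !in_itv/= ?andbT.
    case: (ltP 0 s) => s0; first by rewrite quantile_gt_ln//; left.
    by rewrite /quantile (ltNge 0 s) s0 /=; right.
  have := ln_tail_le0 a => a0.
  case; first by move=> h; rewrite quantile_gt_ln//; lra.
  by move=> [s0 ?]; rewrite /quantile (ltNge 0 s) s0.
apply: measurableU => //.
case: (a < 0).
  by have -> : [set _ : R | true] = setT; [apply/seteqP|rewrite setIT].
by have -> : [set _ : R | false] = set0; [apply/seteqP; split|rewrite setI0].
Qed.

Let quantileRV : {mfun mR >-> mR} :=
  HB.pack (quantile : mR -> mR)
    (isMeasurableFun.Build _ _ _ _ (quantile : mR -> mR) measurable_quantile).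

(** Both measures give the ray beyond [a] the mass [tail a]: by [quantile_gt_ln] its preimage is the
    ray beyond [- ln (tail a)], up to the junk part [s <= 0], which has no exponential mass. Such
    rays are stable under intersection and generate the Borel sets. *)
Lemma integral_law_quantile (f : mR -> \bar R) :
  measurable_fun setT f -> (forall x, 0 <= f x)%E ->
  (\int[law_of L]_x f x = \int[leb]_s (f (quantile s) * (exponential_pdf 1 s)%:E))%E.
Proof.
move=> mf f0.
have mE : measurable_fun setT (fun x : mR => (exponential_pdf 1 x)%:E).
  by apply/measurable_EFinP; exact: measurable_exponential_pdf.
have mg (g : mR -> \bar R) : measurable_fun setT g ->
    measurable_fun setT ((g \o quantile) : mR -> _).
  by move=> mg; exact: (measurableT_comp mg measurable_quantile).
rewrite -(ge0_integral_exponential_prob (f := f \o quantile)) //=; last exact: mg.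
rewrite -(@ge0_integral_distribution _ _ _ _ R (exponential_prob 1) quantileRV)//.
apply: eq_measure_integral => A mA _.
apply: (@measure_unique _ R mR (@RGenOInfty.G R) (fun n => `]- n%:R, +oo[%classic) _ _ _ _
  (distribution P (borelRV L)) (distribution (exponential_prob 1) quantileRV)) => //.
- exact: RGenOInfty.measurableE.
- move=> _ _ [a ->] [b ->]; exists (Num.max a b).
  by apply/seteqP; split => x /=; rewrite !in_itv /= !andbT gt_max => /andP.
- by move=> n; exists (- n%:R).
- apply/seteqP; split => // x _; exists (Num.truncn (- x)).+1 => //=.
  rewrite in_itv /= andbT ltrNl.
  have [x0|x0] := leP 0 (- x); first by have /andP[] := truncn_itv x0.
  by rewrite (lt_le_trans x0).
- move=> _ [a ->].
  transitivity ((tail a)%:E); first by rewrite tailE.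
  rewrite /= /pushforward /exponential_prob.
  transitivity (\int[leb]_x ((- ln (tail a) < x)%R%:R * expR (- 1 * x))%:E)%E.
    rewrite (@integral_open_ray R _ (fun x => expR (- 1 * x))); last first.
      by apply: measurableT_comp => //; apply: measurable_funM.
    by rewrite integral_ray_expR // mulN1r opprK divr1 lnK ?posrE.
  pose g (x : mR) : R := ((a < quantile x)%R%:R * expR (- 1 * x))%R.
  have Qa x : (x \in (quantile : mR -> mR) @^-1` `]a, +oo[%classic) = (a < quantile x).
    by apply/idP/idP; rewrite inE /= in_itv /= andbT.
  have mgg : measurable_fun setT g.
    apply: measurable_funM; last by apply: measurableT_comp => //; apply: measurable_funM.
    rewrite (_ : (fun _ => _) = \1_(quantile @^-1` `]a, +oo[%classic : set mR)); last first.
      by apply/funext => x; rewrite indicE Qa.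
    apply: measurable_indic; rewrite -[X in measurable X]setTI.
    by apply: measurable_quantile => //.
  transitivity (\int[leb]_x ((0 < x)%R%:R * g x)%:E)%E.
    apply: eq_integral => x _; rewrite /g; case: (ltP 0 x) => x0.
      by rewrite quantile_gt_ln//= mul1r.
    by rewrite ltNge (le_trans x0) ?mul0r// oppr_ge0 ln_tail_le0.
  rewrite integral_open_ray // [RHS]integral_mkcond.
  apply: eq_integral => x _; rewrite patchE.
  rewrite Qa /g.
  rewrite /exponential_pdf patchE mem_setE in_itv /= andbT.
  by case: (0 <= x); case: (a < quantile x); rewrite ?mul1r ?mul0r ?mulr1 ?mulr0.
- by move=> k; rewrite ltey_eq fin_num_measure.
Qed.

(** The substitution [s = t - ln (tail M)] turns the exponential density into [tail M * expR (- t)],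
    on a ray whose end point [ln (tail M)] tends to minus infinity as [M] grows. *)
Lemma integral_law_shift (M : R) (f : mR -> \bar R) :
  measurable_fun setT f -> (forall x, 0 <= f x)%E ->
  (\int[law_of L]_x f x = (tail M)%:E * \int[leb]_t (f (quantile (t - ln (tail M))%R) *
      ((ln (tail M) <= t)%R%:R * expR (- t))%:E))%E.
Proof.
move=> mf f0; rewrite integral_law_quantile//.
pose h (s : mR) := (f (quantile s) * (exponential_pdf 1 s)%:E)%E.
have mh : measurable_fun setT h.
  apply: emeasurable_funM; first exact: (measurableT_comp mf measurable_quantile).
  by apply/measurable_EFinP; exact: measurable_exponential_pdf.
have h0 s : (0 <= h s)%E by rewrite mule_ge0// lee_fin exponential_pdf_ge0.
have := ge0_integral_affine (- ln (tail M)) (oner_neq0 R) mh h0.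
rewrite normr1 invr1 mul1e => <-.
rewrite -ge0_integralZl_EFin//; last 3 first.
- by move=> t _; apply: mule_ge0; [exact: f0|rewrite lee_fin mulr_ge0 ?expR_ge0].
- apply: emeasurable_funM.
    apply: (measurableT_comp mf).
    apply: (measurableT_comp measurable_quantile).
    by apply: measurable_funB.
  have := @measurable_ray_expR R 1 (ln (tail M)).
  by under eq_fun do rewrite mulN1r.
- exact: tail_ge0.
apply: eq_integral => t _; rewrite /h mul1r muleCA; congr (_ * _)%E.
rewrite -EFinM; congr EFin; rewrite /exponential_pdf patchE mem_setE in_itv /= andbT.
rewrite subr_ge0; case: (_ <= _); last by rewrite !mul0r mulr0.
by rewrite !mul1r mulN1r opprB expRD lnK ?posrE.
Qed.

Hypothesis tail_rv : forall h, tail (w + h) / tail w @[w --> +oo] --> expR (- h).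

Lemma quantile_shift_gt t M w : ln (tail M) < t ->
  (w < quantile (t - ln (tail M)) - M) = (expR (- t) < tail (M + w) / tail M).
Proof.
move=> tM; rewrite ltrBrDl quantile_gt ?subr_gt0// opprB expRD lnK ?posrE//.
by rewrite ltr_pdivlMr// mulrC.
Qed.

Lemma near_ln_tail_lt t : \forall M \near +oo, ln (tail M) < t.
Proof.
have /= [M [rM HM]] := cvgr_lt _ tail_cvgy _ (expR_gt0 t).
by exists M; split => // y /HM ht; rewrite -(expRK t) ltr_ln ?posrE ?expR_gt0.
Qed.

(** Generalised inverses converge when the limit is strictly monotone: the ratio
    [tail (M + w) / tail M] tends to [expR (- w)], so for large [M] it is above [expR (- t)] at a
    point left of [t] and below it at a point right of [t]. *)
Lemma quantile_shift_cvg t : quantile (t - ln (tail M)) - M @[M --> +oo] --> t.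
Proof.
apply/cvgrPdist_lt => e e0.
have lo : expR (- t) < expR (- (t - e)) by rewrite ltr_expR; lra.
(* The upper bound will come out nonstrict, whence [e / 2] instead of [e]. *)
have hi : expR (- (t + e / 2)) < expR (- t) by rewrite ltr_expR; lra.
have H1 := cvgr_gt _ (@tail_rv (t - e)) _ lo.
have H2 := cvgr_lt _ (@tail_rv (t + e / 2)) _ hi.
have H3 := near_ln_tail_lt t.
near=> M.
have tM : ln (tail M) < t by near: M.
have h1 : t - e < quantile (t - ln (tail M)) - M.
  by rewrite quantile_shift_gt//; near: M; exact: H1.
have h2 : quantile (t - ln (tail M)) - M <= t + e / 2.
  by rewrite leNgt quantile_shift_gt// -leNgt ltW//; near: M; exact: H2.
by rewrite ltr_norml; apply/andP; split; lra.
Unshelve. all: by end_near.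
Qed.

End Tail.

(** * Exponential moments *)

Section Moments.
Variables (R : realType) (disp : measure_display) (T : measurableType disp).
Variables (P : probability T R) (L : {RV P >-> R}).
Hypothesis tail_gt0 : forall w, 0 < tail L w.
Hypothesis tail_rv : forall h, tail L (w + h) / tail L w @[w --> +oo] --> expR (- h).

(** Potter's bound from the fixed level [w0] to the level [k - 1]; [K] absorbs the distance between
    [h] and [k]. *)
Lemma tail_geometric (eta : R) : 0 < eta < 1 ->
  exists2 K : R, 0 <= K & forall k : nat, tail L (k%:R - 1) <= K * expR (- (1 - eta)) ^+ k.
Proof.
move=> eta01; have [C [w0 [C0 H]]] :=
  potter tail_gt0 (@tail_le1 _ _ _ _ L) (@tail_nincr _ _ _ _ L) tail_rv eta01.
move: eta01 => /andP[eta0 eta1].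
exists (C * expR (2 * (1 + `|w0|))).
  by rewrite mulr_ge0 ?expR_ge0// ltW.
move=> k; have := H w0 (k%:R - 1 - w0) (lexx _).
rewrite addrC subrK => /le_trans; apply.
rewrite -!mulrA ler_pM2l// -expRM_natr -expRD.
apply: (@le_trans _ _ (expR (eta * `|k%:R - 1 - w0| - (k%:R - 1 - w0)))).
  by rewrite ler_piMl ?expR_ge0// tail_le1.
rewrite ler_expR.
have : `|k%:R - 1 - w0| <= k%:R + (1 + `|w0|).
  rewrite -addrA -opprD (le_trans (ler_normB _ _))// ger0_norm// lerD2l.
  by rewrite (le_trans (ler_normD _ _))// normr1.
have : w0 <= `|w0| by exact: ler_norm.
have : 0 <= `|w0| by [].
nra.
Qed.

(** A tail of index -1 has power moments of every order below 1. The term [th * |L w|] makes room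
    for the loss [eta * |h|] in Potter's bounds. *)
Lemma exp_moment_lty (e th m : R) : 0 <= th -> e + th < 1 ->
  {ae P, forall w, - m <= L w} ->
  (\int[P]_w (expR (e * L w + th * `|L w|))%:E < +oo)%E.
Proof.
move=> th0 eth aeL.
(* The maximum with 0 allows [p * L] to be bounded by [p] times the next integer. *)
pose p := Num.max (e + th) 0.
have p0 : 0 <= p by rewrite le_max lexx orbT.
have p1 : p < 1 by rewrite gt_max eth ltr01.
(* With this choice [p - (1 - eta) = - eta], so the dominating series is geometric with ratio
   [expR (- eta)]. *)
pose eta := (1 - p) / 2.
have eta01 : 0 < eta < 1 by rewrite /eta; apply/andP; split; lra.
have [K K0 HK] := tail_geometric eta01.
pose M := (`|e| + th) * `|m|.
(* For positive [L] with [k <= L < k + 1] the integrand is at most [expR M * a k]. The ray starts at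
   [k - 1] so that its strict inequality also holds at [L = k]. *)
pose a (k : nat) (w : T) : R := expR (p * k.+1%:R) * (k%:R - 1 < L w)%R%:R.
have a0 k w : (0 <= (a k w)%:E)%E by rewrite lee_fin mulr_ge0 ?expR_ge0.
have mlt (c : R) : measurable_fun setT (fun w => (c < L w)%R%:R : R).
  rewrite (_ : (fun _ => _) = \1_(L @^-1` `]c, +oo[%classic)); last first.
    by apply/funext => w; rewrite indicE; congr (nat_of_bool _)%:R; apply/idP/idP; rewrite inE /= in_itv /= andbT.
  by apply: measurable_indic; exact: measurable_funPTI.
have ma k : measurable_fun setT (fun w => (a k w)%:E).
  by apply/measurable_EFinP; apply: measurable_funM.
have mL : measurable_fun setT (L : T -> R) by [].
apply: (@le_lt_trans _ _ (\int[P]_w ((expR M)%:E * (1 + \sum_(k <oo) (a k w)%:E)))%E).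
  apply: ae_ge0_le_integral => //.
  - apply/measurable_EFinP; apply: measurableT_comp => //.
    apply: measurable_funD; first exact: measurable_funM.
    by apply: measurable_funM => //; exact: measurableT_comp.
  - by move=> w _; rewrite mule_ge0// ?lee_fin ?expR_ge0// adde_ge0// nneseries_ge0.
  - apply: emeasurable_funM => //; apply: emeasurable_funD => //.
    exact: ge0_emeasurable_sum.
  - apply: filterS aeL => w mLw _.
    have s0 : (0 <= \sum_(k <oo) (a k w)%:E)%E by rewrite nneseries_ge0.
    have [L0|L0] := leP (L w) 0.
      apply: (@le_trans _ _ ((expR M)%:E * 1)%E); last first.
        by apply: lee_wpmul2l; rewrite ?lee_fin ?expR_ge0// leeDl.
      rewrite mule1 lee_fin ler_expR /M ler0_norm//.
      have : `|L w| <= `|m|.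
        by rewrite ler0_norm// (le_trans _ (ler_norm m))// lerNl.
      rewrite ler0_norm// => Lm.
      have : e * L w <= `|e| * - L w.
        by rewrite mulrN -mulNr ler_wnM2r// lerNl -normrN ler_norm.
      have : 0 <= `|e| by []. nra.
    have /andP[k1 k2] := truncn_itv (ltW L0); set k := Num.truncn (L w) in k1 k2.
    apply: (@le_trans _ _ ((expR M)%:E * (a k w)%:E)%E); last first.
      apply: lee_wpmul2l; rewrite ?lee_fin ?expR_ge0//.
      apply: (@le_trans _ _ (\sum_(k <oo) (a k w)%:E)%E); last by rewrite leeDr.
      apply: (le_trans _ (nneseries_lim_ge k.+1 _)) => //.
      by rewrite big_nat_recr//= leeDr// sume_ge0.
    rewrite lee_fin /a ltrBlDr (le_lt_trans k1) ?ltrDl// mulr1 -expRD ler_expR.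
    rewrite gtr0_norm// -mulrDl.
    have M0 : 0 <= M by rewrite mulr_ge0// addr_ge0.
    have ep : e + th <= p by rewrite le_max lexx.
    have : (e + th) * L w <= p * L w by rewrite ler_wpM2r// ltW.
    have : p * L w <= p * k.+1%:R by rewrite ler_wpM2l// ltW.
    lra.
have ms : measurable_fun setT (fun w => \sum_(k <oo) (a k w)%:E)%E.
  exact: ge0_emeasurable_sum.
rewrite ge0_integralZl//; last 2 first.
- exact: emeasurable_funD.
- by move=> w _; rewrite adde_ge0// nneseries_ge0.
rewrite ge0_integralD//; last by move=> w _; rewrite nneseries_ge0.
have -> : (\int[P]__ 1 = 1 :> \bar R)%E by rewrite integral_cst// mul1e; exact: probability_setT.
rewrite integral_nneseries//.
apply: lte_mul_pinfty; rewrite ?lee_fin ?expR_ge0//.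
apply: lte_add_pinfty; first exact: ltry.
pose q := expR (- eta).
apply: (@le_lt_trans _ _ (\sum_(k <oo) (geometric (K * expR p) q k)%:E)%E).
  apply: lee_nneseries => k _; first by move=> _; exact: integral_ge0.
  under eq_integral do rewrite EFinM.
  rewrite ge0_integralZl//; last exact/measurable_EFinP.
  rewrite (_ : \int[P]_w _ = (tail L (k%:R - 1))%:E)%E; last first.
    rewrite tailE -[X in P X]setIT -integral_indic//; last exact: measurable_funPTI.
    apply: eq_integral => w _; rewrite indicE; congr (nat_of_bool _)%:R%:E.
    by apply/idP/idP; rewrite inE /= in_itv /= andbT.
  rewrite -EFinM lee_fin /=.
  apply: (@le_trans _ _ (expR (p * k.+1%:R) * (K * expR (- (1 - eta)) ^+ k))).
    by rewrite ler_pM2l ?expR_gt0.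
  rewrite mulrCA -mulrA ler_wpM2l// /q -!expRM_natr -!expRD ler_expR -natr1.
  by rewrite le_eqVlt; apply/orP; left; apply/eqP; rewrite /eta; field.
have q1 : `|q| < 1 by rewrite ger0_norm ?expR_ge0// expR_lt1 oppr_lt0; case/andP: eta01.
have := cvg_geometric_series (a := K * expR p) q1.
move=> H.
rewrite (_ : (\sum_(k <oo) _)%E = ((K * expR p) * (1 - q)^-1)%:E) ?ltry//.
apply/cvg_lim => //.
under eq_fun do rewrite sumEFin.
by apply: cvg_EFin => //; exact: nearW.
Qed.

End Moments.

(** * The linear program *)

Section LinearProgram.
Variables (R : realType) (d n : nat) (alpha : 'M[R]_(d, n)) (kappa : 'I_n -> R).
Hypothesis sol : lp_solution alpha kappa.

Let kappa_ge0 j : 0 <= kappa j. Proof. by case: sol => -[]. Qed.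

Lemma small_step (delta : 'I_n -> R) : (forall j, kappa j = 0 -> 0 <= delta j) ->
  exists2 t, 0 < t & forall j, 0 <= kappa j + t * delta j.
Proof.
(* Indices with [kappa j = 0] add nothing to [s], as division by 0 gives 0; there [delta j >= 0]
   makes every step length admissible. *)
move=> dk; pose s := 1 + \sum_j `|delta j| / kappa j.
have s0 : 0 < s by rewrite ltr_pwDl// sumr_ge0// => j _; rewrite divr_ge0.
exists s^-1; first by rewrite invr_gt0.
move=> j; have [k0|k0] := eqVneq (kappa j) 0.
  by rewrite k0 add0r mulr_ge0 ?dk// invr_ge0 ltW.
have kp : 0 < kappa j by rewrite lt_def k0 kappa_ge0.
have : `|delta j| / kappa j <= s.
  rewrite /s (bigD1 j)//= addrCA lerDl addr_ge0// sumr_ge0// => i _.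
  by rewrite divr_ge0.
rewrite ler_pdivrMr// -ler_pdivrMl// => h.
have : - `|s^-1 * delta j| <= s^-1 * delta j by rewrite lerNl -normrN ler_norm.
rewrite normrM ger0_norm ?invr_ge0 ?(ltW s0)//; lra.
Qed.

(** Moving along [delta] keeps the left sides of the constraints, and a small step keeps
    nonnegativity. So the objective cannot decrease, and if it does not change, the new point is a
    solution too. *)
Lemma lp_direction (delta : 'I_n -> R) : (forall j, kappa j = 0 -> 0 <= delta j) ->
  (forall i, \sum_j alpha i j * delta j = 0) ->
  0 <= \sum_j delta j /\
  ((forall kappa', lp_solution alpha kappa' -> kappa' = kappa) ->
   \sum_j delta j = 0 -> forall j, delta j = 0).
Proof.
move=> dk ad; have [t t0 kt] := small_step dk.
have fk : lp_feasible alpha (fun j => kappa j + t * delta j).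
  split=> // i; under eq_bigr do rewrite mulrDr mulrCA.
  by rewrite big_split /= -mulr_sumr ad mulr0 addr0; case: sol => -[].
have sE : \sum_j (kappa j + t * delta j) = \sum_j kappa j + t * \sum_j delta j.
  by rewrite big_split /= mulr_sumr.
split.
  have [_ /(_ _ fk)] := sol.
  by rewrite sE lerDl pmulr_rge0.
move=> uniq d0 j.
have /uniq /(congr1 (fun f => f j)) /= /eqP : lp_solution alpha (fun j => kappa j + t * delta j).
  by split=> // k' /(proj2 sol); rewrite sE d0 mulr0 addr0.
by rewrite -subr_eq0 addrC addKr mulf_eq0 gt_eqF//= => /eqP.
Qed.

Hypothesis uniq : forall kappa', lp_solution alpha kappa' -> kappa' = kappa.
Let J := pos_support kappa.
Hypothesis cardJ : #|J| = d.
Let A := cols_of alpha cardJ.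

Definition supp_idx (l : 'I_d) : 'I_n := enum_val (cast_ord (esym cardJ) l).

Lemma supp_idx_inj : injective supp_idx.
Proof. by move=> l l' /enum_val_inj /cast_ord_inj. Qed.

Lemma supp_idx_in l : supp_idx l \in J.
Proof. exact: enum_valP. Qed.

Lemma supp_idx_gt0 l : 0 < kappa (supp_idx l).
Proof. by have := supp_idx_in l; rewrite inE. Qed.

Lemma notin_supp k : k \notin J -> kappa k = 0.
Proof. by rewrite inE -leNgt => k0; apply/eqP; rewrite eq_le k0 kappa_ge0. Qed.

Lemma sum_supp (f : 'I_n -> R) : \sum_(j in J) f j = \sum_l f (supp_idx l).
Proof.
rewrite big_enum_val (reindex (cast_ord (esym cardJ)))//=.
by exists (cast_ord cardJ) => ? _; rewrite ?cast_ordK ?cast_ordKV.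
Qed.

Lemma prod_supp (f : 'I_n -> R) : \prod_(j in J) f j = \prod_l f (supp_idx l).
Proof.
rewrite big_enum_val (reindex (cast_ord (esym cardJ)))//=.
by exists (cast_ord cardJ) => ? _; rewrite ?cast_ordK ?cast_ordKV.
Qed.

Lemma sum_split (f : 'I_n -> R) :
  \sum_j f j = \sum_l f (supp_idx l) + \sum_(k | k \notin J) f k.
Proof. by rewrite (bigID (mem J)) /= sum_supp. Qed.

(** As a direction for [lp_direction], [c = 0] moves within the support, while [c = 1] also
    activates an index [k] outside it. *)
Definition supp_ext (v : 'I_d -> R) (k : 'I_n) (c : R) : 'I_n -> R :=
  fun j => if [pick l | supp_idx l == j] is Some l then v l
           else if j == k then c else 0.

Lemma supp_ext_in v k c l : supp_ext v k c (supp_idx l) = v l.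
Proof.
rewrite /supp_ext; case: pickP => [l' /eqP /supp_idx_inj -> //|/(_ l)].
by rewrite eqxx.
Qed.

Lemma supp_ext_out v k c j : j \notin J -> supp_ext v k c j = if j == k then c else 0.
Proof.
rewrite /supp_ext; case: pickP => // l /eqP <-.
by rewrite supp_idx_in.
Qed.

Lemma exists_supp_idx j : j \in J -> exists l, j = supp_idx l.
Proof.
move=> jJ; exists (cast_ord cardJ (enum_rank_in jJ j)).
by rewrite /supp_idx cast_ordK enum_rankK_in.
Qed.

Lemma colsE i l : A i l = alpha i (supp_idx l).
Proof. by rewrite mxE. Qed.

Lemma sum_supp_ext v k (c : R) (b : 'I_n -> R) : k \notin J ->
  \sum_j b j * supp_ext v k c j = \sum_l b (supp_idx l) * v l + b k * c.
Proof.
move=> kJ; rewrite sum_split; congr (_ + _).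
  by apply: eq_bigr => l _; rewrite supp_ext_in.
rewrite (bigD1 k)//= supp_ext_out// eqxx big1 ?addr0// => j /andP[jJ jk].
by rewrite supp_ext_out// (negbTE jk) mulr0.
Qed.

Lemma sum_supp_ext0 v k (b : 'I_n -> R) :
  \sum_j b j * supp_ext v k 0 j = \sum_l b (supp_idx l) * v l.
Proof.
rewrite sum_split [X in _ + X]big1 ?addr0.
  by apply: eq_bigr => l _; rewrite supp_ext_in.
by move=> j jJ; rewrite supp_ext_out// if_same mulr0.
Qed.

(** As [kappa] is positive on [J], a kernel vector is an admissible direction with either sign;
    hence its entries sum to 0, and uniqueness makes it vanish. *)
Lemma cols_unit : A \in unitmx.
Proof.
rewrite unitmxE unitfE; apply/negP; rewrite -det_tr => /det0P[v v0 vA].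
have [l0 vl0] : exists l, v 0 l != 0 by apply/rV0Pn.
pose k := supp_idx l0.
have Av i : \sum_l A i l * v 0 l = 0.
  have := congr1 (fun M : 'rV_d => M 0 i) vA; rewrite !mxE => h; rewrite -[RHS]h.
  by apply: eq_bigr => l _; rewrite [A^T _ _]mxE mulrC.
have H (s : R) : 0 <= \sum_j supp_ext (fun l => s * v 0 l) k 0 j /\
    (\sum_j supp_ext (fun l => s * v 0 l) k 0 j = 0 -> forall j, supp_ext (fun l => s * v 0 l) k 0 j = 0).
  have [||h1 h2] := @lp_direction (supp_ext (fun l => s * v 0 l) k 0).
  - move=> j kj; rewrite supp_ext_out ?if_same//.
    by rewrite inE kj ltxx.
  - move=> i; rewrite sum_supp_ext0.
    under eq_bigr do rewrite mulrCA.
    rewrite -mulr_sumr; apply/eqP; rewrite mulf_eq0; apply/orP; right; apply/eqP.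
    by rewrite -[RHS](Av i); apply: eq_bigr => l _; rewrite colsE.
  - by split=> //; exact: h2.
have S s : \sum_j supp_ext (fun l => s * v 0 l) k 0 j = s * \sum_l v 0 l.
  under eq_bigr do rewrite -[supp_ext _ _ _ _]mul1r.
  rewrite (sum_supp_ext0 _ _ (fun _ => 1)) mulr_sumr.
  by apply: eq_bigr => l _; rewrite mul1r.
have s0 : \sum_l v 0 l = 0.
  have := proj1 (H 1); have := proj1 (H (-1)); rewrite !S; lra.
have := proj2 (H 1); rewrite S s0 mulr0 => /(_ erefl) /(_ (supp_idx l0)).
by rewrite supp_ext_in mul1r => /eqP; rewrite (negbTE vl0).
Qed.

(** The direction raises coordinate [k] by 1 and compensates on [J] so that all constraints keep
    their values; the objective changes by 1 minus the moment exponent. This is not 0, since the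
    direction is nonzero and the solution unique. *)
Lemma moment_exponent_lt1 k : k \notin J -> moment_exponent alpha A k < 1.
Proof.
move=> kJ; pose v l := - \sum_i invmx A l i * alpha i k.
have Av i : \sum_l A i l * v l = - alpha i k.
  rewrite /v; under eq_bigr do rewrite mulrN mulr_sumr.
  rewrite sumrN exchange_big /=; congr (- _).
  transitivity (\sum_j (A *m invmx A) i j * alpha j k).
    by apply: eq_bigr => j _; rewrite mxE mulr_suml; apply: eq_bigr => l _; rewrite mulrA.
  rewrite mulmxV ?cols_unit// (bigD1 i)//= mxE eqxx mul1r big1 ?addr0// => j ji.
  by rewrite mxE eq_sym (negbTE ji) mul0r.
have [||h1 h2] := @lp_direction (supp_ext v k 1).
- move=> j kj; rewrite supp_ext_out; first by case: ifP.
  by rewrite inE kj ltxx.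
- move=> i; rewrite sum_supp_ext// mulr1.
  rewrite -[X in _ + X]opprK -Av -mulN1r mulr_sumr -big_split /= big1// => l _.
  by rewrite colsE; ring.
have S : \sum_j supp_ext v k 1 j = 1 - moment_exponent alpha A k.
  under eq_bigr do rewrite -[supp_ext _ _ _ _]mul1r.
  rewrite (sum_supp_ext _ _ (fun _ => 1))// mulr1 addrC; congr (_ + _).
  by rewrite -sumrN; apply: eq_bigr => l _; rewrite mul1r.
rewrite S subr_ge0 in h1; rewrite lt_neqAle h1 andbT; apply/eqP => e1.
have := h2 uniq; rewrite S e1 subrr => /(_ erefl k).
by rewrite supp_ext_out// eqxx => /eqP; rewrite oner_eq0.
Qed.

Hypothesis invA_gt0 : forall l i, 0 < invmx A l i.

(** With slack [r], the restriction of [kappa] to [J] is [A^-1 (1 + r)]. Positivity of [A^-1] makes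
    [A^-1 1], extended by 0, feasible; optimality then forces the nonnegative vector [A^-1 r] to
    vanish. *)
Lemma kappa_supp l : kappa (supp_idx l) = \sum_i invmx A l i.
Proof.
pose r i := \sum_l A i l * kappa (supp_idx l) - 1.
have Ak i : \sum_j alpha i j * kappa j = \sum_l A i l * kappa (supp_idx l).
  rewrite sum_split [X in _ + X]big1 ?addr0.
    by apply: eq_bigr => l' _; rewrite colsE.
  by move=> j /notin_supp ->; rewrite mulr0.
have r0 i : 0 <= r i by rewrite subr_ge0 -Ak; case: sol => -[].
have kE l' : kappa (supp_idx l') = \sum_i invmx A l' i * (1 + r i).
  rewrite /r; under eq_bigr do rewrite addrC subrK mulr_sumr.
  rewrite exchange_big /=.
  transitivity (\sum_j (invmx A *m A) l' j * kappa (supp_idx j)).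
    rewrite mulVmx ?cols_unit// (bigD1 l')//= mxE eqxx mul1r big1 ?addr0// => j jl.
    by rewrite mxE eq_sym (negbTE jl) mul0r.
  by apply: eq_bigr => j _; rewrite mxE mulr_suml; apply: eq_bigr => i _; rewrite mulrA.
pose k' := supp_ext (fun l => \sum_i invmx A l i) (supp_idx l) 0.
have fk : lp_feasible alpha k'.
  split=> [i|j].
    rewrite sum_supp_ext0; rewrite le_eqVlt; apply/orP; left; apply/eqP/esym.
    under eq_bigr do rewrite mulr_sumr.
    rewrite exchange_big /=.
    transitivity (\sum_j (A *m invmx A) i j).
      by apply: eq_bigr => j _; rewrite mxE; apply: eq_bigr => l' _; rewrite colsE.
    rewrite mulmxV ?cols_unit// (bigD1 i)//= mxE eqxx big1 ?addr0// => j ji.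
    by rewrite mxE eq_sym (negbTE ji).
  have [/exists_supp_idx[l' ->]|jJ] := boolP (j \in J).
    by rewrite /k' supp_ext_in sumr_ge0// => i _; rewrite ltW.
  by rewrite /k' supp_ext_out// if_same.
have := proj2 sol _ fk.
have -> : \sum_j k' j = \sum_l \sum_i invmx A l i.
  under eq_bigr do rewrite -[k' _]mul1r.
  by rewrite (sum_supp_ext0 _ _ (fun _ => 1)); apply: eq_bigr => l' _; rewrite mul1r.
rewrite sum_split [X in _ + X]big1 ?addr0; last by move=> j /notin_supp.
under eq_bigr do rewrite kE; rewrite -subr_le0 -sumrB.
have E l' : \sum_i invmx A l' i * (1 + r i) - \sum_i invmx A l' i = \sum_i invmx A l' i * r i.
  by rewrite -sumrB; apply: eq_bigr => i _; ring.
under eq_bigr do rewrite E.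
move=> h; rewrite kE; apply/eqP; rewrite -subr_eq0 E eq_le; apply/andP; split.
  apply: le_trans h; rewrite [leRHS](bigD1 l)//= lerDl sumr_ge0// => l' _.
  by rewrite sumr_ge0// => i _; rewrite mulr_ge0// ltW.
by rewrite sumr_ge0// => i _; rewrite mulr_ge0// ltW.
Qed.

End LinearProgram.

(** * Logarithmic asymptotics *)

Section TailOrder.
Variables (R : realType) (disp : measure_display) (T : measurableType disp).
Variables (P : probability T R) (n : nat) (L : 'I_n -> {RV P >-> R}) (m : R).
Hypothesis indL : independent_RVs L.
Hypothesis L_ge : forall j w, - m <= L j w.
Hypothesis tail_gt0 : forall j w, 0 < tail (L j) w.
Hypothesis tail_rv : forall j h,
  tail (L j) (w + h) / tail (L j) w @[w --> +oo] --> expR (- h).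
Variables (d : nat) (alpha : 'M[R]_(d, n)) (kappa : 'I_n -> R).
Hypothesis sol : lp_solution alpha kappa.
Local Notation mR := (measurableTypeR R).
Local Notation K := (\sum_j kappa j).

Definition exceed (c : 'I_d -> R) (N : R) : set T :=
  [set w | forall i, c i + N < \sum_j alpha i j * L j w].

Lemma measurable_exceed c N : measurable (exceed c N).
Proof.
have -> : exceed c N = \bigcap_(i in [set: 'I_d])
    ((fun w => \sum_j alpha i j * L j w) @^-1` `]c i + N, +oo[%classic).
  apply/seteqP; split => w /= H i; first by move=> _; rewrite /= in_itv /= andbT.
  by have := H i I; rewrite /= in_itv /= andbT.
apply: fin_bigcap_measurable => [|i _]; first exact: finite_finset.
rewrite -[X in measurable X]setTI.
have mf : measurable_fun setT (fun w => \sum_j alpha i j * L j w).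
  by apply: measurable_sum => j; apply: measurable_funM.
exact: mf.
Qed.

(* No duality is needed: on the event, the positive parts of the [L j] divided by
   [N - M] are feasible, so their sum is at least [K (N - M)], and Markov's
   inequality for [exp ((1 - eta) * sum)] gives the bound. *)
Lemma prob_exceed_upper (eps : R) : 0 < eps -> exists C N0 : R, forall N, N0 <= N ->
  fine (P (exceed (fun=> 0) N)) <= C * expR ((eps - K) * N).
Proof.
move=> eps0.
have kappa_ge0 j : 0 <= kappa j by case: sol => -[].
have K0 : 0 <= K by rewrite sumr_ge0.
(* Chosen so that [eta < 1] and [eta * K <= eps]: the order [1 - eta] keeps the moments finite and
   the loss [eta * K * N] fits into [eps * N]. *)
pose eta := eps / (eps + K + 1).
have den0 : 0 < eps + K + 1 by rewrite addr_gt0// ltr_wpDr.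
have eta0 : 0 < eta by rewrite divr_gt0.
have eta1 : eta < 1 by rewrite ltr_pdivrMr// mul1r; lra.
have etaK : eta * K <= eps.
  by rewrite mulrAC ler_pdivrMr// ler_wpM2l ?ltW//; lra.
(* [M] bounds what the negative parts of the [L j], at most [|m|] each, contribute to any
   constraint. *)
pose M := \sum_i \sum_j `|alpha i j| * `|m|.
have M0 : 0 <= M by apply: sumr_ge0 => i _; apply: sumr_ge0 => j _; rewrite mulr_ge0.
pose u (x : R) := Num.max x 0.
pose f (j : 'I_n) (x : mR) : \bar R := (expR ((1 - eta) * u x))%:E.
have mf j : measurable_fun setT (f j).
  apply/measurable_EFinP; apply: measurableT_comp => //.
  apply: measurable_funM => //.
  by apply: measurable_maxr.
have f0 j x : (0 <= f j x)%E by rewrite lee_fin expR_ge0.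
have fE : (\int[P]_w \prod_j f j (L j w) \is a fin_num)%E.
  rewrite expectation_prod//; apply: prode_fin_num => j _.
  rewrite ge0_fin_numE; last by apply: integral_ge0.
  under eq_integral => w _.
    (* The positive part of [x] is half of [x + |x|], which gives the form treated by
       [exp_moment_lty]. *)
    rewrite (_ : f j (L j w) = (expR ((1 - eta) / 2 * L j w + (1 - eta) / 2 * `|L j w|))%:E); last first.
      congr (expR _)%:E; rewrite -mulrDr -mulrA; congr (_ * _).
      rewrite /u; have [h|h] := leP (L j w) 0.
        by rewrite ler0_norm// subrr mulr0.
      by rewrite gtr0_norm//; field.
    over.
  apply: (@exp_moment_lty _ _ _ _ (L j) (@tail_gt0 j) (@tail_rv j) _ _ m); [lra|lra|].
  by apply: aeW => w; exact: L_ge.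
pose C' := fine (\int[P]_w \prod_j f j (L j w))%E.
exists (C' * expR ((1 - eta) * (K * M))), (M + 1) => N hN.
have N0 : 0 < N - M by lra.
have key w : exceed (fun=> 0) N w -> (1 - eta) * (K * (N - M)) <= \sum_j (1 - eta) * u (L j w).
  move=> ew; rewrite -mulr_sumr ler_wpM2l ?subr_ge0 ?(ltW eta1)//.
  have /(proj2 sol) : lp_feasible alpha (fun j => u (L j w) / (N - M)).
    split=> [i|j]; last by rewrite divr_ge0 ?(ltW N0)// le_max lexx orbT.
    under eq_bigr do rewrite mulrA.
    rewrite -mulr_suml ler_pdivlMr// mul1r.
    have /ltW := ew i; rewrite add0r => h.
    rewrite lerBlDr (le_trans h)// -lerBlDl -sumrB.
    apply: (@le_trans _ _ (\sum_j `|alpha i j| * `|m|)); last first.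
      by rewrite /M (bigD1 i)//= lerDl; apply: sumr_ge0 => i' _; apply: sumr_ge0 => j _; rewrite mulr_ge0.
    apply: ler_sum => j _; rewrite -mulrBr.
    apply: (le_trans (ler_norm _)); rewrite normrM ler_wpM2l//.
    rewrite /u; have [h0|h0] := leP (L j w) 0.
      by rewrite subr0 ler0_norm// (le_trans _ (ler_norm m))// lerNl.
    by rewrite subrr normr0.
  by rewrite -mulr_suml ler_pdivlMr.
have : ((fine (P (exceed (fun=> 0) N)) * expR ((1 - eta) * (K * (N - M))))%:E <= C'%:E)%E.
  rewrite /C' fineK// EFinM fineK ?fin_num_measure//; last exact: measurable_exceed.
  rewrite -[X in P X]setIT -integral_indic//; last exact: measurable_exceed.
  rewrite muleC -ge0_integralZl_EFin ?expR_ge0//; last first.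
    by apply/measurable_EFinP/measurable_indic; exact: measurable_exceed.
  apply: ge0_le_integral => //.
  - apply: measurable_funeM; apply/measurable_EFinP/measurable_indic; exact: measurable_exceed.
  - apply: emeasurable_prod => j _; exact: (measurableT_comp (mf j) (measurable_funPT (borelRV (L j)))).
  - move=> w _; rewrite indicE; case: (boolP (w \in _)) => [|_]; last by rewrite mule0 prode_ge0.
    rewrite inE => /key h; rewrite mule1.
    rewrite /f prodEFin lee_fin -expR_sum ler_expR//.
rewrite lee_fin -ler_pdivlMr ?expR_gt0// => /le_trans; apply.
have C'0 : 0 <= C' by rewrite fine_ge0// integral_ge0// => w _; exact: prode_ge0.
rewrite -expRN -mulrA ler_wpM2l// -expRD.
rewrite ler_expR -subr_ge0.
rewrite (_ : _ - _ = (eps - eta * K) * N); last by ring.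
rewrite mulr_ge0 ?subr_ge0//; lra.
Qed.

Lemma prob_itv j (a b : R) : a <= b ->
  fine (P (L j @^-1` `]a, b]%classic)) = tail (L j) a - tail (L j) b.
Proof.
move=> ab; apply: EFin_inj; rewrite fineK ?fin_num_measure; last exact: measurable_funPTI.
rewrite EFinB !tailE.
have -> : L j @^-1` `]a, b]%classic =
    L j @^-1` `]a, +oo[%classic `\` L j @^-1` `]b, +oo[%classic.
  apply/seteqP; split => w /=; rewrite !in_itv /= !andbT.
    by move=> /andP[aw wb]; split => //; apply/negP; rewrite -leNgt.
  by move=> [-> /negP]; rewrite -leNgt.
have mray c : measurable (L j @^-1` `]c, +oo[%classic) by exact: measurable_funPTI.
rewrite measureD ?setIidr//.
- by move=> w /=; rewrite !in_itv /= !andbT; exact: le_lt_trans.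
- by rewrite ltey_eq fin_num_measure.
- by [].
Qed.

(** Potter's bound read from the large level [w] back to the fixed level [w0]. *)
Lemma tail_lower j (eta : R) : 0 < eta < 1 -> exists c N0 : R, 0 < c /\
  forall w, N0 <= w -> c * expR (- ((1 + eta) * w)) <= tail (L j) w.
Proof.
move=> eta01; have [C [w0 [C0 H]]] := potter (@tail_gt0 j) (@tail_le1 _ _ _ _ (L j))
  (@tail_nincr _ _ _ _ (L j)) (@tail_rv j) eta01.
exists (tail (L j) w0 / C * expR ((1 + eta) * w0)), w0.
split; first by rewrite mulr_gt0 ?expR_gt0// divr_gt0.
move=> w w0w; have := H w (w0 - w) w0w.
rewrite addrC subrK ler0_norm ?subr_le0// => h.
rewrite -mulrA -expRD mulrAC ler_pdivrMr// [leRHS]mulrC.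
rewrite -ler_pdivlMr ?expR_gt0// -expRN (le_trans h)// ler_wpM2l//.
  by rewrite mulr_ge0// ltW.
by rewrite ler_expR le_eqVlt; apply/orP; left; apply/eqP; ring.
Qed.

(** For [t > 0] a box of half-width 1 has at least a fixed fraction of the mass [tail (t * N)], by
    regular variation. For [t = 0] the level does not grow, and a wide fixed box of mass at least
    1/2 is used. *)
Lemma box_lower j (t eta : R) : 0 <= t -> 0 < eta < 1 ->
  exists b c N0 : R, [/\ 0 <= b, 0 < c & forall N, N0 <= N ->
  c * expR (- ((1 + eta) * (t * N))) <=
  fine (P (L j @^-1` `](t * N - b), (t * N + b)]%classic))].
Proof.
move=> t0 eta01; have [t_eq0|t_neq0] := eqVneq t 0.
  have h14 : 0 < 4^-1 :> R by lra.
  have h34 : 3 / 4 < 1 :> R by lra.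
  have /= [M1 [_ H1]] := cvgr_lt _ (tail_cvgy (L j)) _ h14.
  have /= [M2 [_ H2]] := cvgr_gt _ (tail_cvgNy (L j)) _ h34.
  exists (`|M1| + `|M2| + 1), 2^-1, 0; split; [|lra|].
    by rewrite addr_ge0// addr_ge0.
  move=> N _; rewrite t_eq0 mul0r mulr0 oppr0 expR0 mulr1 prob_itv; last first.
    by rewrite lerD2l; have := normr_ge0 M1; have := normr_ge0 M2; lra.
  have := H1 (0 + (`|M1| + `|M2| + 1)).
  have := H2 (0 - (`|M1| + `|M2| + 1)).
  have h1 := ler_norm M1; have : - `|M2| <= M2 by rewrite lerNl -normrN ler_norm.
  have h3 := normr_ge0 M1; have h4 := normr_ge0 M2 => h2.
  have -> : 0 - (`|M1| + `|M2| + 1) < M2 by lra.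
  have -> : M1 < 0 + (`|M1| + `|M2| + 1) by lra.
  by move=> /(_ isT) q1 /(_ isT) q2; lra.
have tp : 0 < t by rewrite lt_def t_neq0.
have e1 : expR (- 1) < 1 :> R by rewrite expR_lt1; lra.
have [c [N1 [c0 Hc]]] := tail_lower j eta01.
have rlt : expR (- 1) < (1 + expR (- 1)) / 2 :> R by lra.
have /= [M1 [_ H1]] := cvgr_lt _ (@tail_rv j 1) _ rlt.
exists 1, (c * ((1 - expR (- 1)) / 2)), ((`|M1| + `|N1| + 1) / t).
split => //.
  by rewrite mulr_gt0//; lra.
move=> N; rewrite ler_pdivrMr// mulrC => hN.
have h1 := ler_norm M1; have h2 := ler_norm N1.
have h3 := normr_ge0 M1; have h4 := normr_ge0 N1.
rewrite prob_itv; last lra.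
have w1 : N1 <= t * N by lra.
have w2 : M1 < t * N by lra.
have := Hc _ w1; have := H1 _ w2; rewrite ltr_pdivrMr// => q1 q2.
have q3 : tail (L j) (t * N) <= tail (L j) (t * N - 1) by apply: tail_nincr; lra.
set x := expR (- ((1 + eta) * (t * N))) in q2 *.
set y := tail (L j) (t * N) in q1 q2 q3 *.
set z := expR (- 1) in q1 e1 *.
nra.
Qed.

(* The event contains the box where each [L j] is at bounded distance from
   [(1 + eta) * kappa j * N]. *)
Lemma prob_exceed_lower (eps : R) : 0 < eps -> exists c N0 : R, 0 < c /\
  forall N, N0 <= N ->
  c * expR (- ((eps + K) * N)) <= fine (P (exceed (fun=> 0) N)).
Proof.
move=> eps0.
have kappa_ge0 j : 0 <= kappa j by case: sol => -[].
have K0 : 0 <= K by rewrite sumr_ge0.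
(* One factor [1 + eta] comes from the centres of the boxes, another from [box_lower], and
   [(1 + eta)^2 <= 1 + 3 * eta]. *)
pose eta := eps / (3 * K + 2 * eps + 2).
have den0 : 0 < 3 * K + 2 * eps + 2 by lra.
have eta0 : 0 < eta by rewrite divr_gt0.
have eta1 : eta < 1 by rewrite ltr_pdivrMr// mul1r; lra.
have etaK : 3 * eta * K <= eps.
  by rewrite /eta mulrA mulrAC ler_pdivrMr//; nra.
have eta01 : 0 < eta < 1 by rewrite eta0.
pose t j := (1 + eta) * kappa j.
have t0 j : 0 <= t j by rewrite mulr_ge0//; lra.
have /choice[b /choice[c /choice[N0 H]]] j := box_lower j (t0 j) eta01.
have b0 j : 0 <= b j by case: (H j).
have c0 j : 0 < c j by case: (H j).
pose M := \sum_i \sum_j `|alpha i j| * b j.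
have M0 : 0 <= M by apply: sumr_ge0 => i _; apply: sumr_ge0 => j _; rewrite mulr_ge0.
(* Beyond [(M + 1) / eta] the surplus [eta * N] of the box centres exceeds the deviation [M] allowed
   by the boxes; the other summand majorises all thresholds [N0 j]. *)
exists (\prod_j c j), (\sum_j `|N0 j| + (M + 1) / eta); split; first exact: prodr_gt0.
move=> N hN.
have S0 : 0 <= \sum_j `|N0 j| by rewrite sumr_ge0.
have hN0 j : N0 j <= N.
  apply: le_trans hN; apply: (le_trans (ler_norm _)).
  have q : 0 <= (M + 1) / eta by rewrite divr_ge0 ?(ltW eta0)//; lra.
  rewrite (bigD1 j)//= -addrA lerDl addr_ge0// sumr_ge0// => ? _; exact: normr_ge0.
have hM : M + 1 <= N * eta.
  by rewrite -ler_pdivrMr//; lra.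
have N_ge0 : 0 <= N.
  by apply: le_trans hN; rewrite addr_ge0// divr_ge0 ?(ltW eta0)//; lra.
pose B j : set R := `](t j * N - b j), (t j * N + b j)]%classic.
have mB j : measurable (B j) by exact: measurable_itv.
set E := [set w | forall j, j \in [set: 'I_n]%SET -> B j (L j w)].
have mE : measurable E.
  have -> : E = \bigcap_(j in [set: 'I_n]) (L j @^-1` B j).
    by apply/seteqP; split => w /= h j _; apply: h; rewrite ?inE.
  apply: fin_bigcap_measurable => [|j _]; first exact: finite_finset.
  exact: measurable_funPTI.
apply: (@le_trans _ _ (fine (P E))); last first.
  rewrite fine_le ?fin_num_measure//; try exact: measurable_exceed.
  apply: le_measure; rewrite ?inE//; first exact: measurable_exceed.
  move=> w /= hw i; rewrite add0r.
  have a1 : (1 + eta) * N <= \sum_j alpha i j * (t j * N).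
    have := proj1 (proj1 sol) i; rewrite -(@ler_pM2r _ ((1 + eta) * N)); last first.
      rewrite mulr_gt0//; [lra|]. 
      by rewrite -(pmulr_lgt0 _ eta0); lra.
    rewrite mul1r mulr_suml => /le_trans; apply.
    by apply: ler_sum => j _; rewrite /t le_eqVlt; apply/orP; left; apply/eqP; ring.
  have a2 : `|\sum_j alpha i j * (t j * N) - \sum_j alpha i j * L j w| <= M.
    rewrite -sumrB (le_trans (ler_norm_sum _ _ _))//.
    apply: (@le_trans _ _ (\sum_j `|alpha i j| * b j)); last first.
      by rewrite /M (bigD1 i)//= lerDl; apply: sumr_ge0 => i' _; apply: sumr_ge0 => j _; rewrite mulr_ge0.
    apply: ler_sum => j _; rewrite -mulrBr normrM ler_wpM2l// ler_norml.
    have := hw j; rewrite inE /B /= in_itv /= => /(_ isT) /andP[? ?].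
    by apply/andP; split; lra.
  move: a2; rewrite ler_norml => /andP[_ a2]; lra.
rewrite /E indL// fine_prode; last first.
  by move=> j _; rewrite fin_num_measure//; exact: measurable_funPTI.
apply: (@le_trans _ _ (\prod_j (c j * expR (- ((1 + eta) * (t j * N)))))); last first.
  rewrite [leRHS](eq_bigl xpredT); last by move=> j; rewrite inE.
  apply: ler_prod => j _; rewrite mulr_ge0 ?expR_ge0 ?(ltW (c0 j))//=.
  by case: (H j) => _ _; apply.
rewrite big_split /= -expR_sum ler_wpM2l//.
  by rewrite prodr_ge0// => j _; rewrite ltW.
rewrite ler_expR sumrN lerN2 /t.
have -> : \sum_j (1 + eta) * ((1 + eta) * kappa j * N) = (1 + eta) ^+ 2 * K * N.
  by rewrite mulrAC mulr_sumr; apply: eq_bigr => j _; ring.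
by rewrite ler_wpM2r//; nra.
Qed.

End TailOrder.

(** * Exact asymptotics *)

Section Indicators.
Variables (R : realType) (d : measure_display) (S : measurableType d).

Lemma measurable_natb (b : S -> bool) :
  measurable_fun setT b -> measurable_fun setT (fun s => (b s)%:R : R).
Proof.
move=> mb; have -> : (fun s => (b s)%:R : R) = \1_(b @^-1` [set true]).
  by apply/funext => s; rewrite indicE; congr (nat_of_bool _)%:R; apply/idP/idP; rewrite inE.
by apply: measurable_indic; rewrite -[X in measurable X]setTI; exact: mb.
Qed.

Lemma measurable_forallb (I : finType) (b : I -> S -> bool) :
  (forall i, measurable_fun setT (b i)) ->
  measurable_fun setT (fun s => [forall i, b i s]).
Proof.
move=> mb; apply: (measurable_fun_bool true); rewrite setTI.
have -> : (fun s => [forall i, b i s]) @^-1` [set true] =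
    \bigcap_(i in [set: I]) (b i @^-1` [set true]).
  apply/seteqP; split => s /=.
    by move=> /forallP bs i _; exact: bs.
  by move=> bs; apply/forallP => i; exact: bs.
apply: fin_bigcap_measurable => [|i _]; first exact: finite_finset.
by rewrite -[X in measurable X]setTI; exact: mb.
Qed.

End Indicators.

(** * From lower limits to limits *)

Section Squeeze.
Variable R : realType.

Lemma near_limn_einf (u : (\bar R)^nat) (V e : R) : (V%:E <= limn_einf u)%E -> 0 < e ->
  \forall k \near \oo, ((V - e)%:E <= u k)%E.
Proof.
move=> Vu e0; have : ((V - e)%:E < limn_einf u)%E.
  by apply: lt_le_trans Vu; rewrite lte_fin ltrBlDr ltrDl.
rewrite limn_einf_lim.
have -> : limn (einfs u) = ereal_sup (range (einfs u)).
  by apply/cvg_lim => //; apply: ereal_nondecreasing_cvgn; exact: nondecreasing_einfs.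
move=> /ereal_sup_gt[_ [n _ <-] h]; exists n => // k /= nk.
by apply: (le_trans (ltW h)); apply: ereal_inf_lbound; exists k.
Qed.

(* Fatou applied to both [a] and [b] yields the limit of [a] as soon as the
   limit of [a + b] does not exceed the sum of the two lower bounds. *)
Lemma cvg_liminf_split (a b : (\bar R)^nat) (V W : \bar R) (G : R) :
  (forall k, 0 <= a k)%E -> (forall k, 0 <= b k)%E -> (0 <= V)%E -> (0 <= W)%E ->
  (V <= limn_einf a)%E -> (W <= limn_einf b)%E ->
  (fun k => a k + b k)%E @ \oo --> G%:E -> (G%:E <= V + W)%E ->
  V \is a fin_num /\ fine (a k) @[k --> \oo] --> fine V.
Proof.
move=> a0 b0 V0 W0 Va Wb abG GVW.
have finle (U : \bar R) (u : (\bar R)^nat) : (0 <= U)%E -> (U <= limn_einf u)%E ->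
    (forall k, u k <= a k + b k)%E -> U \is a fin_num.
  move=> U0 Uu uab; rewrite ge0_fin_numE// (le_lt_trans Uu)//.
  rewrite (le_lt_trans (le_limn_einf uab))//.
  by rewrite (cvg_limn_einf_sup abG).1 ltry.
have Vf : V \is a fin_num by apply: (finle V a) => // k; rewrite leeDl.
have Wf : W \is a fin_num by apply: (finle W b) => // k; rewrite leeDr.
split => //.
move: Vf Wf V0 W0 Va Wb GVW; case: V => // v _; case: W => // w _.
rewrite !lee_fin => v0 w0 Va Wb Gvw /=.
apply/cvgrPdist_lt => e e0.
have e4 : 0 < e / 4 by rewrite divr_gt0.
have H1 := near_limn_einf Va e4.
have H2 := near_limn_einf Wb e4.
have H3 : \forall k \near \oo, (a k + b k < (G + e / 4)%:E)%E.
  have [abf abr] := (fine_cvgP _ _).1 abG.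
  have Ge : G < G + e / 4 by rewrite ltrDl.
  have abr' := cvgr_lt _ abr _ Ge.
  near=> k; rewrite -[X in (X < _)%E]fineK; last by near: k.
  by rewrite lte_fin; near: k; exact: abr'.
near=> k.
have h1 : ((v - e / 4)%:E <= a k)%E by near: k.
have h2 : ((w - e / 4)%:E <= b k)%E by near: k.
have h3 : (a k + b k < (G + e / 4)%:E)%E by near: k.
have : a k \is a fin_num.
  by rewrite ge0_fin_numE// (@le_lt_trans _ _ (a k + b k)%E) ?leeDl// (lt_trans h3)// ltry.
have : b k \is a fin_num.
  by rewrite ge0_fin_numE// (@le_lt_trans _ _ (a k + b k)%E) ?leeDr// (lt_trans h3)// ltry.
move: h1 h2 h3; case: (b k) => // y; case: (a k) => // x.
rewrite -EFinD !lee_fin lte_fin /= => h1 h2 h3 _ _.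
by rewrite ltr_norml; apply/andP; split; lra.
Unshelve. all: by end_near.
Qed.

End Squeeze.

(** * Substitution and Fatou's lemma for iterated integrals *)

Section Substitution.
Variable R : realType.
Local Notation mR := (measurableTypeR R).

(** The integral hypothesis says that [mu i] is the image under [phi i] of the measure with density
    [w i] with respect to [nu i]; it is applied to one coordinate after the other. *)
Lemma iint_subst d (S : measurableType d) s n
    (mu nu : 'I_n -> {sigma_finite_measure set mR -> \bar R})
    (phi : 'I_n -> mR -> mR) (w : 'I_n -> mR -> \bar R) (F : S -> ('I_n -> R) -> \bar R) :
  (forall i, measurable_fun setT (phi i)) -> (forall i, measurable_fun setT (w i)) ->
  (forall i x, 0 <= w i x)%E ->
  (forall i (f : mR -> \bar R), measurable_fun setT f -> (forall x, 0 <= f x)%E ->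
    \int[mu i]_x f x = \int[nu i]_x (w i x * f (phi i x)))%E ->
  pmeas F -> (forall s v, 0 <= F s v)%E ->
  (iint mu (F s) = iint nu (fun v => \prod_i w i (v i) * F s (fun i => phi i (v i))))%E.
Proof.
elim: n d S s mu nu phi w F => [|n IH] d S s mu nu phi w F mphi mw w0 H mF F0 /=.
  by rewrite big_ord0 mul1e; congr (F s _); apply/funext => -[].
rewrite H; last 2 first.
- exact: iint_measurable1.
- by move=> x; exact: iint_ge0.
apply: eq_integral => x _.
rewrite (IH _ mR (phi ord0 x : mR) _ (fun i => nu (lift ord0 i)) (fun i => phi (lift ord0 i))
  (fun i => w (lift ord0 i)) (fun x v => F s (fcons x v)))//; last 2 first.
- by move=> i f; exact: H.
- exact: pmeas_fconsr.
rewrite -(@iintZl _ _ S s _ _ (fun s v => \prod_i w (lift ord0 i) (v i) *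
    F s (fcons (phi ord0 x) (fun i => phi (lift ord0 i) (v i))))%E)//.
- apply: eq_iint => v; rewrite big_ord_recl fcons0 -muleA; congr (_ * (_ * F s _))%E.
    by apply: eq_bigr => i _; rewrite fconsS.
  by apply/funext => i; case: (unliftP ord0 i) => [k ->|->]; rewrite ?fconsS ?fcons0.
- move=> d' S' h v mh mv; apply: emeasurable_funM.
    by apply: emeasurable_prod => i _; exact: measurableT_comp (mw _) (mv i).
  apply: (mF _ _ h (fun i s => fcons (phi ord0 x) (fun i => phi (lift ord0 i) (v i s)) i)) => // i.
  rewrite /fcons; case: unliftP => [k _|_] /=; last exact: measurable_cst.
  exact: measurableT_comp (mphi _) (mv k).
- by move=> s' v; rewrite mule_ge0// prode_ge0.
Qed.

Lemma integral_iint_fatou d (S : measurableType d) n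
    (m : {measure set S -> \bar R})
    (mu : 'I_n -> {sigma_finite_measure set mR -> \bar R})
    (G : S -> ('I_n -> R) -> \bar R) (F : nat -> S -> ('I_n -> R) -> \bar R) :
  pmeas G -> (forall s v, 0 <= G s v)%E ->
  (forall k, pmeas (F k)) -> (forall k s v, 0 <= F k s v)%E ->
  (forall s v, G s v <= limn_einf (fun k => F k s v))%E ->
  (\int[m]_s iint mu (G s) <= limn_einf (fun k => \int[m]_s iint mu (F k s)))%E.
Proof.
move=> mG G0 mF F0 GF.
apply: (@le_trans _ _ (\int[m]_s limn_einf (fun k => iint mu (F k s)))%E).
  apply: ge0_le_integral => //.
  - by move=> s _; exact: iint_ge0.
  - exact: iint_measurable.
  - by apply: measurable_limn_einf => k; exact: iint_measurable.
  - move=> s _; apply: le_trans (iint_fatou s mu mF F0).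
    apply: (@le_iint _ _ _ s _ _ _ (fun s v => limn_einf (fun k => F k s v))) => //.
    + exact: pmeas_limn_einf.
    + by move=> ? ?; exact: limn_einf_ge0.
apply: fatou => // k; first exact: iint_measurable.
by move=> s _; exact: iint_ge0.
Qed.

End Substitution.

(** * The mass of a cone and of the orthant around it *)

Section Cone.
Variables (R : realType) (d : nat) (A : 'M[R]_d).
Hypothesis uA : A \in unitmx.
Hypothesis invA_gt0 : forall l i, 0 < invmx A l i.
Local Notation mR := (measurableTypeR R).
Local Notation leb := (@lebesgue_measure R).
Local Notation lebs := (fun _ => leb).

(** The coefficients of the linear form [u -> sum_l (A^-1 u)_l], hence the rates of the exponentials
    after the substitution [u = A v]. *)
Definition colsum (i : 'I_d) : R := \sum_l invmx A l i.

Lemma colsum_gt0 i : 0 < colsum i.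
Proof. by rewrite /colsum (bigD1 i)//= ltr_pwDl// sumr_ge0// => l _; rewrite ltW. Qed.

Lemma natr_forallb (I : finType) (b : I -> bool) :
  ([forall i, b i])%:R = \prod_i (b i)%:R :> R.
Proof.
case: (boolP [forall i, b i]) => [/forallP H|].
  by rewrite big1// => i _; rewrite H.
rewrite negb_forall => /existsP[i bi].
by rewrite (bigD1 i)//= (negbTE bi) mul0r.
Qed.

Lemma act_invmxl v : act (invmx A) (act A v) = v.
Proof. by rewrite -act_mul mulVmx// act1. Qed.

Lemma act_invmxr v : act A (act (invmx A) v) = v.
Proof. by rewrite -act_mul mulmxV// act1. Qed.

Lemma sum_act_invmx u : \sum_l act (invmx A) u l = \sum_i colsum i * u i.
Proof.
rewrite /act exchange_big /=; apply: eq_bigr => i _.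
by rewrite /colsum mulr_suml.
Qed.

(** In the coordinates [u = A v] the cone is a product of rays and the density a product of
    exponentials. The comparison [cmp] is abstract so as to cover the open and the closed cone. *)
Lemma cone_integral (cmp : R -> mR -> bool) (c : 'I_d -> R) :
  (forall x, measurable_fun setT (cmp x)) ->
  (forall a x, 0 < a ->
    (\int[leb]_t ((cmp x t)%:R * expR (- a * t))%:E = (expR (- a * x) / a)%:E)%E) ->
  (iint lebs (fun v => (\prod_l expR (- v l) * ([forall i, cmp (c i) (act A v i)])%:R)%:E) =
   (`|\det A|^-1 * \prod_i (expR (- colsum i * c i) / colsum i))%:E)%E.
Proof.
move=> mcmp Hcmp.
pose f i (t : mR) : \bar R := ((cmp (c i) t)%:R * expR (- colsum i * t))%:E.
have mf i : measurable_fun setT (f i).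
  apply/measurable_EFinP; apply: measurable_funM; first exact: measurable_natb.
  by apply: measurableT_comp => //; apply: measurable_funM.
have f0 i t : (0 <= f i t)%E by rewrite lee_fin mulr_ge0 ?expR_ge0.
transitivity (iint lebs (fun v => (fun u => \prod_i f i (u i))%E (act A v))).
  apply: eq_iint => v; rewrite /f prodEFin; congr EFin.
  rewrite big_split /= -natr_forallb mulrC; congr (_ * _).
  rewrite -!expR_sum; congr expR.
  rewrite sumrN -[in LHS](act_invmxl v) sum_act_invmx -sumrN.
  by apply: eq_bigr => i _; rewrite mulNr.
rewrite (linear_change_unit uA (F := fun u => \prod_i f i (u i))%E).
- rewrite iint_prod// EFinM; congr (_ * _)%E.
  rewrite -prodEFin; apply: eq_bigr => i _.
  by rewrite Hcmp// colsum_gt0.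
- move=> d' S' h v mh mv; apply: emeasurable_prod => i _.
  exact: measurableT_comp (mf i) (mv i).
- by move=> v; exact: prode_ge0.
Qed.

Lemma cone_integral_lt (c : 'I_d -> R) :
  (iint lebs (fun v => (\prod_l expR (- v l) * ([forall i, c i < act A v i])%:R)%:E) =
   (`|\det A|^-1 * \prod_i (expR (- colsum i * c i) / colsum i))%:E)%E.
Proof.
apply: (cone_integral (cmp := fun x t => x < t)).
  by move=> x; apply: measurable_fun_ltr.
move=> a x a0; rewrite (integral_open_ray _ (f := fun t => expR (- a * t))).
  exact: integral_ray_expR.
by apply: measurableT_comp => //; apply: measurable_funM.
Qed.

Lemma cone_integral_le (c : 'I_d -> R) :
  (iint lebs (fun v => (\prod_l expR (- v l) * ([forall i, c i <= act A v i])%:R)%:E) =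
   (`|\det A|^-1 * \prod_i (expR (- colsum i * c i) / colsum i))%:E)%E.
Proof.
apply: (cone_integral (cmp := fun x t => x <= t)).
  by move=> x; apply: measurable_fun_ler.
by move=> a x a0; exact: integral_ray_expR.
Qed.

Lemma orthant_integral (b : 'I_d -> R) :
  (iint lebs (fun v => (\prod_l expR (- v l) * ([forall l, b l < v l])%:R)%:E) =
   (\prod_l expR (- b l))%:E)%E.
Proof.
pose f l (t : mR) : \bar R := ((b l < t)%R%:R * expR (- 1 * t))%:E.
have mf i : measurable_fun setT (f i).
  apply/measurable_EFinP; apply: measurable_funM.
    by apply: measurable_natb; apply: measurable_fun_ltr.
  by apply: measurableT_comp => //; apply: measurable_funM.
transitivity (iint lebs (fun v => \prod_i f i (v i))%E).
  apply: eq_iint => v; rewrite /f prodEFin; congr EFin.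
  rewrite big_split /= -natr_forallb mulrC; congr (_ * _).
  by apply: eq_bigr => l _; rewrite mulN1r.
rewrite iint_prod//; last by move=> l t; rewrite lee_fin mulr_ge0 ?expR_ge0.
rewrite -prodEFin; apply: eq_bigr => l _.
rewrite (integral_open_ray _ (f := fun t => expR (- 1 * t))).
  by rewrite integral_ray_expR// divr1 mulN1r.
by apply: measurableT_comp => //; apply: measurable_funM.
Qed.

(* [A v > c] forces [v > A^-1 c] since the entries of [A^-1] are positive. *)
Lemma cone_sub_orthant (c v : 'I_d -> R) :
  [forall i, c i < act A v i] -> [forall l, act (invmx A) c l < v l].
Proof.
move=> /forallP H; apply/forallP => l; rewrite -[X in _ < X l](act_invmxl v).
rewrite -subr_gt0 /act -sumrB (bigD1 l)//= ltr_pwDl//.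
  by rewrite -mulrBr mulr_gt0// subr_gt0; exact: H.
by apply: sumr_ge0 => i _; rewrite -mulrBr mulr_ge0 ?(ltW (invA_gt0 _ _))// subr_ge0 ltW//; exact: H.
Qed.

End Cone.

(** * The limit of the normalised probability *)

Section TailLimit.
Variables (R : realType) (disp : measure_display) (T : measurableType disp).
Variables (P : probability T R) (n : nat) (L : 'I_n -> {RV P >-> R}) (m : R).
Hypothesis indL : independent_RVs L.
Hypothesis L_ge : forall j w, - m <= L j w.
Hypothesis tail_gt0 : forall j w, 0 < tail (L j) w.
Hypothesis tail_rv : forall j h,
  tail (L j) (w + h) / tail (L j) w @[w --> +oo] --> expR (- h).
Variables (d : nat) (alpha : 'M[R]_(d, n)) (kappa : 'I_n -> R).
Hypothesis sol : lp_solution alpha kappa.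
Hypothesis uniq : forall kappa', lp_solution alpha kappa' -> kappa' = kappa.
Let J := pos_support kappa.
Hypothesis cardJ : #|J| = d.
Let A := cols_of alpha cardJ.
Let B := invmx A.
Hypothesis invA_gt0 : forall l i, 0 < B l i.
Local Notation mR := (measurableTypeR R).
Local Notation leb := (@lebesgue_measure R).
Local Notation lebs := (fun _ => leb).
Local Notation e := (supp_idx cardJ).

Let uA : A \in unitmx. Proof. exact: cols_unit. Qed.

(** At the values [g k = L k w] this is the random vector [Z]. *)
Definition off_supp (g : 'I_n -> R) (i : 'I_d) : R := \sum_(k | k \notin J) alpha i k * g k.

Lemma sum_upds (g : 'I_n -> R) v i :
  \sum_j alpha i j * upds g e v j = act A v i + off_supp g i.
Proof.
rewrite (sum_split cardJ); congr (_ + _).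
  by apply: eq_bigr => l _; rewrite (upds_in _ _ _ (@supp_idx_inj _ _ _ _ cardJ)) mxE.
apply: eq_bigr => k kJ; rewrite upds_notin// => l; apply: contraNneq kJ => <-.
exact: supp_idx_in.
Qed.

(** All constraints are tight, so centring each [L_j] at [kappa_j N] cancels the threshold [N]. *)
Lemma act_kappa i : act A (fun l => kappa (e l)) i = 1.
Proof.
have -> : (fun l => kappa (e l)) = act B (fun _ => 1).
  apply/funext => l; rewrite (kappa_supp sol uniq)// /act.
  by apply: eq_bigr => j _; rewrite mulr1.
by rewrite (act_invmxr uA).
Qed.

Variable c : 'I_d -> R.

Section Level.
Variable N : R.

Let p l := tail (L (e l)) (kappa (e l) * N).

(** The displacement [L_j - kappa_j N], as a function of the exponential variable translated by
    [ln (p l)]. *)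
Definition shifted_quantile l (t : R) : R :=
  quantile (L (e l)) (t - ln (p l)) - kappa (e l) * N.

Definition weight l (t : R) : R := (ln (p l) <= t)%R%:R * expR (- t).

Let p_gt0 l : 0 < p l. Proof. exact: tail_gt0. Qed.

Lemma weight_ge0 l t : 0 <= weight l t.
Proof. by rewrite mulr_ge0 ?expR_ge0. Qed.

Lemma measurable_weight l : measurable_fun setT (weight l : mR -> R).
Proof.
have /measurable_EFinP := @measurable_ray_expR R 1 (ln (p l)).
by under eq_fun do rewrite mulN1r.
Qed.

Lemma measurable_shifted_quantile l : measurable_fun setT (shifted_quantile l : mR -> mR).
Proof.
apply: measurable_funB => //.
apply: (measurableT_comp (measurable_quantile (tail_gt0 (e l)))).
exact: measurable_funB.
Qed.

Definition in_cone (z v : 'I_d -> R) : bool := [forall i, c i < act A v i + z i].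

(** The apex of the cone [A v > c - z], which is also the corner of the orthant around it. *)
Definition vertex (z : 'I_d -> R) : 'I_d -> R := act B (fun i => c i - z i).

Definition in_orthant (z v : 'I_d -> R) : bool := [forall l, vertex z l < v l].

Lemma in_cone_orthant z v : in_cone z v -> in_orthant z v.
Proof.
move=> H; apply: (cone_sub_orthant uA invA_gt0).
by apply/forallP => i; rewrite ltrBlDr; move/forallP: H.
Qed.

(* After the change of variables, [cone_density] is the integrand of the
   normalised probability; [orthant_density] dominates it and factorises, and
   [gap_density] is their difference. *)
Definition cone_density z v : R :=
  \prod_l weight l (v l) * (in_cone z (fun l => shifted_quantile l (v l)))%:R.

Definition orthant_density z v : R :=
  \prod_l weight l (v l) * (in_orthant z (fun l => shifted_quantile l (v l)))%:R.

Definition gap_density z v : R :=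
  \prod_l weight l (v l) *
   (in_orthant z (fun l => shifted_quantile l (v l)) &&
    ~~ in_cone z (fun l => shifted_quantile l (v l)))%:R.

Lemma cone_density_ge0 z v : 0 <= cone_density z v.
Proof. by rewrite mulr_ge0// prodr_ge0// => l _; exact: weight_ge0. Qed.

Lemma gap_density_ge0 z v : 0 <= gap_density z v.
Proof. by rewrite mulr_ge0// prodr_ge0// => l _; exact: weight_ge0. Qed.

Lemma cone_gap_density z v : cone_density z v + gap_density z v = orthant_density z v.
Proof.
rewrite -mulrDr; congr (_ * _).
case: (boolP (in_cone _ _)) => [/in_cone_orthant ->|_] /=; first by rewrite addr0.
by rewrite andbT add0r.
Qed.

Lemma measurable_act dS (S : measurableType dS) m1 n1 (M : 'M[R]_(m1, n1)) (v : 'I_n1 -> S -> R) i :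
  (forall i, measurable_fun setT (v i)) ->
  measurable_fun setT (fun s => act M (v^~ s) i).
Proof. by move=> mv; apply: measurable_sum => j; apply: measurable_funM. Qed.

Lemma measurable_in_cone dS (S : measurableType dS) (z v : 'I_d -> S -> R) :
  (forall i, measurable_fun setT (z i)) -> (forall i, measurable_fun setT (v i)) ->
  measurable_fun setT (fun s => in_cone (z^~ s) (v^~ s)).
Proof.
move=> mz mv; apply: measurable_forallb => i; apply: measurable_fun_ltr => //.
by apply: measurable_funD => //; exact: measurable_act.
Qed.

Lemma measurable_in_orthant dS (S : measurableType dS) (z v : 'I_d -> S -> R) :
  (forall i, measurable_fun setT (z i)) -> (forall i, measurable_fun setT (v i)) ->
  measurable_fun setT (fun s => in_orthant (z^~ s) (v^~ s)).
Proof.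
move=> mz mv; apply: measurable_forallb => i; apply: measurable_fun_ltr => //.
by apply: measurable_act => j; apply: measurable_funB.
Qed.

Lemma measurable_off_supp i : measurable_fun setT (fun w => off_supp (fun k => L k w) i).
Proof.
have -> : (fun w => off_supp (fun k => L k w) i) =
    (fun w => \sum_k if k \notin J then alpha i k * L k w else 0).
  by apply/funext => w; rewrite /off_supp big_mkcond.
apply: measurable_sum => k; case: (k \notin J); last exact: measurable_cst.
exact: measurable_funM.
Qed.

Lemma measurable_weights dS (S : measurableType dS) (v : 'I_d -> S -> mR) :
  (forall i, measurable_fun setT (v i)) ->
  measurable_fun setT (fun s => \prod_l weight l (v l s)).
Proof.
move=> mv; apply: measurable_prod => l _.
exact: (measurableT_comp (measurable_weight l) (mv l)).
Qed.

Lemma pmeas_cone_density :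
  pmeas (fun (w : T) v => (cone_density (off_supp (fun k => L k w)) v)%:E).
Proof.
move=> d' S' h v mh mv; apply/measurable_EFinP; apply: measurable_funM.
  exact: measurable_weights.
apply: measurable_natb; apply: (measurable_in_cone
    (z := fun i s => off_supp (fun k => L k (h s)) i)
    (v := fun l s => shifted_quantile l (v l s))) => i.
  exact: (measurableT_comp (measurable_off_supp i) mh).
exact: (measurableT_comp (measurable_shifted_quantile i) (mv i)).
Qed.

Lemma pmeas_gap_density :
  pmeas (fun (w : T) v => (gap_density (off_supp (fun k => L k w)) v)%:E).
Proof.
move=> d' S' h v mh mv; apply/measurable_EFinP; apply: measurable_funM.
  exact: measurable_weights.
have mz i : measurable_fun setT (fun s => off_supp (fun k => L k (h s)) i).
  exact: (measurableT_comp (measurable_off_supp i) mh).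
have mt i : measurable_fun setT ((fun s => shifted_quantile i (v i s)) : S' -> R).
  exact: (measurableT_comp (measurable_shifted_quantile i) (mv i)).
apply: measurable_natb; apply: measurable_and.
  exact: (measurable_in_orthant (z := fun i s => off_supp (fun k => L k (h s)) i)
    (v := fun l s => shifted_quantile l (v l s))).
apply: measurable_neg.
exact: (measurable_in_cone (z := fun i s => off_supp (fun k => L k (h s)) i)
    (v := fun l s => shifted_quantile l (v l s))).
Qed.

(** [integral_law_shift] for the indicator of a ray, read backwards. *)
Lemma integral_weight_ray l b :
  (\int[leb]_t (weight l t * (b < shifted_quantile l t)%R%:R)%:E =
   (tail (L (e l)) (kappa (e l) * N + b) / p l)%:E)%E.
Proof.
pose f (x : mR) : \bar R := ((kappa (e l) * N + b < x)%R%:R)%:E.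
have mf : measurable_fun setT f.
  by apply/measurable_EFinP; apply: measurable_natb; apply: measurable_fun_ltr.
have f0 x : (0 <= f x)%E by rewrite lee_fin.
have := @integral_law_shift _ _ _ _ (L (e l)) (tail_gt0 (e l)) (kappa (e l) * N) f mf f0.
rewrite /law_of ge0_integral_distribution//=.
have -> : (\int[P]_w f (L (e l) w) = (tail (L (e l)) (kappa (e l) * N + b))%:E)%E.
  rewrite tailE -[X in P X]setIT -integral_indic//; last exact: measurable_funPTI.
  apply: eq_integral => w _; rewrite /f indicE; congr (nat_of_bool _)%:R%:E.
  by apply/idP/idP; rewrite inE /= in_itv /= andbT.
move=> H; rewrite EFinM H muleAC -EFinM divff ?gt_eqF// mul1e.
apply: eq_integral => t _; rewrite /f -EFinM mulrC; congr ((nat_of_bool _)%:R * _)%:E.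
by rewrite /shifted_quantile ltrBrDl.
Qed.

(** This is what the orthant is for: its indicator factorises, and its mass consists of tail ratios,
    to which Potter's bounds apply. *)
Lemma iint_orthant_density z :
  (iint lebs (fun v => (orthant_density z v)%:E) =
   (\prod_l (tail (L (e l)) (kappa (e l) * N + vertex z l) / p l))%:E)%E.
Proof.
pose f l (t : mR) : \bar R := (weight l t * (vertex z l < shifted_quantile l t)%R%:R)%:E.
have mf l : measurable_fun setT (f l).
  apply/measurable_EFinP; apply: measurable_funM; first exact: measurable_weight.
  apply: measurable_natb; apply: measurable_fun_ltr => //.
  exact: measurable_shifted_quantile.
transitivity (iint lebs (fun v => \prod_l f l (v l))%E).
  apply: eq_iint => v; rewrite /f prodEFin big_split /=; congr (_ * _)%:E.
  exact: natr_forallb.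
rewrite iint_prod//; last by move=> l t; rewrite lee_fin mulr_ge0// weight_ge0.
by rewrite -prodEFin; apply: eq_bigr => l _; exact: integral_weight_ray.
Qed.

(** The variables with index in [J] are integrated out by independence and written through their
    quantile functions; [act_kappa] then removes [N] from the inequalities. *)
Lemma prob_exceed_iint :
  (P (exceed L alpha c N) = (\prod_l p l)%:E *
   \int[P]_w iint lebs (fun v => (cone_density (off_supp (fun k => L k w)) v)%:E))%E.
Proof.
pose F (g : 'I_n -> R) : \bar R := ([forall i, c i + N < \sum_j alpha i j * g j]%:R)%:E.
have mF : pmeas (fun _ : unit => F).
  move=> d' S' h g mh mg; apply/measurable_EFinP; apply: measurable_natb.
  apply: measurable_forallb => i; apply: measurable_fun_ltr => //.
  by apply: measurable_sum => j; apply: measurable_funM => //; exact: mg.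
have F0 g : (0 <= F g)%E by rewrite lee_fin.
have -> : (P (exceed L alpha c N) = \int[P]_w F (fun j => L j w))%E.
  rewrite -[X in P X]setIT -integral_indic//; last exact: measurable_exceed.
  apply: eq_integral => w _; rewrite /F indicE; congr (nat_of_bool _)%:R%:E.
  by apply/idP/forallP; rewrite inE.
rewrite (integral_indep indL e mF F0).
rewrite -ge0_integralZl//; last 3 first.
- exact: (iint_measurable _ pmeas_cone_density (fun w v => cone_density_ge0 _ _)).
- by move=> w _; apply: iint_ge0 => v; rewrite lee_fin cone_density_ge0.
- by rewrite lee_fin prodr_ge0// => l _; rewrite ltW.
apply: eq_integral => w _.
pose G (g v : 'I_d -> R) : \bar R := ([forall i, c i + N < act A v i + g i]%:R)%:E.
have mG : pmeas (fun (w : T) v => G (off_supp (fun k => L k w)) v).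
  move=> d' S' h v mh mv; apply/measurable_EFinP; apply: measurable_natb.
  apply: measurable_forallb => i; apply: measurable_fun_ltr => //.
  apply: measurable_funD.
    by apply: measurable_act => j; exact: mv.
  exact: (measurableT_comp (measurable_off_supp i) mh).
transitivity (iint (fun l => law L (e l)) (G (off_supp (fun k => L k w)))).
  apply: eq_iint => v; rewrite /F /G; congr (nat_of_bool _)%:R%:E.
  by apply: eq_forallb => i; rewrite sum_upds.
rewrite (@iint_subst R _ T w d _ lebs (fun l t => quantile (L (e l)) (t - ln (p l)))
  (fun l t => (p l * weight l t)%:E) (fun w v => G (off_supp (fun k => L k w)) v)) //.
- rewrite -(@iintZl _ _ T w _ _ (fun w v => (cone_density (off_supp (fun k => L k w)) v)%:E)) //.
  + apply: eq_iint => v; rewrite prodEFin big_split /= EFinM -muleA; congr (_ * _)%E.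
    rewrite /G -EFinM; congr (_ * (nat_of_bool _)%:R)%:E.
    apply: eq_forallb => i.
    have -> : act A (fun l => quantile (L (e l)) (v l - ln (p l))) i =
        act A (fun l => shifted_quantile l (v l)) i + N.
      rewrite -[X in _ + X]mul1r -[X in _ + X * _](act_kappa i) /act mulr_suml -big_split /=.
      by apply: eq_bigr => l _; rewrite /shifted_quantile -[X in _ = _ + X]mulrA -mulrDr subrK.
    by rewrite addrAC ltrD2r.
  + exact: pmeas_cone_density.
  + by move=> ? ?; rewrite lee_fin cone_density_ge0.
  + by rewrite lee_fin prodr_ge0// => l _; rewrite ltW.
- move=> l; apply: (measurableT_comp (measurable_quantile (tail_gt0 (e l)))).
  exact: measurable_funB.
- move=> l; apply/measurable_EFinP; apply: measurable_funM => //.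
  exact: measurable_weight.
- by move=> l t; rewrite lee_fin mulr_ge0 ?weight_ge0// ltW.
- move=> l f mf f0.
  have := @integral_law_shift _ _ _ _ (L (e l)) (tail_gt0 (e l)) (kappa (e l) * N) f mf f0.
  rewrite /law /law_of => ->.
  rewrite -ge0_integralZl//.
  + by apply: eq_integral => t _; rewrite muleCA muleC -EFinM.
  + apply: emeasurable_funM; last by apply/measurable_EFinP; exact: measurable_weight.
    apply: (measurableT_comp mf).
    apply: (measurableT_comp (measurable_quantile (tail_gt0 (e l)))).
    exact: measurable_funB.
  + by move=> t _; rewrite mule_ge0// lee_fin weight_ge0.
  + by rewrite lee_fin tail_ge0.
- by move=> ? ?; rewrite lee_fin.
Qed.

End Level.

(** * Pointwise limits along a sequence of levels *)

Section Sequence.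
Variable N : nat -> R.
Hypothesis N_cvg : N @ \oo --> +oo.

Let kN_cvg l : kappa (e l) * N k @[k --> \oo] --> +oo.
Proof. exact: (cvg_comp _ _ N_cvg (gt0_cvgMry (supp_idx_gt0 cardJ l) cvg_id)). Qed.

Lemma near_weight l t : \forall k \near \oo, weight (N k) l t = expR (- t).
Proof.
have H := @near_ln_tail_lt _ _ _ _ (L (e l)) (tail_gt0 (e l)) t.
have H' : \forall k \near \oo, ln (tail (L (e l)) (kappa (e l) * N k)) < t := @kN_cvg l _ H.
near=> k; rewrite /weight ltW ?mul1r//; near: k; exact: H'.
Unshelve. all: by end_near.
Qed.

Lemma shifted_quantile_cvg l t : shifted_quantile (N k) l t @[k --> \oo] --> t.
Proof.
have H := @quantile_shift_cvg _ _ _ _ (L (e l)) (tail_gt0 (e l)) (@tail_rv (e l)) t.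
exact: (cvg_comp _ _ (@kN_cvg l) H).
Qed.

Lemma act_shifted_quantile_cvg v i :
  act A (fun l => shifted_quantile (N k) l (v l)) i @[k --> \oo] --> act A v i.
Proof.
apply: cvg_big => [|l _]; first exact: add_continuous.
by apply: cvgMr; exact: shifted_quantile_cvg.
Qed.

(** Where [b] is false nonnegativity suffices, so convergence only has to be checked where the
    limiting indicator is 1. *)
Lemma limn_einf_indicator (u : nat -> \bar R) (b : bool) (x : R) :
  (forall k, 0 <= u k)%E -> (b -> \forall k \near \oo, u k = x%:E) ->
  ((x * b%:R)%:E <= limn_einf u)%E.
Proof.
case: b => u0 H; last by rewrite mulr0 limn_einf_ge0.
have ux : u k @[k --> \oo] --> x%:E by apply: cvg_near_cst; exact: H.
by rewrite mulr1 (cvg_limn_einf_sup ux).1.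
Qed.

(** The cone is open: strict inequalities at [v] carry over to the shifted quantiles, which converge
    to [v]. *)
Lemma le_limn_einf_cone z v :
  ((\prod_l expR (- v l) * (in_cone z v)%:R)%:E <=
   limn_einf (fun k => (cone_density (N k) z v)%:E))%E.
Proof.
apply: limn_einf_indicator => [k|/forallP vc]; first by rewrite lee_fin cone_density_ge0.
have H1 : \forall k \near \oo, forall l, weight (N k) l (v l) = expR (- v l).
  by apply: filter_forall => l; exact: near_weight.
have H2 : \forall k \near \oo, forall i, c i - z i < act A (fun l => shifted_quantile (N k) l (v l)) i.
  apply: filter_forall => i; apply: (cvgr_gt _ (@act_shifted_quantile_cvg v i)).
  by rewrite ltrBlDr.
near=> k; congr EFin; rewrite /cone_density.
have -> : in_cone z (fun l => shifted_quantile (N k) l (v l)).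
  apply/forallP => i; rewrite -ltrBlDr; move: i; near: k; exact: H2.
rewrite mulr1; apply: eq_bigr => l _; move: l; near: k; exact: H1.
Unshelve. all: by end_near.
Qed.

(** The complement of the cone is taken with a strict inequality, without the boundary, so that its
    condition is open as well. *)
Lemma le_limn_einf_gap z v :
  ((\prod_l expR (- v l) *
     (in_orthant z v && [exists i, act A v i + z i < c i])%:R)%:E <=
   limn_einf (fun k => (gap_density (N k) z v)%:E))%E.
Proof.
apply: limn_einf_indicator => [k|/andP[/forallP vb /existsP[i vc]]].
  by rewrite lee_fin gap_density_ge0.
have H1 : \forall k \near \oo, forall l, weight (N k) l (v l) = expR (- v l).
  by apply: filter_forall => l; exact: near_weight.
have H2 : \forall k \near \oo, act A (fun l => shifted_quantile (N k) l (v l)) i < c i - z i.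
  apply: (cvgr_lt _ (@act_shifted_quantile_cvg v i)).
  by rewrite ltrBrDr.
have H3 : \forall k \near \oo, forall l, vertex z l < shifted_quantile (N k) l (v l).
  by apply: filter_forall => l; exact: (cvgr_gt _ (@shifted_quantile_cvg l (v l))).
near=> k; congr EFin; rewrite /gap_density.
have -> : in_orthant z (fun l => shifted_quantile (N k) l (v l)).
  by apply/forallP; near: k; exact: H3.
have -> : in_cone z (fun l => shifted_quantile (N k) l (v l)) = false.
  apply/negbTE; rewrite negb_forall; apply/existsP; exists i.
  by rewrite -leNgt -lerBrDr ltW//; near: k; exact: H2.
rewrite mulr1; apply: eq_bigr => l _; move: l; near: k; exact: H1.
Unshelve. all: by end_near.
Qed.

End Sequence.

(** The entries of [A^-1] times column [k] of [alpha]: up to sign, the coefficient of [g k] in the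
    vertex. *)
Definition off_coef l k : R := \sum_i B l i * alpha i k.

Lemma vertex_off_supp g l :
  vertex (off_supp g) l = act B c l - \sum_(k | k \notin J) off_coef l k * g k.
Proof.
rewrite /vertex /act; under eq_bigr do rewrite mulrBr.
rewrite sumrB; congr (_ - _).
under eq_bigr do rewrite /off_supp mulr_sumr.
rewrite exchange_big /=; apply: eq_bigr => k _.
by rewrite /off_coef mulr_suml; apply: eq_bigr => i _; rewrite mulrA.
Qed.

Lemma sum_off_coef k : \sum_l off_coef l k = moment_exponent alpha A k.
Proof. by []. Qed.

(** Finitely many strict inequalities leave a common margin. *)
Lemma exists_small_eta : exists eta : R, 0 < eta < 1 /\
  forall k, k \notin J -> moment_exponent alpha A k + eta * \sum_l `|off_coef l k| < 1.
Proof.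
pose r k := (\sum_l `|off_coef l k| + 1) / (1 - moment_exponent alpha A k).
have lt1 k : k \notin J -> 0 < 1 - moment_exponent alpha A k.
  by move=> kJ; rewrite subr_gt0; exact: moment_exponent_lt1.
have S0 k : 0 <= \sum_l `|off_coef l k| by rewrite sumr_ge0.
have r0 k : k \notin J -> 0 <= r k.
  by move=> /lt1/ltW h; apply: divr_ge0 => //; exact: addr_ge0.
(* The summand 2 gives [eta < 1]; [r k <= s] gives the inequality at [k], strict because of the
   [+ 1] in [r k]. *)
pose s := 2 + \sum_(k | k \notin J) r k.
have s2 : 2 <= s by rewrite lerDl sumr_ge0.
have s0 : 0 < s by lra.
exists s^-1; split; first by rewrite invr_gt0 s0 invf_lt1//=; lra.
move=> k kJ; rewrite -ltrBrDl mulrC ltr_pdivrMr; last lra.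
have : r k <= s.
  rewrite /s (bigD1 k)//= addrCA lerDl addr_ge0// sumr_ge0// => j /andP[jJ _].
  exact: r0.
rewrite /r ler_pdivrMr ?lt1// mulrC => h; lra.
Qed.

(** The vertex is affine in the [L k] with [k] outside [J], so the product of the Potter bounds is
    at most a constant times a product of functions of the single [L k]. Independence separates
    these factors, and each is an exponential moment of order below 1. *)
Lemma dominating_lty (C : 'I_d -> R) (eta : R) : 0 < eta -> (forall l, 0 < C l) ->
  (forall k, k \notin J -> moment_exponent alpha A k + eta * \sum_l `|off_coef l k| < 1) ->
  (\int[P]_w (\prod_l (C l * expR (eta * `|vertex (off_supp (fun k => L k w)) l|
                                    - vertex (off_supp (fun k => L k w)) l)))%:E < +oo)%E.
Proof.
move=> eta0 C0 He.
pose th k := eta * \sum_l `|off_coef l k|.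
have th0 k : 0 <= th k by rewrite mulr_ge0 ?(ltW eta0)// sumr_ge0.
pose f k (x : mR) : \bar R :=
  if k \notin J then (expR (moment_exponent alpha A k * x + th k * `|x|))%:E else 1%E.
have mf k : measurable_fun setT (f k).
  rewrite /f; case: (k \notin J); last exact: measurable_cst.
  apply/measurable_EFinP; apply: measurableT_comp => //.
  apply: measurable_funD; first exact: measurable_funM.
  by apply: measurable_funM => //; exact: measurableT_comp.
have f0 k x : (0 <= f k x)%E by rewrite /f; case: ifP; rewrite ?lee_fin ?expR_ge0.
pose K0 := (\prod_l C l) * expR (\sum_l (eta * `|act B c l| - act B c l)).
have K00 : 0 <= K0 by rewrite mulr_ge0 ?expR_ge0// prodr_ge0// => l _; rewrite ltW.
apply: (@le_lt_trans _ _ (\int[P]_w (K0%:E * \prod_k f k (L k w)))%E).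
  apply: ge0_le_integral => //.
  - by move=> w _; rewrite lee_fin prodr_ge0// => l _; rewrite mulr_ge0 ?expR_ge0// ltW.
  - apply/measurable_EFinP; apply: measurable_prod => l _; apply: measurable_funM => //.
    have mv : measurable_fun setT (fun w => vertex (off_supp (fun k => L k w)) l).
      by apply: measurable_act => j; apply: measurable_funB => //; exact: measurable_off_supp.
    apply: measurableT_comp => //; apply: measurable_funB => //.
    by apply: measurable_funM => //; exact: measurableT_comp.
  - apply: measurable_funeM; apply: emeasurable_prod => k _.
    exact: (measurableT_comp (mf k) (measurable_funPT (borelRV (L k)))).
  - move=> w _; set z := off_supp _.
    have -> : (\prod_k f k (L k w))%E =
        (expR (\sum_(k | k \notin J) (moment_exponent alpha A k * L k w + th k * `|L k w|)))%:E.
      rewrite expR_sum -prodEFin [RHS]big_mkcond /=; apply: eq_bigr => k _.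
      by rewrite /f; case: ifP.
    rewrite -EFinM lee_fin big_split /= -expR_sum /K0 -mulrA ler_wpM2l//.
      by rewrite prodr_ge0// => l _; rewrite ltW.
    rewrite -expRD ler_expR.
    have -> : \sum_(k | k \notin J) (moment_exponent alpha A k * L k w + th k * `|L k w|) =
       \sum_l \sum_(k | k \notin J) (off_coef l k * L k w + eta * (`|off_coef l k| * `|L k w|)).
      rewrite exchange_big /=; apply: eq_bigr => k _.
      rewrite big_split /= -mulr_suml -mulr_sumr -mulr_suml sum_off_coef mulrA.
      by [].
    rewrite -big_split /=; apply: ler_sum => l _.
    rewrite big_split /= -mulr_sumr vertex_off_supp.
    set b := act B c l; set g := \sum_(k | _) _ * _; set a := \sum_(k | _) _ * _.
    have ga : `|g| <= a.
      by rewrite (le_trans (ler_norm_sum _ _ _))// ler_sum// => k _; rewrite normrM.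
    have := ler_normB b g.
    nra.
rewrite ge0_integralZl//; last 2 first.
- apply: emeasurable_prod => k _.
  exact: (measurableT_comp (mf k) (measurable_funPT (borelRV (L k)))).
- by move=> w _; exact: prode_ge0.
rewrite expectation_prod// lte_mul_pinfty ?lee_fin//.
rewrite ltey_eq; apply/orP; left; apply: prode_fin_num => k _.
rewrite ge0_fin_numE ?integral_ge0// /f.
have [kJ|kJ] := boolP (k \notin J).
  apply: (@exp_moment_lty _ _ _ _ (L k) (@tail_gt0 k) (@tail_rv k) _ _ m) => //.
    exact: He.
  by apply: aeW => w; exact: L_ge.
by rewrite integral_cst// mul1e; apply: (@le_lt_trans _ _ 1%E); rewrite ?ltry// probability_le1.
Qed.

Definition cone_mass (z : 'I_d -> R) : R :=
  `|\det A|^-1 * \prod_i (expR (- colsum A i * (c i - z i)) / colsum A i).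

Definition cone_limit z v : R := \prod_l expR (- v l) * (in_cone z v)%:R.

Definition gap_limit z v : R :=
  \prod_l expR (- v l) * (in_orthant z v && [exists i, act A v i + z i < c i])%:R.

Lemma cone_limit_ge0 z v : 0 <= cone_limit z v.
Proof. by rewrite mulr_ge0// prodr_ge0// => l _; exact: expR_ge0. Qed.

Lemma gap_limit_ge0 z v : 0 <= gap_limit z v.
Proof. by rewrite mulr_ge0// prodr_ge0// => l _; exact: expR_ge0. Qed.

Lemma iint_cone_limit z :
  (iint lebs (fun v => (cone_limit z v)%:E) = (cone_mass z)%:E)%E.
Proof.
rewrite -(cone_integral_lt uA invA_gt0 (fun i => c i - z i)).
apply: eq_iint => v; congr (_ * (nat_of_bool _)%:R)%:E.
by apply: eq_forallb => i; rewrite ltrBlDr.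
Qed.

Lemma measurable_prod_expR dS (S : measurableType dS) (v : 'I_d -> S -> R) :
  (forall i, measurable_fun setT (v i)) ->
  measurable_fun setT (fun s => \prod_l expR (- v l s)).
Proof.
move=> mv; apply: measurable_prod => l _; apply: measurableT_comp => //.
exact: measurableT_comp.
Qed.

Lemma measurable_off_supp_comp dS (S : measurableType dS) (h : S -> T) i :
  measurable_fun setT h -> measurable_fun setT (fun s => off_supp (fun k => L k (h s)) i).
Proof. by move=> mh; exact: (measurableT_comp (measurable_off_supp i) mh). Qed.

Lemma pmeas_cone_limit :
  pmeas (fun (w : T) v => (cone_limit (off_supp (fun k => L k w)) v)%:E).
Proof.
move=> d' S' h v mh mv; apply/measurable_EFinP; apply: measurable_funM.
  exact: measurable_prod_expR.
apply: measurable_natb; apply: (measurable_in_cone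
    (z := fun i s => off_supp (fun k => L k (h s)) i)) => // i.
exact: measurable_off_supp_comp.
Qed.

Lemma pmeas_gap_limit :
  pmeas (fun (w : T) v => (gap_limit (off_supp (fun k => L k w)) v)%:E).
Proof.
move=> d' S' h v mh mv; apply/measurable_EFinP; apply: measurable_funM.
  exact: measurable_prod_expR.
have mz i : measurable_fun setT (fun s => off_supp (fun k => L k (h s)) i).
  exact: measurable_off_supp_comp.
apply: measurable_natb; apply: measurable_and.
  exact: (measurable_in_orthant (z := fun i s => off_supp (fun k => L k (h s)) i)).
have -> : (fun s => [exists i, act A (v^~ s) i + off_supp (fun k => L k (h s)) i < c i]) =
    (fun s => ~~ [forall i, ~~ (act A (v^~ s) i + off_supp (fun k => L k (h s)) i < c i)]).
  by apply/funext => s; rewrite negb_forall; apply: eq_existsb => i; rewrite negbK.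
apply: measurable_neg; apply: measurable_forallb => i; apply: measurable_neg.
apply: measurable_fun_ltr => //; apply: measurable_funD => //.
by apply: measurable_act => j; exact: mv.
Qed.

(* The boundary of the cone does not matter: the closed and the open cone have
   the same mass. *)
Lemma orthant_le_cone_gap w (z := off_supp (fun k => L k w)) :
  ((\prod_l expR (- vertex z l))%:E <=
   (cone_mass z)%:E + iint lebs (fun v => (gap_limit z v)%:E))%E.
Proof.
pose weak (w : T) v : \bar R := (\prod_l expR (- v l) *
  ([forall i, c i - off_supp (fun k => L k w) i <= act A v i])%:R)%:E.
have mweak : pmeas weak.
  move=> d' S' h v mh mv; apply/measurable_EFinP; apply: measurable_funM.
    exact: measurable_prod_expR.
  apply: measurable_natb; apply: measurable_forallb => i; apply: measurable_fun_ler.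
    by apply: measurable_funB => //; exact: measurable_off_supp_comp.
  by apply: measurable_act => j; exact: mv.
have weak0 w' v : (0 <= weak w' v)%E.
  by rewrite lee_fin mulr_ge0// prodr_ge0// => l _; exact: expR_ge0.
have gap0 w' v : (0 <= (gap_limit (off_supp (fun k => L k w')) v)%:E)%E.
  by rewrite lee_fin gap_limit_ge0.
rewrite -orthant_integral -(cone_integral_le uA invA_gt0 (fun i => c i - z i)).
rewrite -[X in (_ <= X + _)%E]/(iint lebs (weak w)).
rewrite -(@iintD _ _ T w _ _ weak (fun w v => (gap_limit (off_supp (fun k => L k w)) v)%:E)) //;
  last exact: pmeas_gap_limit.
pose orth (w : T) v : \bar R := (\prod_l expR (- v l) *
  (in_orthant (off_supp (fun k => L k w)) v)%:R)%:E.
apply: (@le_iint _ _ T w _ _ orth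
  (fun w v => weak w v + (gap_limit (off_supp (fun k => L k w)) v)%:E)%E).
- move=> d' S' h v mh mv; apply/measurable_EFinP; apply: measurable_funM.
    exact: measurable_prod_expR.
  apply: measurable_natb; apply: (measurable_in_orthant
    (z := fun i s => off_supp (fun k => L k (h s)) i)) => // i.
  exact: measurable_off_supp_comp.
- move=> d' S' h v mh mv; apply: emeasurable_funD; first exact: mweak.
  exact: pmeas_gap_limit.
- by move=> w' v; rewrite lee_fin mulr_ge0// prodr_ge0// => l _; exact: expR_ge0.
- by move=> w' v; rewrite adde_ge0.
- move=> v; rewrite /orth /weak /gap_limit -EFinD lee_fin -mulrDr ler_wpM2l//.
    by rewrite prodr_ge0// => l _; exact: expR_ge0.
  case: (in_orthant _ _) => /=; rewrite -natrD ler_nat; last exact: leq0n.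
  case: (boolP [forall i, _]) => //.
  rewrite negb_forall => /existsP[i hi].
  suff -> : [exists i, act A v i + off_supp (fun k => L k w) i < c i] by [].
  by apply/existsP; exists i; rewrite -ltrBrDr ltNge.
Qed.

(** * Convergence of the masses of orthant and cone *)

Section Convergence.
Variables (N : nat -> R) (C w0 : 'I_d -> R) (eta : R).
Hypothesis N_cvg : N @ \oo --> +oo.
Hypothesis eta_gt0 : 0 < eta.
Hypothesis C_gt0 : forall l, 0 < C l.
Hypothesis potterC : forall l w h, w0 l <= w ->
  tail (L (e l)) (w + h) <= C l * tail (L (e l)) w * expR (eta * `|h| - h).
Hypothesis small_eta : forall k, k \notin J ->
  moment_exponent alpha A k + eta * \sum_l `|off_coef l k| < 1.
Hypothesis N_large : forall k l, w0 l <= kappa (e l) * N k.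

Let Z (w : T) : 'I_d -> R := off_supp (fun k => L k w).

Let mass k w : R :=
  \prod_l (tail (L (e l)) (kappa (e l) * N k + vertex (Z w) l) / tail (L (e l)) (kappa (e l) * N k)).

Let measurable_vertex l : measurable_fun setT (fun w => vertex (Z w) l).
Proof.
by apply: measurable_act => j; apply: measurable_funB => //; exact: measurable_off_supp.
Qed.

Let measurable_mass k : measurable_fun setT (mass k).
Proof.
apply: measurable_prod => l _; apply: measurable_funM => //.
have mt : measurable_fun setT (tail (L (e l))).
  by apply: measurableT_comp => //; exact: ccdf_measurable.
by apply: (measurableT_comp mt); apply: measurable_funD.
Qed.

(** Pointwise convergence is regular variation at the translation [vertex (Z w) l]; Potter's bound
    at the same translation dominates. *)
Lemma integral_mass_cvg :
  (fun k => \int[P]_w (mass k w)%:E)%E @ \oo -->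
    (\int[P]_w (\prod_l expR (- vertex (Z w) l))%:E)%E /\
  (\int[P]_w (\prod_l expR (- vertex (Z w) l))%:E \is a fin_num)%E.
Proof.
pose g w : \bar R := (\prod_l (C l * expR (eta * `|vertex (Z w) l| - vertex (Z w) l)))%:E.
have mlim : measurable_fun setT (fun w => (\prod_l expR (- vertex (Z w) l))%:E).
  by apply/measurable_EFinP; exact: measurable_prod_expR.
have g0 w : (0 <= g w)%E.
  by rewrite lee_fin prodr_ge0// => l _; rewrite mulr_ge0 ?expR_ge0// ltW.
have ig : P.-integrable setT g.
  apply/integrableP; split.
    apply/measurable_EFinP; apply: measurable_prod => l _; apply: measurable_funM => //.
    apply: measurableT_comp => //; apply: measurable_funB => //.
    by apply: measurable_funM => //; exact: measurableT_comp.
  under eq_integral do rewrite gee0_abs//.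
  exact: dominating_lty.
have [||ilim _ H] := @dominated_convergence _ _ _ P setT measurableT
  (fun k w => (mass k w)%:E) (fun w => (\prod_l expR (- vertex (Z w) l))%:E) g
  (fun k => (measurable_EFinP _ _).2 (measurable_mass k)) mlim _ ig _.
- apply: aeW => w _; apply: cvg_EFin; first exact: nearW.
  rewrite /= /mass; apply: cvg_big => [|l _].
    by move=> x; apply: cvgM; [exact: cvg_fst|exact: cvg_snd].
  have kN : kappa (e l) * N k @[k --> \oo] --> +oo.
    exact: (cvg_comp _ _ N_cvg (gt0_cvgMry (supp_idx_gt0 cardJ l) cvg_id)).
  exact: (cvg_comp _ _ kN (@tail_rv (e l) (vertex (Z w) l))).
- apply: aeW => w k _; rewrite gee0_abs; last first.
    by rewrite lee_fin prodr_ge0// => l _; rewrite divr_ge0// tail_ge0.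
  rewrite lee_fin ler_prod// => l _; rewrite divr_ge0 ?tail_ge0//=.
  by rewrite ler_pdivrMr// mulrAC; exact: potterC.
- by split => //; exact: integrable_fin_num.
Qed.

(** [cvg_liminf_split] for the masses of cone and gap: their sum is the orthant mass, whose limit is
    given by [integral_mass_cvg], and [orthant_le_cone_gap] shows that the limiting cone and gap
    exhaust it. *)
Lemma exceed_cvg_aux :
  (\int[P]_w (cone_mass (Z w))%:E \is a fin_num)%E /\
  fine (P (exceed L alpha c (N k))) / \prod_l tail (L (e l)) (kappa (e l) * N k)
    @[k --> \oo] --> fine (\int[P]_w (cone_mass (Z w))%:E)%E.
Proof.
have [mass_cvg mass_fin] := integral_mass_cvg.
pose a k := (\int[P]_w iint lebs (fun v => (cone_density (N k) (Z w) v)%:E))%E.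
pose b k := (\int[P]_w iint lebs (fun v => (gap_density (N k) (Z w) v)%:E))%E.
have cd0 k w v : (0 <= (cone_density (N k) (Z w) v)%:E)%E by rewrite lee_fin cone_density_ge0.
have gd0 k w v : (0 <= (gap_density (N k) (Z w) v)%:E)%E by rewrite lee_fin gap_density_ge0.
have cl0 w v : (0 <= (cone_limit (Z w) v)%:E)%E by rewrite lee_fin cone_limit_ge0.
have gl0 w v : (0 <= (gap_limit (Z w) v)%:E)%E by rewrite lee_fin gap_limit_ge0.
have mcd k := pmeas_cone_density (N k).
have mgd k := pmeas_gap_density (N k).
have a0 k : (0 <= a k)%E by apply: integral_ge0 => w _; exact: iint_ge0.
have b0 k : (0 <= b k)%E by apply: integral_ge0 => w _; exact: iint_ge0.
have abE k : (a k + b k = \int[P]_w (mass k w)%:E)%E.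
  rewrite -ge0_integralD//.
  - apply: eq_integral => w _.
    rewrite -(@iintD _ _ T w _ _ (fun w v => (cone_density (N k) (Z w) v)%:E)
      (fun w v => (gap_density (N k) (Z w) v)%:E)) //.
    rewrite /mass -iint_orthant_density; apply: eq_iint => v.
    by rewrite -EFinD cone_gap_density.
  - by move=> w _; exact: iint_ge0.
  - exact: (iint_measurable lebs (mcd k) (cd0 k)).
  - by move=> w _; exact: iint_ge0.
  - exact: (iint_measurable lebs (mgd k) (gd0 k)).
have VE : (\int[P]_w (cone_mass (Z w))%:E = \int[P]_w iint lebs (fun v => (cone_limit (Z w) v)%:E))%E.
  by apply: eq_integral => w _; rewrite iint_cone_limit.
have cm0 z : (0 <= (cone_mass z)%:E)%E.
  by rewrite -iint_cone_limit; apply: iint_ge0 => v; rewrite lee_fin cone_limit_ge0.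
have [] := @cvg_liminf_split _ a b (\int[P]_w (cone_mass (Z w))%:E)%E
  (\int[P]_w iint lebs (fun v => (gap_limit (Z w) v)%:E))%E
  (fine (\int[P]_w (\prod_l expR (- vertex (Z w) l))%:E)%E) a0 b0.
- by apply: integral_ge0.
- by apply: integral_ge0 => w _; exact: iint_ge0.
- rewrite VE; apply: integral_iint_fatou => //; first exact: pmeas_cone_limit.
  by move=> w v; exact: le_limn_einf_cone.
- apply: integral_iint_fatou => //; first exact: pmeas_gap_limit.
  by move=> w v; exact: le_limn_einf_gap.
- by rewrite fineK//; under eq_fun do rewrite abE.
- rewrite fineK// -ge0_integralD//.
  + apply: ge0_le_integral => //.
    * by move=> w _; rewrite lee_fin prodr_ge0// => l _; exact: expR_ge0.
    * by apply/measurable_EFinP; exact: measurable_prod_expR.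
    * apply: emeasurable_funD.
        have := iint_measurable lebs pmeas_cone_limit cl0.
        by under eq_fun do rewrite iint_cone_limit.
      exact: (iint_measurable lebs pmeas_gap_limit gl0).
    * by move=> w _; exact: orthant_le_cone_gap.
  + have := iint_measurable lebs pmeas_cone_limit cl0.
    by under eq_fun do rewrite iint_cone_limit.
  + by move=> w _; exact: iint_ge0.
  + exact: (iint_measurable lebs pmeas_gap_limit gl0).
move=> Vf aV; split => //.
have -> // : (fun k => fine (P (exceed L alpha c (N k))) / \prod_l tail (L (e l)) (kappa (e l) * N k)) =
    (fun k => fine (a k)).
apply/funext => k; rewrite prob_exceed_iint -/(a k).
have p0 : 0 < \prod_l tail (L (e l)) (kappa (e l) * N k) by apply: prodr_gt0.
(* Finiteness has to be shown since [fine] sends an infinite value to 0; it holds because [a k]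
   times a positive number is a probability. *)
have af : a k \is a fin_num.
  rewrite ge0_fin_numE//.
  have : ((\prod_l tail (L (e l)) (kappa (e l) * N k))%:E * a k <= 1)%E.
    rewrite -prob_exceed_iint probability_le1//; exact: measurable_exceed.
  case: (a k) (a0 k) => [x|_|]//; first by rewrite ltry.
  by rewrite gt0_muley ?lte_fin.
by rewrite -(fineK af) -EFinM /= mulrAC mulfV ?mul1r// gt_eqF.
Qed.

End Convergence.

(** Dropping the first [k0] terms makes Potter's bounds valid along the whole sequence and does not
    change the limit. *)
Lemma exceed_cvg (N : nat -> R) : N @ \oo --> +oo ->
  (\int[P]_w (cone_mass (off_supp (fun k => L k w)))%:E \is a fin_num)%E /\
  fine (P (exceed L alpha c (N k))) / \prod_l tail (L (e l)) (kappa (e l) * N k)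
    @[k --> \oo] --> fine (\int[P]_w (cone_mass (off_supp (fun k => L k w)))%:E)%E.
Proof.
move=> N_cvg; have [eta [eta01 small_eta]] := exists_small_eta.
have /choice[C /choice[w0 H]] l := potter (tail_gt0 (e l)) (@tail_le1 _ _ _ _ (L (e l)))
  (@tail_nincr _ _ _ _ (L (e l))) (@tail_rv (e l)) eta01.
have eta0 : 0 < eta by case/andP: eta01.
have : \forall k \near \oo, forall l, w0 l <= kappa (e l) * N k.
  apply: filter_forall => l.
  have kN : kappa (e l) * N k @[k --> \oo] --> +oo.
    exact: (cvg_comp _ _ N_cvg (gt0_cvgMry (supp_idx_gt0 cardJ l) cvg_id)).
  exact: (kN _ (nbhs_pinfty_ge (num_real (w0 l)))).
move=> [k0 _ Hk0].
have N'_cvg : (fun k => N (k + k0)%N) @ \oo --> +oo.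
  exact: (cvg_comp _ _ (cvg_addnr k0) N_cvg).
have [||||Vf Hc] := @exceed_cvg_aux (fun k => N (k + k0)%N) C w0 eta N'_cvg eta0.
- by move=> l; case: (H l).
- by move=> l w h hw; case: (H l) => _; apply.
- exact: small_eta.
- by move=> k l; apply: Hk0 => /=; exact: leq_addl.
split => //; rewrite -(cvg_shiftn k0).
exact: Hc.
Qed.

Lemma moment_fin_num k : k \notin J ->
  (\int[P]_w (expR (moment_exponent alpha A k * L k w))%:E \is a fin_num)%E.
Proof.
move=> kJ; rewrite ge0_fin_numE; last by apply: integral_ge0 => w _; rewrite lee_fin expR_ge0.
have := @exp_moment_lty _ _ _ _ (L k) (@tail_gt0 k) (@tail_rv k)
  (moment_exponent alpha A k) 0 m (lexx _).
rewrite addr0 => /(_ (moment_exponent_lt1 sol uniq cardJ kJ)).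
under eq_integral do rewrite mul0r addr0.
by apply; apply: aeW => w; exact: L_ge.
Qed.

(** [cone_mass] depends on [z] through the exponential of [sum_i colsum_i z_i]. At [z = Z] this sum
    is the combination of the [L k] outside [J] with the moment exponents as coefficients, so
    independence splits the expectation. *)
Lemma integral_cone_mass :
  (\int[P]_w (cone_mass (off_supp (fun k => L k w)))%:E =
   (`|\det A|^-1 * \prod_i (expR (- colsum A i * c i) / colsum A i))%:E *
   \prod_(k | k \notin J) \int[P]_w (expR (moment_exponent alpha A k * L k w))%:E)%E.
Proof.
pose f k (x : mR) : \bar R :=
  if k \notin J then (expR (moment_exponent alpha A k * x))%:E else 1%E.
have mf k : measurable_fun setT (f k).
  rewrite /f; case: (k \notin J); last exact: measurable_cst.
  by apply/measurable_EFinP; apply: measurableT_comp => //; exact: measurable_funM.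
have f0 k x : (0 <= f k x)%E by rewrite /f; case: ifP; rewrite ?lee_fin ?expR_ge0.
set K0 := `|\det A|^-1 * _.
have K00 : 0 <= K0.
  rewrite mulr_ge0 ?invr_ge0// prodr_ge0// => i _.
  by rewrite divr_ge0 ?expR_ge0// ltW// colsum_gt0.
have E w : ((cone_mass (off_supp (fun k => L k w)))%:E = K0%:E * \prod_k f k (L k w))%E.
  have -> : (\prod_k f k (L k w))%E =
      (expR (\sum_(k | k \notin J) moment_exponent alpha A k * L k w))%:E.
    rewrite expR_sum -prodEFin [RHS]big_mkcond /=; apply: eq_bigr => k _.
    by rewrite /f; case: ifP.
  rewrite -EFinM /cone_mass /K0 -mulrA; congr (_ * _)%:E.
  have -> : \sum_(k | k \notin J) moment_exponent alpha A k * L k w =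
      \sum_i colsum A i * off_supp (fun k => L k w) i.
    rewrite /off_supp; under [RHS]eq_bigr do rewrite mulr_sumr.
    rewrite [RHS]exchange_big /=; apply: eq_bigr => k _.
    rewrite /moment_exponent exchange_big /= mulr_suml; apply: eq_bigr => i _.
    by rewrite mulrA; congr (_ * _); rewrite /colsum mulr_suml.
  rewrite expR_sum -big_split /=; apply: eq_bigr => i _.
  by rewrite mulrAC -expRD; congr (expR _ / _); ring.
under eq_integral do rewrite E.
have mL k : measurable_fun setT (fun w => f k (L k w)).
  exact: (measurableT_comp (mf k) (measurable_funPT (borelRV (L k)))).
rewrite ge0_integralZl//; last 2 first.
- by apply: emeasurable_prod.
- by move=> w _; exact: prode_ge0.
rewrite expectation_prod//; congr (_ * _)%E.
rewrite [RHS]big_mkcond /=; apply: eq_bigr => k _; rewrite /f.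
case: ifP => _ //.
by rewrite integral_cst// mul1e; exact: probability_setT.
Qed.

End TailLimit.

(** * Passage to logarithms *)

Section LogTransfer.
Variables (R : realType) (disp : measure_display) (T : measurableType disp).
Variables (P : probability T R) (n : nat) (X : 'I_n -> {RV P >-> R}) (delta : R).
Hypothesis indX : independent_RVs X.
Hypothesis rvX : forall j, regularly_varying_m1 (X j).
Hypothesis delta_gt0 : 0 < delta.
Hypothesis X_ge : forall j, {ae P, forall w, delta <= X j w}.

Let logmax (x : R) : R := ln (Num.max x delta).

Let measurable_logmax : measurable_fun setT logmax.
Proof. by apply: measurableT_comp => //; exact: measurable_maxr. Qed.

(* Truncating at [delta] changes [X j] on a null set only and makes the logarithm
   bounded from below everywhere. *)
Definition logRV (j : 'I_n) : {RV P >-> R} :=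
  HB.pack (fun w => ln (Num.max (X j w) delta) : R)
    (isMeasurableFun.Build _ _ _ _ (fun w => ln (Num.max (X j w) delta) : R)
      (measurableT_comp measurable_logmax (measurable_funPT (X j)))).

Let max_gt0 x : 0 < Num.max x delta.
Proof. by rewrite lt_max delta_gt0 orbT. Qed.

Lemma logRV_ge j w : - - ln delta <= logRV j w.
Proof. by rewrite opprK /= ler_ln ?posrE// le_max lexx orbT. Qed.

Lemma expR_logRV j w : delta <= X j w -> expR (logRV j w) = X j w.
Proof. by move=> dX; rewrite /= lnK ?posrE//; apply/max_idPl. Qed.

Lemma independent_logRV : independent_RVs logRV.
Proof.
move=> K B mB; apply: (indX K (B := fun j => logmax @^-1` B j)) => j.
by rewrite -[X in measurable X]setTI; exact: measurable_logmax.
Qed.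

Lemma ae_prob_eq (A B : set T) : measurable A -> measurable B ->
  {ae P, forall w, A w <-> B w} -> P A = P B.
Proof.
move=> mA mB AB.
rewrite -[X in P X = _]setIT -[X in _ = P X]setIT -!integral_indic//.
apply: ge0_ae_eq_integral => //.
- exact/measurable_EFinP/measurable_indic.
- exact/measurable_EFinP/measurable_indic.
apply: filterS AB => w ABw _; rewrite !indicE; congr (nat_of_bool _)%:R%:E.
by apply/idP/idP; rewrite !inE; apply ABw.
Qed.

Lemma tail_logRV j w : tail (logRV j) w = fine (ccdf (X j) (expR w)).
Proof.
rewrite /tail /ccdf /distribution /pushforward; congr fine.
apply: ae_prob_eq; try exact: measurable_funPTI.
apply: filterS (X_ge j) => t dX.
have : (expR w < X j t) = (w < logRV j t) by rewrite -(expR_logRV dX) ltr_expR.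
by rewrite /= !in_itv /= !andbT => ->.
Qed.

Lemma tail_logRV_gt0 j w : 0 < tail (logRV j) w.
Proof.
rewrite tail_logRV fine_gt0//; have [_ -> _] := rvX j.
by rewrite ltey_eq fin_num_measure.
Qed.

Lemma cvgr_expRy : expR x @[x --> +oo] --> (+oo : set_system R).
Proof.
apply/cvgryPge => M; near=> x.
apply: (@le_trans _ _ (1 + x)); last exact: expR_ge1Dx.
rewrite -lerBlDl; near: x; apply: nbhs_pinfty_ge; exact: num_real.
Unshelve. all: by end_near.
Qed.

Lemma tail_logRV_rv j h :
  tail (logRV j) (w + h) / tail (logRV j) w @[w --> +oo] --> expR (- h).
Proof.
have [_ _ /(_ (expR h) (expR_gt0 h))] := rvX j.
rewrite -expRN => H.
have -> : (fun w => tail (logRV j) (w + h) / tail (logRV j) w) =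
    (fun x => fine (ccdf (X j) (expR h * x)) / fine (ccdf (X j) x)) \o expR.
  by apply/funext => w /=; rewrite !tail_logRV expRD (mulrC (expR w)).
exact: (cvg_comp _ _ cvgr_expRy H).
Qed.

Lemma ae_X_ge : {ae P, forall w, forall j, delta <= X j w}.
Proof.
have H : \forall w \near almost_everywhere P, forall j, delta <= X j w.
  by apply: filter_forall => j; exact: X_ge.
exact: H.
Qed.

Variables (d : nat) (alpha : 'M[R]_(d, n)).

Lemma power_prod_logRV i w : (forall j, delta <= X j w) ->
  power_prod alpha X i w = expR (\sum_j alpha i j * logRV j w).
Proof.
move=> dX; rewrite /power_prod expR_sum; apply: eq_bigr => j _.
rewrite /powR -(expR_logRV (dX j)) gt_eqF ?expR_gt0//.
by rewrite expRK.
Qed.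

Lemma joint_tail_logRV (s : 'I_d -> R) (x : R) : 0 < x -> (forall i, 0 < s i) ->
  joint_tail P (power_prod alpha X) (fun i => s i * x) =
  fine (P (exceed logRV alpha (fun i => ln (s i)) (ln x))).
Proof.
move=> x0 s0; rewrite /joint_tail; congr fine; apply: ae_prob_eq.
- have -> : [set w | forall i, s i * x < power_prod alpha X i w] =
      \bigcap_(i in [set: 'I_d]) (power_prod alpha X i @^-1` `]s i * x, +oo[%classic).
    apply/seteqP; split => w /= H i; first by move=> _; rewrite /= in_itv /= andbT.
    by have := H i I; rewrite /= in_itv /= andbT.
  apply: fin_bigcap_measurable => [|i _]; first exact: finite_finset.
  rewrite -[X in measurable X]setTI.
  have mf : measurable_fun setT (power_prod alpha X i).
    apply: measurable_prod => j _.
    by apply: (measurableT_comp (measurable_powR _)).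
  exact: mf.
- exact: measurable_exceed.
apply: filterS ae_X_ge => w dX; rewrite /exceed /=.
have E i : (s i * x < power_prod alpha X i w) =
    (ln (s i) + ln x < \sum_j alpha i j * logRV j w).
  by rewrite power_prod_logRV// -[RHS]ltr_expR expRD !lnK ?posrE.
by split=> H i; have := H i; rewrite E.
Qed.

Lemma power_moment_logRV k e :
  power_moment (X k) e = (\int[P]_w (expR (e * logRV k w))%:E)%E.
Proof.
rewrite /power_moment unlock; apply: ge0_ae_eq_integral => //.
- by apply/measurable_EFinP; apply: (measurableT_comp (measurable_powR _)).
- by apply/measurable_EFinP; apply: measurableT_comp => //; exact: measurable_funM.
- by move=> w _; rewrite lee_fin powR_ge0.
apply: filterS (X_ge k) => w dX _.
by rewrite /powR -(expR_logRV dX) gt_eqF ?expR_gt0// expRK.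
Qed.

End LogTransfer.

Theorem theorem4p5 (R : realType) (disp : measure_display)
    (T : measurableType disp) (P : probability T R) (d n : nat)
    (alpha : 'M[R]_(d, n)) (X : 'I_n -> {RV P >-> R}) (kappa : 'I_n -> R) :
  (d <= n)%N ->
  independent_RVs X ->
  (forall j, regularly_varying_m1 (X j)) ->
  bounded_away_from0 X ->
  lp_solution alpha kappa ->
  let Y := power_prod alpha X in
  let J := pos_support kappa in
  (forall eps : R, 0 < eps ->
     (fun x : R => joint_tail P Y (fun=> x))
       =o_+oo (fun x : R => x `^ (eps - \sum_j kappa j))
     /\
     (fun x : R => x `^ (- eps - \sum_j kappa j))
       =o_+oo (fun x : R => joint_tail P Y (fun=> x)))
  /\
  ((forall kappa', lp_solution alpha kappa' -> kappa' = kappa) ->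
   forall cardJ : #|J| = d,
     let A := cols_of alpha cardJ in
     A \in unitmx /\
     ((forall l i, 0 < invmx A l i) ->
      (forall k, k \notin J ->
         power_moment (X k) (moment_exponent alpha A k) \is a fin_num)
      /\
      (forall s : 'I_d -> R, (forall i, 0 < s i) ->
         joint_tail P Y (fun i => s i * x) /
           \prod_(j in J) fine (ccdf (X j) (x `^ kappa j))
         @[x --> +oo] -->
         limit_constant alpha X J A *
           \prod_i s i `^ (- \sum_l invmx A l i)))).
Proof.
move=> dn indX rvX [delta delta0 X_ge] sol Y J.
pose L := logRV X delta.
have indL : independent_RVs L by exact: independent_logRV.
have L_ge : forall j w, - - ln delta <= L j w by exact: logRV_ge.
have tail_gt0 := tail_logRV_gt0 rvX delta0 X_ge.
have tail_rv := tail_logRV_rv rvX delta0 X_ge.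
split.
  move=> eps eps0.
  have jt x : 0 < x -> joint_tail P Y (fun=> x) = fine (P (exceed L alpha (fun=> 0) (ln x))).
    move=> x0; have := @joint_tail_logRV _ _ _ _ _ _ _ delta0 X_ge _ alpha (fun=> 1) x x0 (fun _ => ltr01).
    rewrite ln1 => <-; congr joint_tail; apply/funext => i; by rewrite mul1r.
  have jt_ge0 x : 0 <= joint_tail P Y (fun=> x) by rewrite fine_ge0.
  have lnx (N x : R) : expR N < x -> 0 < x /\ N < ln x.
    move=> Nx; have x0 : 0 < x by apply: le_lt_trans Nx; exact: expR_ge0.
    by split=> //; rewrite -(expRK N) ltr_ln ?posrE ?expR_gt0.
  have pw (x a : R) : 0 < x -> x `^ a = expR (a * ln x) by move=> x0; rewrite /powR gt_eqF.
  have eps2 : 0 < eps / 2 by rewrite divr_gt0.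
  split.
  - apply/eqoP => e0 e00.
    have [C [N0 HC]] := prob_exceed_upper indL L_ge tail_gt0 tail_rv sol eps2.
    (* Beyond this point [x^(eps / 2)] exceeds [|C| / e0 + 1], so half of [eps] absorbs the
       constant; the added 1 keeps the argument of the logarithm positive. *)
    exists (expR (Num.max N0 (ln (`|C| / e0 + 1) / (eps / 2)))); split => // x /lnx[x0].
    rewrite gt_max => /andP[/ltW h1]; rewrite ltr_pdivrMr// => h2.
    rewrite !ger0_norm ?powR_ge0// pw// jt// (le_trans (HC _ h1))//.
    have -> : (eps - \sum_j kappa j) * ln x =
        ln x * (eps / 2) + (eps / 2 - \sum_j kappa j) * ln x by field.
    rewrite expRD [leRHS]mulrA ler_pM2r ?expR_gt0//.
    rewrite -ler_pdivrMl// mulrC (@le_trans _ _ (`|C| / e0 + 1))//.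
      by rewrite ler_wpDr// ler_pM2r ?invr_gt0// ler_norm.
    have C0 : 0 < `|C| / e0 + 1 by rewrite ltr_wpDl// divr_ge0// ltW.
    by rewrite -[leLHS](@lnK _ (`|C| / e0 + 1)) ?posrE// ler_expR ltW.
  - apply/eqoP => e0 e00.
    have [c [N0 [c0 Hc]]] := prob_exceed_lower indL tail_gt0 tail_rv sol eps2.
    (* Beyond this point [x^(- eps / 2)] is at most [e0 * c]. *)
    exists (expR (Num.max N0 (- ln (e0 * c) / (eps / 2)))); split => // x /lnx[x0].
    rewrite gt_max => /andP[/ltW h1]; rewrite ltr_pdivrMr// => h2.
    rewrite !ger0_norm ?powR_ge0// pw// jt//.
    rewrite -ler_pdivrMl// (le_trans _ (Hc _ h1))//.
    have -> : (- eps - \sum_j kappa j) * ln x =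
        - (ln x * (eps / 2)) + - ((eps / 2 + \sum_j kappa j) * ln x) by field.
    rewrite expRD [leLHS]mulrA ler_pM2r ?expR_gt0// ler_pdivrMl//.
    have ec0 : 0 < e0 * c by rewrite mulr_gt0.
    by rewrite -[leRHS](@lnK _ (e0 * c)) ?posrE// ler_expR lerNl ltW.
move=> uniq cardJ A.
have uA : A \in unitmx by exact: cols_unit.
split=> // invA_gt0.
have fm k : k \notin J -> power_moment (X k) (moment_exponent alpha A k) \is a fin_num.
  move=> kJ; rewrite (power_moment_logRV delta0 X_ge).
  exact: (moment_fin_num L_ge tail_gt0 tail_rv sol uniq).
split=> // s s0.
have <- : fine (\int[P]_w (cone_mass alpha cardJ (fun i => ln (s i))
      (off_supp alpha kappa (fun k => L k w)))%:E)%E =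
    limit_constant alpha X J A * \prod_i s i `^ (- \sum_l invmx A l i).
  rewrite (integral_cone_mass indL invA_gt0).
  rewrite (eq_bigr (fun k => power_moment (X k) (moment_exponent alpha A k))); last first.
    by move=> k _; rewrite (power_moment_logRV delta0 X_ge).
  rewrite fineM ?fine_prode//; last by apply: prode_fin_num.
  rewrite /= /limit_constant prodf_div -!mulrA; congr (_ * _).
  rewrite mulrCA [RHS]mulrCA; congr (_ * _); rewrite mulrC; congr (_ * _).
  by apply: eq_bigr => i _; rewrite /powR gt_eqF.
(* Fatou's lemma is about sequences, so the limit is tested along sequences tending to infinity. *)
apply/cvg_pinftyP => u u_cvg.
have lnu_cvg : ln (u k) @[k --> \oo] --> +oo.
  apply/cvgryPge => M.
  have H : \forall k \near \oo, expR M <= u k.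
    exact: (u_cvg _ (nbhs_pinfty_ge (num_real (expR M)))).
  near=> k; have uk : expR M <= u k by near: k.
  by rewrite -(expRK M) ler_ln ?posrE ?expR_gt0// (lt_le_trans _ uk) ?expR_gt0.
have [_ Hc] := exceed_cvg indL L_ge tail_gt0 tail_rv sol uniq invA_gt0 (fun i => ln (s i)) lnu_cvg.
apply: cvg_trans Hc; apply: near_eq_cvg.
have H : \forall k \near \oo, 0 < u k.
  exact: (u_cvg _ (nbhs_pinfty_gt (num_real 0))).
near=> k; have uk : 0 < u k by near: k.
rewrite (joint_tail_logRV delta0 X_ge)//; congr (_ / _).
rewrite (prod_supp cardJ); apply: eq_bigr => l _.
by rewrite (tail_logRV delta0 X_ge) /powR gt_eqF.
Unshelve. all: by end_near.
Qed.
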